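(* Let $\pi$ be uniform on $\mathrm{PF}_n$. Then $$\max_{1\le k\le n}\frac{\#\{i:\pi_i\le k\}-k}{\sqrt n}\Longrightarrow M\qquad(n\to\infty),$$ where $M$ is a random variable with $P\{M\le t\}=\sum_{k=-\infty}^{\infty}(1-4k^2t^2)e^{-2k^2t^2}$ for $t>0$.
   Context: A parking function of length $n$ is a sequence $(\pi_1,\dots,\pi_n)$ with $1\le\pi_i\le n$ such that $\#\{t:\pi_t\le i\}\ge i$ for all $1\le i\le n$; $\mathrm{PF}_n$ denotes the set of these. $\Longrightarrow$ denotes convergence in distribution. *)

(* Defs.v *)
From Stdlib Require Import Reals ZArith Arith List.
Import ListNotations.
Open Scope R_scope.

Fixpoint all_seqs (n m : nat) : list (list nat) :=
  match n with
  | O => [[]]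
  | S n' => flat_map (fun x => map (cons x) (all_seqs n' m)) (seq 1 m)
  end.

Definition count_le (p : list nat) (k : nat) : nat :=
  length (filter (fun x => Nat.leb x k) p).

Definition is_pf (n : nat) (p : list nat) : bool :=
  forallb (fun i => Nat.leb i (count_le p i)) (seq 1 n).

(* PF_n, as a duplicate-free list (entries in 1..n, length n). *)
Definition PF (n : nat) : list (list nat) := filter (is_pf n) (all_seqs n n).

Definition maxstat (n : nat) (p : list nat) : Z :=
  fold_right
    (fun k acc => Z.max (Z.of_nat (count_le p k) - Z.of_nat k) acc)
    (Z.of_nat (count_le p n) - Z.of_nat n)%Z
    (seq 1 n).

Definition Xn (n : nat) (p : list nat) : R := IZR (maxstat n p) / sqrt (INR n).

Definition cdf_n (n : nat) (t : R) : R :=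
  INR (length (filter (fun p => if Rle_dec (Xn n p) t then true else false) (PF n)))
  / INR (length (PF n)).

Definition M_term (t : R) (k : Z) : R :=
  (1 - 4 * (IZR k)^2 * t^2) * exp (- (2 * (IZR k)^2 * t^2)).

Definition M_partial (t : R) (N : nat) : R :=
  sum_f_R0 (fun j => M_term t (Z.of_nat j - Z.of_nat N)%Z) (2 * N).

(* Main.v *)
(* Let P_m be the power series whose n-th coefficient is e^(-n)/n! times the number of parking functions
   of length n with maximum at most m.  These are closed walks in the strip [0, m] that go down by at
   most one, so P_m = D_(m+1) / D_(m+2) for explicit truncated Abel sums D_M.  With T the tree function
   and p = exp(T - 1), mirroring the truncated half of D_M gives
     e^M p^M (1 - T) D_M = 1 - p^(2M) - (small),
   so the logarithmic derivative of the left side is minus the image series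
   sum_(i >= 1) 2M n/(n + 2iM) g_(2iM)(n), up to o(1); after scaling its terms tend to
   2t exp(-2 i^2 t^2).  The logarithmic derivative of P_m is monotone in m and equals T/(1 - T) plus a
   first difference in m of these, so its coefficients, divided by those of 1/(1 - T), tend to the
   derivative of t (1 + 2 sum_i exp(-2 i^2 t^2)), the announced distribution function.  Finally
   y P_m' = (y P_m'/P_m) P_m transfers this limit to P_m, all the mass of the convolution sitting near
   the end where the coefficients of P_m have small index. *)
Require Import Defs.
From Stdlib Require Import Reals ZArith Arith List Lia Lra FunctionalExtensionality.
From Coquelicot Require Import Coquelicot.
Open Scope bool_scope.
Open Scope R_scope.

(** * Power series as coefficient sequences *)

(** The obstacle is a mismatch of scales. For m of order sqrt n the n-th coefficient of [lam m] has
    order n^(-1/2), yet it is a difference of two values of [Lam] that are known only up to o(1), so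
    subtracting their asymptotics gives nothing. Monotonicity of [lam] in m repairs this: averaging
    over a window of e sqrt n consecutive m replaces the unit difference by a difference quotient of
    width e, and e is sent to 0 after n. The logarithmic derivative is used because it is both
    additive along P_m = D_(m+1)/D_(m+2) and monotone. The error of the mirroring must therefore be
    o(1) after multiplication by n, with n of order M^2; it comes out as M^(-9/4), which needs both
    the M^(-3) decay of [q] and a balanced cut in the l1 bound of [defect]. *)

Definition fps := nat -> R.
Declare Scope fps_scope.
Delimit Scope fps_scope with FS.
Bind Scope fps_scope with fps.

Definition shift (a : fps) : fps := fun n => match n with O => 0 | S k => a k end.
Definition tl (a : fps) : fps := fun n => a (S n).
Definition cst (c : R) : fps := fun n => match n with O => c | S _ => 0 end.
Definition fadd (a b : fps) : fps := fun n => a n + b n.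
Definition fopp (a : fps) : fps := fun n => - a n.
Definition fsub (a b : fps) : fps := fun n => a n - b n.
(** Peeling off the head coefficient of the left factor makes the product computable by recursion,
    so the ring laws follow by induction on the index without reindexing double sums. [fmul_sum]
    recovers the Cauchy convolution. *)
Fixpoint fmul_coef (n : nat) (a b : fps) : R :=
  match n with
  | O => a O * b O
  | S n' => a O * b n + fmul_coef n' (tl a) b
  end.
Definition fmul (a b : fps) : fps := fun n => fmul_coef n a b.
(** The Euler operator y d/dy: a derivation, like d/dy, but one that does not move indices. *)
Definition theta (a : fps) : fps := fun n => INR n * a n.

Infix "+" := fadd : fps_scope.
Infix "-" := fsub : fps_scope.
Infix "*" := fmul : fps_scope.
Notation "- a" := (fopp a) : fps_scope.

Lemma fmulS (a b : fps) n : (a * b)%FS (S n) = a O * b (S n) + (tl a * b)%FS n.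
Proof. reflexivity. Qed.

Lemma fmul0 (a b : fps) : (a * b)%FS O = a O * b O.
Proof. reflexivity. Qed.

Lemma fmul_sum (a b : fps) n :
  (a * b)%FS n = sum_f_R0 (fun i => a i * b (n - i)%nat) n.
Proof.
  revert a; induction n as [|n IH]; intros a; [reflexivity|].
  rewrite fmulS, IH, (decomp_sum _ (S n)) by lia. reflexivity.
Qed.

Lemma fmul_ext (a a' b b' : fps) n :
  (forall k, (k <= n)%nat -> a k = a' k) -> (forall k, (k <= n)%nat -> b k = b' k) ->
  (a * b)%FS n = (a' * b')%FS n.
Proof.
  intros Ha Hb. rewrite !fmul_sum. apply sum_eq; intros i Hi.
  rewrite Ha, Hb by lia. reflexivity.
Qed.

Lemma fmulDl (a b c : fps) : ((a + b) * c = a * c + b * c)%FS.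
Proof.
  apply functional_extensionality; intros n; revert a b.
  unfold fadd; induction n as [|n IH]; intros a b.
  - rewrite !fmul0; ring.
  - rewrite !fmulS. rewrite <- Rplus_assoc. change (tl (fun k => a k + b k)) with (fun k => tl a k + tl b k).
    rewrite IH; ring.
Qed.

Lemma fmulZl (s : R) (a b : fps) n : ((fun k => s * a k)%R * b)%FS n = s * (a * b)%FS n.
Proof.
  revert a; induction n as [|n IH]; intros a.
  - rewrite !fmul0; ring.
  - rewrite !fmulS. change (tl (fun k => (s * a k)%R)) with (fun k => s * tl a k). rewrite IH; ring.
Qed.

Lemma tl_mul (a b : fps) : tl (a * b)%FS = ((fun k => a O * tl b k)%R + tl a * b)%FS.
Proof. reflexivity. Qed.

Lemma fmulA (a b c : fps) : (a * (b * c) = (a * b) * c)%FS.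
Proof.
  apply functional_extensionality; intros n; revert a b.
  induction n as [|n IH]; intros a b.
  - rewrite !fmul0; ring.
  - rewrite !fmulS, tl_mul, fmulDl. unfold fadd. rewrite fmulZl, IH, fmul0. ring.
Qed.

Lemma fmulS_r (a b : fps) n : (a * b)%FS (S n) = (a * tl b)%FS n + a (S n) * b O.
Proof.
  revert a; induction n as [|n IH]; intros a.
  - rewrite fmulS, !fmul0. unfold tl. ring.
  - rewrite fmulS, IH, fmulS. unfold tl. ring.
Qed.

Lemma fmulC (a b : fps) : (a * b = b * a)%FS.
Proof.
  apply functional_extensionality; intros n; revert a b.
  induction n as [|n IH]; intros a b.
  - rewrite !fmul0; ring.
  - rewrite fmulS, fmulS_r, IH. ring.
Qed.

Lemma fmul1l (a : fps) : (cst 1 * a = a)%FS.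
Proof.
  apply functional_extensionality; intros n.
  destruct n as [|n]; [rewrite fmul0; simpl; ring|].
  rewrite fmulS. replace ((tl (cst 1) * a)%FS n) with 0; [simpl; ring|].
  rewrite fmul_sum. symmetry. apply sum_eq_R0; intros; unfold tl; simpl; ring.
Qed.

Lemma fps_ring_theory : ring_theory (cst 0) (cst 1) fadd fmul fsub fopp (@eq fps).
Proof.
  split; intros; try (apply functional_extensionality; intros n; unfold fadd, fsub, fopp, cst; destruct n; ring).
  - apply fmul1l.
  - apply fmulC.
  - apply fmulA.
  - apply fmulDl.
Qed.
Add Ring fps_ring : fps_ring_theory.

Lemma cst_mul_coef (c : R) (a : fps) n : (cst c * a)%FS n = c * a n.
Proof.
  destruct n as [|n]; [rewrite fmul0; reflexivity|].
  rewrite fmulS. replace ((tl (cst c) * a)%FS n) with 0; [simpl; ring|].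
  rewrite fmul_sum. symmetry. apply sum_eq_R0; intros; unfold tl; simpl; ring.
Qed.

Lemma shift_mul (a b : fps) : (shift a * b = shift (a * b))%FS.
Proof.
  apply functional_extensionality; intros [|n].
  - rewrite fmul0; simpl; ring.
  - rewrite fmulS. simpl. change (tl (shift a)) with a. ring.
Qed.

Lemma thetaB (a b : fps) : (theta (a - b) = theta a - theta b)%FS.
Proof. apply functional_extensionality; intros n; unfold theta, fsub; ring. Qed.

Lemma theta_cst c : theta (cst c) = cst 0.
Proof. apply functional_extensionality; intros [|n]; unfold theta; simpl; ring. Qed.

Lemma thetaM (a b : fps) : (theta (a * b) = theta a * b + a * theta b)%FS.
Proof.
  apply functional_extensionality; intros n. unfold fadd. rewrite !fmul_sum.
  unfold theta at 1. rewrite fmul_sum, scal_sum, <- sum_plus.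
  apply sum_eq; intros i Hi. unfold theta.
  replace (INR n) with (INR i + INR (n - i)) by (rewrite <- plus_INR; f_equal; lia). ring.
Qed.

(** Each coefficient of an inverse depends on all earlier ones, so the recursion runs on a fuel [N].
    The coefficient k is correct as soon as k < [N]; the default [cst 0] is never read by [finv]. *)
Fixpoint inv_iter (a : fps) (N : nat) : fps :=
  match N with
  | O => cst 0
  | S N' => fun k => match k with
                     | O => / a O
                     | S k' => - / a O * (tl a * inv_iter a N')%FS k'
                     end
  end.
Definition finv (a : fps) : fps := fun k => inv_iter a (S k) k.

Lemma inv_iter_stable (a : fps) k N N' :
  (k < N)%nat -> (k < N')%nat -> inv_iter a N k = inv_iter a N' k.
Proof.
  revert N N'; induction k as [k IH] using lt_wf_ind; intros [|N] [|N'] H H'; try lia.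
  destruct k as [|k]; [reflexivity|]. simpl. f_equal.
  apply fmul_ext; intros j Hj; [reflexivity|]. apply IH; lia.
Qed.

Lemma finv_r (a : fps) : a O <> 0 -> (a * finv a)%FS = cst 1.
Proof.
  intros Ha. apply functional_extensionality; intros [|n].
  - rewrite fmul0. unfold finv; simpl. field; auto.
  - rewrite fmulS. 
    change (finv a (S n)) with (- / a O * (tl a * inv_iter a (S n))%FS n).
    rewrite (fmul_ext (tl a) (tl a) (inv_iter a (S n)) (finv a) n); [simpl; field; auto|reflexivity|].
    intros k Hk. apply inv_iter_stable; lia.
Qed.

Lemma fmul_cancel (a b c : fps) : a O <> 0 -> (a * b = a * c)%FS -> b = c.
Proof.
  intros Ha H.
  replace b with ((a * finv a) * b)%FS by (rewrite finv_r by auto; ring).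
  replace ((a * finv a) * b)%FS with (finv a * (a * b))%FS by ring.
  rewrite H.
  replace (finv a * (a * c))%FS with ((a * finv a) * c)%FS by ring.
  rewrite finv_r by auto; ring.
Qed.

(** * Truncated l1 norm and its product inequalities *)

Definition norm1 (a : fps) (n : nat) : R := sum_f_R0 (fun k => Rabs (a k)) n.

Lemma norm1_ge0 (a : fps) n : 0 <= norm1 a n.
Proof. apply cond_pos_sum; intros; apply Rabs_pos. Qed.

Lemma norm1_mono (a : fps) n m : (n <= m)%nat -> norm1 a n <= norm1 a m.
Proof.
  induction 1 as [|m Hm IH]; [lra|]. unfold norm1 in *; simpl.
  pose proof (Rabs_pos (a (S m))); lra.
Qed.

Lemma norm1_add (a b : fps) n : norm1 (a + b)%FS n <= norm1 a n + norm1 b n.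
Proof.
  unfold norm1. rewrite <- sum_plus. apply sum_Rle; intros; apply Rabs_triang.
Qed.

Lemma norm1_sup (a : fps) n c : (forall k, (k <= n)%nat -> Rabs (a k) <= c) -> norm1 a n <= INR (S n) * c.
Proof.
  intros H. unfold norm1.
  apply Rle_trans with (sum_f_R0 (fun _ => c) n); [apply sum_Rle; intros; auto|].
  rewrite sum_cte; lra.
Qed.

Lemma norm1_mul (a b : fps) n : norm1 (a * b)%FS n <= norm1 a n * norm1 b n.
Proof.
  revert a; induction n as [|n IH]; intros a.
  - unfold norm1; cbn [sum_f_R0]. rewrite fmul0, Rabs_mult; lra.
  - unfold norm1 at 1. rewrite decomp_sum by lia. simpl pred.
    assert (E : norm1 a (S n) = Rabs (a O) + norm1 (tl a) n).
    { unfold norm1. rewrite decomp_sum by lia. reflexivity. }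
    rewrite E.
    assert (E' : norm1 b (S n) = Rabs (b O) + norm1 (tl b) n).
    { unfold norm1. rewrite decomp_sum by lia. reflexivity. }
    assert (H : sum_f_R0 (fun i => Rabs ((a * b)%FS (S i))) n
              <= Rabs (a O) * norm1 (tl b) n + norm1 (tl a * b)%FS n).
    { unfold norm1. rewrite scal_sum.
      rewrite <- sum_plus. apply sum_Rle; intros i Hi. rewrite fmulS.
      eapply Rle_trans; [apply Rabs_triang|]. rewrite Rabs_mult. unfold tl at 2. lra. }
    pose proof (IH (tl a)). pose proof (norm1_mono b n (S n) ltac:(lia)).
    pose proof (norm1_ge0 (tl a) n).
    rewrite fmul0, Rabs_mult. rewrite E' in *. nra.
Qed.

Lemma fmul_sup_norm1 (a b : fps) n c :
  (forall k, (k <= n)%nat -> Rabs (a k) <= c) -> Rabs ((a * b)%FS n) <= c * norm1 b n.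
Proof.
  intros H. rewrite fmulC, fmul_sum. unfold norm1. rewrite scal_sum.
  eapply Rle_trans; [apply Rsum_abs|]. apply sum_Rle; intros i Hi.
  rewrite Rabs_mult. apply Rmult_le_compat_l; [apply Rabs_pos|apply H; lia].
Qed.

Lemma fmul_ge0 (a b : fps) : (forall k, 0 <= a k) -> (forall k, 0 <= b k) -> forall k, 0 <= (a * b)%FS k.
Proof.
  intros Ha Hb k. rewrite fmul_sum. apply cond_pos_sum; intros; apply Rmult_le_pos; auto.
Qed.

Lemma fmul_le (a a' b b' : fps) :
  (forall k, 0 <= a k <= a' k) -> (forall k, 0 <= b k <= b' k) ->
  forall k, (a * b)%FS k <= (a' * b')%FS k.
Proof.
  intros Ha Hb k. rewrite !fmul_sum. apply sum_Rle; intros i Hi.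
  apply Rmult_le_compat; try apply Ha; apply Hb.
Qed.

(** * Abel's identity and the tree function *)

(** Up to a factor K! this is the K-th finite difference of a polynomial of degree d < K. The
    induction writes (b+i)^(d+1) as b (b+i)^d + i (b+i)^d and absorbs the factor i into the
    factorial. *)
Lemma signed_power_sum_eq0 d : forall K b, (d < K)%nat ->
  sum_f_R0 (fun i => (-1) ^ (K - i) * (b + INR i) ^ d / (INR (fact i) * INR (fact (K - i)))) K = 0.
Proof.
  induction d as [|d IH]; intros K b HdK.
  - replace 0 with ((1 + -1) ^ K / INR (fact K))
      by (rewrite Rplus_opp_r, pow_i by lia; unfold Rdiv; ring).
    rewrite binomial. unfold Rdiv at 2. rewrite Rmult_comm, scal_sum.
    apply sum_eq; intros i Hi. unfold Binomial.C. rewrite pow1. simpl pow.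
    field; repeat split; apply INR_fact_neq_0.
  - destruct K as [|K]; [lia|].
    set (u := fun i => (-1) ^ (S K - i) * (b + INR i) ^ d / (INR (fact i) * INR (fact (S K - i)))).
    transitivity (b * sum_f_R0 u (S K)
      + sum_f_R0 (fun i => (-1) ^ (K - i) * (b + 1 + INR i) ^ d
                           / (INR (fact i) * INR (fact (K - i)))) K).
    2: { unfold u. rewrite !IH by lia. ring. }
    transitivity (b * sum_f_R0 u (S K) + sum_f_R0 (fun i => INR i * u i) (S K)).
    + rewrite scal_sum, <- sum_plus. apply sum_eq; intros i Hi. unfold u. simpl pow.
      field; split; apply INR_fact_neq_0.
    + f_equal. rewrite decomp_sum by lia. rewrite Rmult_0_l, Rplus_0_l. simpl pred.
      apply sum_eq; intros i Hi. unfold u.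
      replace (S K - S i)%nat with (K - i)%nat by lia.
      rewrite S_INR, fact_simpl, mult_INR, S_INR.
      replace (b + (INR i + 1)) with (b + 1 + INR i) by ring.
      field; repeat split; try apply INR_fact_neq_0. pose proof (pos_INR i); lra.
Qed.

Definition abel_term (b : R) (k : nat) : R := (INR k + b) ^ k / INR (fact k).

Lemma is_derive_sum (f f' : nat -> R -> R) n x :
  (forall i, (i <= n)%nat -> is_derive (f i) x (f' i x)) ->
  is_derive (fun y => sum_f_R0 (fun i => f i y) n) x (sum_f_R0 (fun i => f' i x) n).
Proof.
  induction n as [|n IH]; intros H; simpl; [apply H; lia|].
  apply (is_derive_plus (K := R_AbsRing) (V := R_NormedModule)); [apply IH; intros; apply H; lia|apply H; lia].
Qed.

Lemma is_derive_abel_term k x : is_derive (fun b => abel_term b (S k)) x (abel_term (x + 1) k).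
Proof.
  unfold abel_term.
  assert (Hk : INR (S k) > 0) by (apply lt_0_INR; lia).
  rewrite fact_simpl, mult_INR.
  replace (INR k + (x + 1)) with (INR (S k) + x) by (rewrite S_INR; ring).
  remember (INR (S k)) as s eqn:Es. remember (INR (fact k)) as c eqn:Ec.
  assert (Hc : c <> 0) by (subst; apply INR_fact_neq_0).
  auto_derive; [trivial|]. change (match k with 0%nat => 1 | S _ => INR k + 1 end) with (INR (S k)).
  rewrite <- Es. simpl pred. field; lra.
Qed.

(** Both sides are polynomials in b. Differentiating in b lowers k and replaces b by b + 1, so by
    induction their difference has derivative 0, and one zero suffices. *)
Lemma abel_identity k : forall b,
  sum_f_R0 (fun i => / (1 + INR i) * abel_term 1 i * abel_term b (k - i)) k = abel_term (b + 1) k.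
Proof.
  induction k as [|k IH]; intros b.
  - unfold abel_term; simpl; field.
  - set (h := fun x => sum_f_R0 (fun i => / (1 + INR i) * abel_term 1 i * abel_term x (S k - i)) (S k)
                       - abel_term (x + 1) (S k)).
    assert (Hd : forall x, is_derive h x 0).
    { intros x. unfold h.
      replace 0 with (sum_f_R0 (fun i => match (S k - i)%nat with O => 0 | S j =>
                 / (1 + INR i) * abel_term 1 i * abel_term (x + 1) j end) (S k) - abel_term (x + 1 + 1) k).
      - apply (is_derive_minus (K := R_AbsRing) (V := R_NormedModule)).
        + apply is_derive_sum with (f := fun i x => / (1 + INR i) * abel_term 1 i * abel_term x (S k - i))
            (f' := fun i x => match (S k - i)%nat with O => 0 | S j =>
                 / (1 + INR i) * abel_term 1 i * abel_term (x + 1) j end).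
          intros i Hi. destruct (S k - i)%nat as [|j].
          * unfold abel_term at 2; simpl. auto_derive; [trivial|ring].
          * apply (is_derive_scal (fun x => abel_term x (S j))). apply is_derive_abel_term.
        + evar_last.
          apply (is_derive_comp (fun x => abel_term x (S k)) (fun x => x + 1)).
          apply is_derive_abel_term.
          auto_derive; [trivial|reflexivity].
          unfold scal; simpl; unfold mult; simpl; ring.
      - rewrite <- IH, tech5, Nat.sub_diag, Rplus_0_r.
        apply Rminus_diag_eq. apply sum_eq; intros i Hi.
        replace (S k - i)%nat with (S (k - i)) by lia. reflexivity. }
    (* At b = -(k+2) the right side is a power of 0, and on the left the base attached to i becomes
       -(1+i). The powers combine to (1+i)^k with alternating signs: a finite difference of order
       k+1 of a polynomial of degree k. *)
    set (c := - INR (S (S k))).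
    assert (Hc : h c = 0).
    { unfold h, c. unfold abel_term at 3. rewrite !S_INR.
      replace (INR k + 1 + (- (INR k + 1 + 1) + 1)) with 0 by ring.
      rewrite pow_i by lia. unfold Rdiv at 1. rewrite Rmult_0_l, Rminus_0_r.
      rewrite <- (signed_power_sum_eq0 k (S k) 1) by lia.
      apply sum_eq; intros i Hi. unfold abel_term.
      replace (INR (S k - i) + - (INR k + 1 + 1)) with (-1 * (1 + INR i))
        by (rewrite minus_INR, S_INR by lia; ring).
      rewrite Rpow_mult_distr.
      assert (E : (1 + INR i) ^ i * (1 + INR i) ^ (S k - i) = (1 + INR i) * (1 + INR i) ^ k).
      { rewrite <- pow_add. replace (i + (S k - i))%nat with (S k) by lia. reflexivity. }
      rewrite (Rplus_comm (INR i)).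
      transitivity (/ (1 + INR i) * (-1) ^ (S k - i) * ((1 + INR i) ^ i * (1 + INR i) ^ (S k - i))
                    / (INR (fact i) * INR (fact (S k - i)))).
      - field. repeat split; try apply INR_fact_neq_0. pose proof (pos_INR i); lra.
      - rewrite E. field. repeat split; try apply INR_fact_neq_0. pose proof (pos_INR i); lra. }
    enough (h b = 0) by (unfold h in *; lra).
    destruct (Rtotal_order b c) as [Hb|[->|Hb]]; [|assumption|].
    + rewrite <- Hc. apply (eq_is_derive h b c); auto.
    + rewrite <- Hc. symmetry. apply (eq_is_derive h c b); auto.
Qed.

(* For the tree function T = y exp(T - 1), [p b] is exp(b(T - 1)) and [g b] is exp(b(T - 1)) / (1 - T). *)
Definition g (b : R) : fps := fun k => abel_term b k * exp (- (INR k + b)).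
Definition p (b : R) : fps := fun k => b / (b + INR k) * g b k.

Lemma p1_mul_g b : (p 1 * g b)%FS = g (b + 1).
Proof.
  apply functional_extensionality; intros k. rewrite fmul_sum.
  unfold g at 2. rewrite <- abel_identity, Rmult_comm, scal_sum.
  apply sum_eq; intros i Hi. unfold p, g.
  replace (exp (- (INR k + (b + 1)))) with (exp (- (INR i + 1)) * exp (- (INR (k - i) + b))).
  - unfold Rdiv. ring.
  - rewrite <- exp_plus. f_equal. rewrite minus_INR by lia. ring.
Qed.

(** This is [p b] = (1 - T) [g b]: since T = y exp(T - 1), the product T [g b] is
    [shift (g (b + 1))], and T needs no name of its own. *)
Lemma p_eq b : 0 < b -> p b = (g b - shift (g (b + 1)))%FS.
Proof.
  intros Hb. apply functional_extensionality; intros [|k]; unfold fsub, p; simpl shift.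
  - simpl INR. field; lra.
  - unfold g, abel_term.
    rewrite fact_simpl, mult_INR.
    replace (INR k + (b + 1)) with (INR (S k) + b) by (rewrite S_INR; ring).
    assert (H : INR (S k) > 0) by (apply lt_0_INR; lia).
    replace ((INR (S k) + b) ^ S k) with ((INR (S k) + b) * (INR (S k) + b) ^ k) by reflexivity.
    field. repeat split; try apply INR_fact_neq_0; lra.
Qed.

(* U = 1/(1 - T), V = 1 - T and [q b] = (1 - T) exp(b(T - 1)). *)
Definition U : fps := g 0.
Definition V : fps := (cst 1 - shift (p 1))%FS.
Definition q (b : R) : fps := (p b - shift (p (b + 1)))%FS.

Lemma pow_self_abel k : abel_term 0 (S k) = abel_term 1 k.
Proof.
  unfold abel_term. rewrite fact_simpl, mult_INR.
  replace (INR (S k) + 0) with (INR k + 1) by (rewrite S_INR; ring).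
  rewrite S_INR. simpl pow.
  field. split; [apply INR_fact_neq_0|pose proof (pos_INR k); lra].
Qed.

Lemma U_mul_V : (U * V)%FS = cst 1.
Proof.
  unfold V. replace (U * (cst 1 - shift (p 1)))%FS with (U - shift (p 1) * U)%FS by ring.
  rewrite shift_mul. unfold U. rewrite p1_mul_g.
  apply functional_extensionality; intros [|k]; unfold fsub, shift, g.
  - unfold abel_term; simpl. rewrite Rplus_0_l, Ropp_0, exp_0. field.
  - rewrite pow_self_abel, Rplus_0_l. unfold cst. rewrite Rplus_0_r, S_INR. ring.
Qed.

Lemma p1_mul_p b : 0 < b -> (p 1 * p b)%FS = p (b + 1).
Proof.
  intros Hb. rewrite !p_eq by lra. rewrite <- !p_eq by lra.
  replace (p 1 * p b)%FS with (p 1 * (g b - shift (g (b + 1))))%FS by (rewrite <- p_eq by lra; reflexivity).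
  replace (p 1 * (g b - shift (g (b + 1))))%FS with (p 1 * g b - shift (g (b + 1)) * p 1)%FS by ring.
  rewrite shift_mul, (fmulC (g (b + 1)) (p 1)), !p1_mul_g, <- p_eq by lra. reflexivity.
Qed.

Lemma p_mul a b : (0 < a)%nat -> (0 < b)%nat -> (p (INR a) * p (INR b))%FS = p (INR (a + b)).
Proof.
  intros Ha Hb. induction a as [|a IH]; [lia|].
  destruct a as [|a].
  - simpl INR. rewrite p1_mul_p by (apply lt_0_INR; lia). f_equal. destruct b; [lia|]. reflexivity.
  - rewrite S_INR, <- p1_mul_p by (apply lt_0_INR; lia).
    rewrite <- fmulA, IH, p1_mul_p by (try apply lt_0_INR; lia).
    reflexivity.
Qed.

Lemma p_mul_g a b : (0 < a)%nat -> (p (INR a) * g b)%FS = g (b + INR a).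
Proof.
  intros Ha. induction a as [|a IH]; [lia|].
  destruct a as [|a].
  - simpl INR. apply p1_mul_g.
  - rewrite S_INR, <- p1_mul_p by (apply lt_0_INR; lia).
    rewrite <- fmulA, IH, p1_mul_g by lia. f_equal. ring.
Qed.

Lemma V_mul_p b : 0 < b -> (V * p b)%FS = q b.
Proof.
  intros Hb. unfold V, q. rewrite <- p1_mul_p by lra. rewrite <- shift_mul. ring.
Qed.

Lemma V_mul_g (a : nat) : (0 < a)%nat -> (V * g (INR a))%FS = p (INR a).
Proof.
  intros Ha. rewrite <- (Rplus_0_l (INR a)) at 1. rewrite <- p_mul_g by lia.
  replace (V * (p (INR a) * g 0))%FS with ((U * V) * p (INR a))%FS by (unfold U; ring).
  rewrite U_mul_V. ring.
Qed.

(** The logarithmic derivative of exp(a(T - 1)) is a y T', and T = y exp(T - 1) gives y T' = T/(1 -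
    T) = [U - cst 1]. *)
Lemma theta_p (a : nat) : (0 < a)%nat -> theta (p (INR a)) = (cst (INR a) * ((U - cst 1) * p (INR a)))%FS.
Proof.
  intros Ha.
  replace ((U - cst 1) * p (INR a))%FS with (p (INR a) * g 0 - p (INR a))%FS by (unfold U; ring).
  rewrite p_mul_g, Rplus_0_l by lia.
  apply functional_extensionality; intros k. rewrite cst_mul_coef. unfold theta, fsub, p.
  field. pose proof (lt_0_INR a ltac:(lia)). pose proof (pos_INR k). lra.
Qed.

(** The extra factor 1 - T costs another factor of order 1/(b+k). At the critical scale k ~ b^2 this
    leaves b^(-3), against b^(-2) for [p b]. *)
Lemma q_coef b k : 0 < b -> q b k = (b ^ 2 - INR k) / (b + INR k) ^ 2 * g b k.
Proof.
  intros Hb. unfold q, fsub. destruct k as [|k]; simpl shift.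
  - unfold p. simpl INR. field; lra.
  - unfold p, g, abel_term. rewrite fact_simpl, mult_INR.
    replace (INR k + (b + 1)) with (INR (S k) + b) by (rewrite S_INR; ring).
    replace (b + 1 + INR k) with (b + INR (S k)) by (rewrite S_INR; ring).
    assert (H : INR (S k) > 0) by (apply lt_0_INR; lia).
    replace ((INR (S k) + b) ^ S k) with ((INR (S k) + b) * (INR (S k) + b) ^ k) by reflexivity.
    field. repeat split; try apply INR_fact_neq_0; lra.
Qed.

(** * Counting words in a strip *)

(** The series exp(y/e). Its coefficient a is the weight of a step of the walk at which one letter
    occurs a times, moving the height by a - 1. *)
Definition alpha : fps := fun a => exp (- INR a) / INR (fact a).
Definition Dc (M : nat) : fps := fun k =>
  if (k <? M)%nat then (INR k - INR M) ^ k / INR (fact k) * exp (- INR k) else 0.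

(** The binomial theorem for (1 + (k - M - 1))^k. The step weight a lowers k and M + 1 together, so
    the base k - M - 1 is the same in every term. *)
Lemma Dc_rec M k : (1 <= M)%nat ->
  Dc M k = sum_f_R0 (fun a => alpha a * Dc (M + 1 - a) (k - a)%nat) k.
Proof.
  intros HM. destruct (Nat.le_gt_cases (M + 1) k) as [H|H].
  - unfold Dc at 1. destruct (Nat.ltb_spec k M); [lia|].
    symmetry; apply sum_eq_R0; intros a Ha. unfold Dc.
    destruct (Nat.ltb_spec (k - a) (M + 1 - a)); [lia|ring].
  (* At k = M the truncation sets the value to 0 and the formula gives 0^M = 0 as well, so the
     cutoff does not break the recursion at its edge. *)
  - transitivity ((INR k - INR M) ^ k / INR (fact k) * exp (- INR k)).
    { unfold Dc. destruct (Nat.ltb_spec k M); [reflexivity|].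
      replace k with M by lia. rewrite Rminus_diag, pow_i by lia. unfold Rdiv; ring. }
    replace (INR k - INR M) with (1 + (INR k - INR (M + 1))) by (rewrite plus_INR; simpl; ring).
    rewrite binomial. unfold Rdiv. rewrite Rmult_assoc, Rmult_comm, scal_sum.
    apply sum_eq; intros a Ha. unfold Dc, alpha.
    destruct (Nat.ltb_spec (k - a) (M + 1 - a)); [|lia].
    replace (INR (k - a) - INR (M + 1 - a)) with (INR k - INR (M + 1))
      by (rewrite !minus_INR by lia; ring).
    replace (exp (- INR k)) with (exp (- INR a) * exp (- INR (k - a)))
      by (rewrite <- exp_plus, minus_INR by lia; f_equal; ring).
    unfold Binomial.C. rewrite pow1. field. repeat split; apply INR_fact_neq_0.
Qed.

Definition cnt (P : list nat -> bool) (l : list (list nat)) : R := INR (length (filter P l)).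

Definition egf (P : list nat -> bool) (k : nat) : fps :=
  fun j => cnt P (all_seqs j k) * exp (- INR j) / INR (fact j).

Definition lsum (h : nat -> fps) (l : list nat) : fps := fold_right (fun x acc => fadd (h x) acc) (cst 0) l.

Lemma lsum_app h l l' : lsum h (l ++ l') = fadd (lsum h l) (lsum h l').
Proof. induction l as [|x l IH]; simpl; [ring|]. rewrite IH. ring. Qed.

Lemma lsum_mul a h l : (a * lsum h l = lsum (fun x => a * h x) l)%FS.
Proof. induction l as [|x l IH]; simpl; [ring|]. rewrite <- IH. ring. Qed.

Lemma lsum_coef_ext h h' l j :
  (forall x, In x l -> h x j = h' x j) -> lsum h l j = lsum h' l j.
Proof.
  induction l as [|x l IH]; intros H; simpl; [reflexivity|].
  unfold fadd. f_equal; [apply H; simpl; auto|apply IH; intros; apply H; simpl; auto].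
Qed.

Lemma cnt_app P l l' : cnt P (l ++ l') = cnt P l + cnt P l'.
Proof. unfold cnt. rewrite filter_app, length_app, plus_INR. reflexivity. Qed.

Lemma cnt_map_cons P x l : cnt P (map (cons x) l) = cnt (fun q => P (x :: q)) l.
Proof.
  unfold cnt. induction l as [|q l IH]; simpl; [reflexivity|].
  destruct (P (x :: q)); simpl length; rewrite ?S_INR, IH; reflexivity.
Qed.

Lemma cnt_ext P Q l : (forall q, In q l -> P q = Q q) -> cnt P l = cnt Q l.
Proof. intros H. unfold cnt. do 2 f_equal. apply filter_ext_in; auto. Qed.

(** Removing the first letter of a word is differentiation of the exponential generating
    function. *)
Lemma egf_S P k j :
  INR (S j) * egf P k (S j) = exp (-1) * lsum (fun x => egf (fun q => P (x :: q)) k) (seq 1 k) j.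
Proof.
  unfold egf at 1. cbn [all_seqs].
  assert (H : forall l, cnt P (flat_map (fun x => map (cons x) (all_seqs j k)) l)
      * exp (- INR j) / INR (fact j) = lsum (fun x => egf (fun q => P (x :: q)) k) l j).
  { induction l as [|x l IH]; simpl.
    - replace (cst 0 j) with 0 by (destruct j; reflexivity).
      unfold cnt; simpl. field. apply INR_fact_neq_0.
    - unfold fadd. rewrite <- IH, cnt_app, cnt_map_cons. unfold egf. field. apply INR_fact_neq_0. }
  rewrite <- H, fact_simpl, mult_INR.
  replace (exp (- INR (S j))) with (exp (-1) * exp (- INR j))
    by (rewrite <- exp_plus, S_INR; f_equal; ring).
  field. split; [apply INR_fact_neq_0|apply not_0_INR; lia].
Qed.

Lemma theta_alpha : theta alpha = (cst (exp (-1)) * shift alpha)%FS.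
Proof.
  apply functional_extensionality; intros k. rewrite cst_mul_coef. unfold theta, alpha.
  destruct k as [|k]; simpl shift; [simpl; ring|].
  replace (exp (- INR (S k))) with (exp (-1) * exp (- INR k))
    by (rewrite <- exp_plus, S_INR; f_equal; ring).
  rewrite fact_simpl, mult_INR. field. split; [apply INR_fact_neq_0|apply not_0_INR; lia].
Qed.

Definition low (k : nat) (l : list nat) : list nat := filter (fun x => Nat.leb x k) l.

(* A word over 1..k+1 is a word over 1..k together with the set of positions of the letter k+1. *)
Lemma egf_low k j : forall P, egf (fun l => P (low k l)) (S k) j = (alpha * egf P k)%FS j.
Proof.
  induction j as [|j IH]; intros P.
  - rewrite fmul0. unfold egf, alpha, cnt; simpl. rewrite Ropp_0, exp_0. field.
  (* Multiplying by the index compares derivatives. A first letter k+1 accounts for the derivative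
     of [alpha], a first letter at most k for that of [egf P k]. *)
  - apply Rmult_eq_reg_l with (INR (S j)); [|apply not_0_INR; lia].
    change (INR (S j) * (alpha * egf P k)%FS (S j)) with (theta (alpha * egf P k)%FS (S j)).
    rewrite thetaM, theta_alpha.
    assert (E : theta (egf P k) = (cst (exp (-1)) * shift (lsum (fun x => egf (fun q => P (x :: q)) k) (seq 1 k)))%FS).
    { apply functional_extensionality; intros [|i]; rewrite cst_mul_coef.
      - unfold theta; simpl; ring.
      - unfold theta. rewrite egf_S. reflexivity. }
    rewrite E.
    transitivity ((cst (exp (-1)) * (shift (alpha * egf P k)
      + shift (lsum (fun x => alpha * egf (fun q => P (x :: q)) k) (seq 1 k))))%FS (S j)).
    2: { apply (f_equal (fun s : fps => s (S j))). rewrite <- lsum_mul, (fmulC alpha (lsum _ _)), <- !shift_mul. ring. }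
    rewrite cst_mul_coef, egf_S. f_equal. unfold fadd; simpl shift.
    rewrite seq_S, lsum_app. unfold fadd at 1. rewrite Rplus_comm. f_equal.
    + unfold lsum; cbn [fold_right]. change (1 + k)%nat with (S k). unfold fadd. rewrite <- IH.
      replace (cst 0 j) with 0 by (destruct j; reflexivity). rewrite Rplus_0_r.
      unfold egf. do 2 f_equal. apply cnt_ext; intros q _. unfold low; cbn [filter].
      rewrite (proj2 (Nat.leb_gt (S k) k)) by lia. reflexivity.
    + apply lsum_coef_ext; intros x Hx. apply in_seq in Hx. rewrite <- IH.
      unfold egf. do 2 f_equal. apply cnt_ext; intros q _. unfold low; cbn [filter].
      destruct (Nat.leb_spec x k); [reflexivity|lia].
Qed.

Definition strip (m n : nat) (l : list nat) : bool :=
  forallb (fun i => (i <=? count_le l i)%nat && (count_le l i <=? i + m)%nat) (seq 1 n).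

(** Over the alphabet 1..k all letters are counted at k, so [B m k j] weighs the walks of k steps
    that stay in the strip and end at height j - k. *)
Definition B (m k : nat) : fps := egf (strip m k) k.

Lemma count_le_low k l i : (i <= k)%nat -> count_le (low k l) i = count_le l i.
Proof.
  intros Hi. unfold count_le, low. induction l as [|x l IH]; [reflexivity|]. cbn [filter].
  destruct (Nat.leb_spec x k); destruct (Nat.leb_spec x i) as [H'|H']; try lia; cbn [filter].
  - apply Nat.leb_le in H'. rewrite H'. simpl. auto.
  - apply Nat.leb_gt in H'. rewrite H'. auto.
Qed.

Lemma strip_low m k l : strip m k (low k l) = strip m k l.
Proof.
  unfold strip.
  assert (H : forall s, (forall i, In i s -> (i <= k)%nat) ->
    forallb (fun i => (i <=? count_le (low k l) i)%nat && (count_le (low k l) i <=? i + m)%nat) s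
    = forallb (fun i => (i <=? count_le l i)%nat && (count_le l i <=? i + m)%nat) s).
  { induction s as [|i s IH]; intros Hs; [reflexivity|]. simpl.
    rewrite count_le_low by (apply Hs; simpl; auto). rewrite IH by (intros; apply Hs; simpl; auto).
    reflexivity. }
  apply H. intros i Hi. apply in_seq in Hi. lia.
Qed.

Lemma all_seqs_spec j k l : In l (all_seqs j k) -> length l = j /\ forall x, In x l -> (1 <= x <= k)%nat.
Proof.
  revert l; induction j as [|j IH]; intros l; simpl.
  - intros [<-|[]]; split; [reflexivity|intros x []].
  - rewrite in_flat_map. intros [x [Hx Hl]]. apply in_map_iff in Hl as [l' [<- Hl']].
    apply IH in Hl' as [H1 H2]. apply in_seq in Hx. simpl. split; [lia|].
    intros y [<-|Hy]; [lia|auto].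
Qed.

Lemma count_le_all j k l : In l (all_seqs j k) -> count_le l k = j.
Proof.
  intros H. apply all_seqs_spec in H as [<- H]. unfold count_le.
  induction l as [|x l IH]; [reflexivity|]. cbn [filter].
  destruct (Nat.leb_spec x k) as [Hx|Hx].
  - simpl. rewrite IH by (intros; apply H; simpl; auto). reflexivity.
  - specialize (H x (or_introl eq_refl)); lia.
Qed.

Lemma B_0 m : B m 0 = cst 1.
Proof.
  apply functional_extensionality; intros [|j]; unfold B, egf, cnt; simpl.
  - rewrite Ropp_0, exp_0. field.
  - unfold Rdiv; ring.
Qed.

(** One step of the walk, killed outside the strip: the earlier conditions see only letters at most
    k, and the new one depends on the length j alone. *)
Lemma B_S m k j :
  B m (S k) j = if ((S k <=? j) && (j <=? S k + m))%nat then (alpha * B m k)%FS j else 0.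
Proof.
  unfold B. rewrite <- egf_low. unfold egf.
  rewrite (cnt_ext (strip m (S k))
     (fun l => strip m k (low k l) && ((S k <=? j)%nat && (j <=? S k + m)%nat))).
  - destruct ((S k <=? j)%nat && (j <=? S k + m)%nat).
    + do 2 f_equal. apply cnt_ext; intros l _. apply Bool.andb_true_r.
    + replace (cnt _ _) with 0; [unfold Rdiv; ring|].
      unfold cnt. rewrite (filter_ext_in _ (fun _ => false)).
      * induction (all_seqs j (S k)); simpl; auto.
      * intros; apply Bool.andb_false_r.
  - intros l Hl. rewrite strip_low. unfold strip. rewrite seq_S, forallb_app. f_equal.
    cbn [forallb]. rewrite Bool.andb_true_r. change (1 + k)%nat with (S k).
    rewrite (count_le_all _ _ _ Hl). reflexivity.
Qed.

Lemma B_support m k j : (j < k \/ k + m < j)%nat -> B m k j = 0.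
Proof.
  intros H. destruct k as [|k].
  - rewrite B_0. destruct j; [lia|reflexivity].
  - rewrite B_S. destruct (Nat.leb_spec (S k) j); destruct (Nat.leb_spec j (S k + m)); simpl; auto; lia.
Qed.

Lemma B_ge0 m k j : 0 <= B m k j.
Proof.
  unfold B, egf, cnt. apply Rmult_le_pos; [apply Rmult_le_pos; [apply pos_INR|apply Rlt_le, exp_pos]|].
  apply Rlt_le, Rinv_0_lt_compat, INR_fact_lt_0.
Qed.

Lemma cnt_mono (P Q : list nat -> bool) l : (forall q, P q = true -> Q q = true) -> cnt P l <= cnt Q l.
Proof.
  intros H. unfold cnt. apply le_INR. induction l as [|x l IH]; simpl; [lia|].
  destruct (P x) eqn:E; [rewrite (H _ E); simpl; lia|]. destruct (Q x); simpl; lia.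
Qed.

Lemma B_mono m k j : B m k j <= B (S m) k j.
Proof.
  unfold B, egf, Rdiv. apply Rmult_le_compat_r; [apply Rlt_le, Rinv_0_lt_compat, INR_fact_lt_0|].
  apply Rmult_le_compat_r; [apply Rlt_le, exp_pos|].
  apply cnt_mono. intros l. unfold strip. rewrite !forallb_forall. intros H x Hx.
  specialize (H x Hx). apply andb_prop in H as [H1 H2]. rewrite H1. simpl.
  apply Nat.leb_le in H2. apply Nat.leb_le. lia.
Qed.

(** Duality: convolution with the step weights is moved from the distribution of the walk onto the
    test function. *)
Lemma sum_conv_swap n : forall (a b : fps) (c : nat -> R),
  sum_f_R0 (fun j => (a * b)%FS j * c j) n
  = sum_f_R0 (fun i => a i * sum_f_R0 (fun r => b r * c (i + r)%nat) (n - i)) n.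
Proof.
  induction n as [|n IH]; intros a b c.
  - cbn [sum_f_R0 Nat.sub Nat.add]. rewrite fmul0. ring.
  - rewrite (decomp_sum (fun i => a i * _)) by lia. simpl pred. simpl Nat.sub at 1.
    transitivity (a O * sum_f_R0 (fun r => b r * c r) (S n)
                  + sum_f_R0 (fun j => (tl a * b)%FS j * c (S j)) n).
    + rewrite (decomp_sum (fun j => (a * b)%FS j * c j)) by lia.
      rewrite (decomp_sum (fun r => b r * c r)) by lia. simpl pred.
      rewrite Rmult_plus_distr_l, scal_sum, Rplus_assoc, <- sum_plus. f_equal.
      * rewrite fmul0; ring.
      * apply sum_eq; intros j Hj. rewrite fmulS. ring.
    + f_equal. rewrite IH. apply sum_eq; intros i Hi. reflexivity.
Qed.

Definition Pm (m : nat) : fps := fun k => B m k k.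

(* [Dc] is harmonic for the step weights alpha and vanishes above the strip, so its expected value
   along the walk only changes when the walk steps below 0. *)
Lemma Pm_mul_Dc m : (Pm m * Dc (m + 2))%FS = Dc (m + 1).
Proof.
  apply functional_extensionality; intros n.
  set (Phi := fun k => sum_f_R0 (fun j => B m k j * Dc (m + 1 + k - j) (n - j)%nat) n).
  (* A walk leaving above lands where the index of [Dc] is 0, hence contributes nothing. One leaving
     below comes from height 0, that is j = k, by a step without letters of weight [alpha 0] = 1,
     and carries [Dc (m + 2)]. *)
  assert (Hstep : forall k, (k <= n)%nat -> Phi k = Phi (S k) + Pm m k * Dc (m + 2) (n - k)%nat).
  { intros k Hk.
    transitivity (sum_f_R0 (fun j => (B m k * alpha)%FS j * Dc (m + 2 + k - j) (n - j)%nat) n).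
    - rewrite sum_conv_swap. unfold Phi. apply sum_eq; intros i Hi.
      destruct (Nat.le_gt_cases i (k + m)) as [Hi'|Hi'].
      + f_equal. rewrite Dc_rec by lia. apply sum_eq; intros r Hr. do 2 f_equal; lia.
      + rewrite B_support by lia. ring.
    - unfold Phi.
      transitivity (sum_f_R0 (fun j => B m (S k) j * Dc (m + 1 + S k - j) (n - j)%nat
         + (if Nat.eqb j k then Pm m k * Dc (m + 2) (n - k)%nat else 0)) n).
      + apply sum_eq; intros j Hj. rewrite B_S, fmulC.
        replace (m + 1 + S k - j)%nat with (m + 2 + k - j)%nat by lia.
        destruct (Nat.leb_spec (S k) j) as [H1|H1].
        * destruct (Nat.eqb_spec j k); [lia|].
          destruct (Nat.leb_spec j (S k + m)) as [H2|H2]; simpl andb; cbv iota; [ring|].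
          replace (m + 2 + k - j)%nat with 0%nat by lia. unfold Dc. simpl. ring.
        * simpl andb. cbv iota. destruct (Nat.eqb_spec j k) as [->|Hjk].
          -- replace (m + 2 + k - k)%nat with (m + 2)%nat by lia.
             replace ((alpha * B m k)%FS k) with (Pm m k); [ring|].
             rewrite fmulC, fmul_sum. destruct k as [|k].
             ++ simpl. unfold Pm, alpha; simpl. rewrite Ropp_0, exp_0. field.
             ++ rewrite tech5, sum_eq_R0, Nat.sub_diag by (intros; rewrite B_support by lia; ring).
                unfold Pm, alpha; simpl. rewrite Ropp_0, exp_0. field.
          -- rewrite fmulC, fmul_sum, sum_eq_R0; [ring|].
             intros i Hi; rewrite B_support by lia; ring.
      + rewrite sum_plus. f_equal. clear Phi. revert Hk. generalize (Pm m k * Dc (m + 2) (n - k)%nat) as c.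
        intros c Hk. induction n as [|n' IH].
        * simpl. destruct k; [reflexivity|lia].
        * rewrite tech5. destruct (Nat.eqb_spec (S n') k) as [E|E].
          -- rewrite sum_eq_R0; [ring|]. intros i Hi. destruct (Nat.eqb_spec i k); [lia|reflexivity].
          -- rewrite IH by lia. ring. }
  assert (H0 : Phi O = Dc (m + 1) n).
  { unfold Phi. rewrite B_0. destruct n as [|n'].
    - simpl. rewrite Nat.add_0_r, Nat.sub_0_r. ring.
    - rewrite decomp_sum by lia. rewrite sum_eq_R0 by (intros; simpl; ring).
      rewrite Nat.add_0_r, !Nat.sub_0_r. simpl cst. ring. }
  assert (Hend : Phi (S n) = 0).
  { unfold Phi. apply sum_eq_R0; intros j Hj. rewrite B_support by lia. ring. }
  rewrite <- H0, fmul_sum.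
  assert (Hsum : forall k, (k <= n)%nat ->
     Phi O = Phi (S k) + sum_f_R0 (fun i => Pm m i * Dc (m + 2) (n - i)%nat) k).
  { induction k as [|k IH]; intros Hk.
    - simpl sum_f_R0. rewrite Nat.sub_0_r. rewrite Hstep by lia. rewrite Nat.sub_0_r. ring.
    - rewrite tech5. rewrite IH, Hstep by lia. ring. }
  rewrite (Hsum n) by lia. rewrite Hend. ring.
Qed.

(** * Logarithmic derivatives *)

(** The formal sum of y^b u_b; only b <= k reaches the coefficient k. *)
Definition diag_sum (u : nat -> fps) : fps := fun k => sum_f_R0 (fun b => u b (k - b)%nat) k.

Lemma diag_sum_mul (c : fps) k : forall u : nat -> fps,
  (diag_sum u * c)%FS k = diag_sum (fun b => (u b * c)%FS) k.
Proof.
  assert (E : forall u, diag_sum u = (u O + shift (diag_sum (fun b => u (S b))))%FS).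
  { intros u. apply functional_extensionality; intros [|j]; unfold fadd, diag_sum; simpl shift.
    - cbn [sum_f_R0 Nat.sub]. ring.
    - rewrite decomp_sum by lia. reflexivity. }
  induction k as [|k IH]; intros u; rewrite (E u), (E (fun b => (u b * c)%FS)), fmulDl, shift_mul;
    unfold fadd; simpl shift; [reflexivity|rewrite IH; reflexivity].
Qed.

(** The product P_(m-1) ... P_(m-b) weighs the descents from height b to a first visit of 0: at each
    level i an excursion above i, in a strip of width m - i, precedes the next step down. Heights b
    > m are outside the strip. *)
Fixpoint Pprod (m b : nat) : fps :=
  match b with
  | O => cst 1
  | S b' => if (S b' <=? m)%nat then (Pm (m - S b') * Pprod m b')%FS else cst 0
  end.

(* 1/P_m = 1 - Q_m with nonnegative coefficients that increase with m; this is what makes the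
   logarithmic derivative [lam m] of P_m monotone in m. *)
Definition Qm (m : nat) : fps := shift (diag_sum (fun b => (cst (alpha (S b)) * Pprod m b)%FS)).

Lemma Dc_Pprod m b : Dc (m + 1 - b) = (Pprod m b * Dc (m + 1))%FS.
Proof.
  induction b as [|b IH]; cbn [Pprod].
  - rewrite Nat.sub_0_r. ring.
  - destruct (Nat.leb_spec (S b) m).
    + rewrite <- fmulA, <- IH.
      replace (m + 1 - b)%nat with (m - S b + 2)%nat by lia. rewrite Pm_mul_Dc.
      f_equal. lia.
    + replace (m + 1 - S b)%nat with O by lia.
      transitivity (cst 0); [|ring].
      apply functional_extensionality; intros [|k]; unfold Dc; simpl; reflexivity.
Qed.

Lemma Dc_0 M : (1 <= M)%nat -> Dc M O = 1.
Proof.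
  intros HM. unfold Dc. destruct (Nat.ltb_spec 0 M); [|lia]. simpl. rewrite Ropp_0, exp_0. field.
Qed.

(** In the harmonic recursion the step a = 0 yields [Dc (m + 2)]; the step a = b + 1 goes up to
    height b and [Dc_Pprod] rewrites its term. Thus [Qm] is the weight of walks up to their first
    return to 0. *)
Lemma Dc_Qm m : Dc (m + 1) = (Dc (m + 2) + Qm m * Dc (m + 1))%FS.
Proof.
  apply functional_extensionality; intros k. unfold Qm, fadd.
  rewrite shift_mul, Dc_rec by lia. replace (m + 1 + 1)%nat with (m + 2)%nat by lia.
  destruct k as [|k]; simpl shift.
  - cbn [sum_f_R0 Nat.sub]. rewrite Nat.sub_0_r. unfold alpha; simpl. rewrite Ropp_0, exp_0. field.
  - rewrite decomp_sum by lia. f_equal.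
    + rewrite !Nat.sub_0_r. unfold alpha; simpl INR; simpl fact. rewrite Ropp_0, exp_0. simpl INR. field.
    + rewrite diag_sum_mul. apply sum_eq; intros b Hb.
      rewrite <- fmulA, cst_mul_coef, <- Dc_Pprod.
      replace (m + 2 - S b)%nat with (m + 1 - b)%nat by lia. reflexivity.
Qed.

Lemma Pm_Qm m : (Pm m * (cst 1 - Qm m))%FS = cst 1.
Proof.
  apply (fmul_cancel (Dc (m + 1))); [rewrite Dc_0 by lia; lra|].
  transitivity (Pm m * (Dc (m + 1) - Qm m * Dc (m + 1)))%FS; [ring|].
  rewrite Dc_Qm at 1.
  transitivity (Pm m * Dc (m + 2))%FS; [ring|]. rewrite Pm_mul_Dc. ring.
Qed.

Definition lam (m : nat) : fps := (theta (Qm m) * Pm m)%FS.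

Lemma theta_Pm m : theta (Pm m) = (lam m * Pm m)%FS.
Proof.
  pose proof (f_equal theta (Pm_Qm m)) as H.
  rewrite thetaM, thetaB, !theta_cst in H.
  unfold lam.
  transitivity (theta (Pm m) * (Pm m * (cst 1 - Qm m)))%FS; [rewrite Pm_Qm; ring|].
  transitivity (Pm m * (theta (Pm m) * (cst 1 - Qm m) + Pm m * (cst 0 - theta (Qm m)))
                + theta (Qm m) * Pm m * Pm m)%FS; [ring|].
  rewrite H. ring.
Qed.

Lemma Pm_ge0 m k : 0 <= Pm m k.
Proof. apply B_ge0. Qed.

Lemma Pm_mono m k : Pm m k <= Pm (S m) k.
Proof. apply B_mono. Qed.

Lemma cst_ge0 c k : 0 <= c -> 0 <= cst c k.
Proof. destruct k; simpl; lra. Qed.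

Lemma Pprod_ge0 m b k : 0 <= Pprod m b k.
Proof.
  revert k; induction b as [|b IH]; intros k; cbn [Pprod]; [apply cst_ge0; lra|].
  destruct (S b <=? m)%nat; [apply fmul_ge0; auto; apply Pm_ge0|apply cst_ge0; lra].
Qed.

Lemma Pprod_mono m b k : Pprod m b k <= Pprod (S m) b k.
Proof.
  revert k; induction b as [|b IH]; intros k; cbn [Pprod]; [lra|].
  destruct (Nat.leb_spec (S b) m).
  - destruct (Nat.leb_spec (S b) (S m)); [|lia].
    apply fmul_le; intros j; split; auto using Pm_ge0, Pprod_ge0.
    replace (S m - S b)%nat with (S (m - S b)) by lia. apply Pm_mono.
  - replace (cst 0 k) with 0 by (destruct k; reflexivity). apply (Pprod_ge0 (S m) (S b)).
Qed.

Lemma alpha_ge0 a : 0 <= alpha a.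
Proof.
  unfold alpha. apply Rmult_le_pos; [apply Rlt_le, exp_pos|apply Rlt_le, Rinv_0_lt_compat, INR_fact_lt_0].
Qed.

Lemma Qm_ge0_mono m k : 0 <= Qm m k <= Qm (S m) k.
Proof.
  unfold Qm. destruct k as [|k]; simpl shift; [lra|]. unfold diag_sum. split.
  - apply cond_pos_sum; intros b. rewrite cst_mul_coef.
    apply Rmult_le_pos; [apply alpha_ge0|apply Pprod_ge0].
  - apply sum_Rle; intros b Hb. rewrite !cst_mul_coef.
    apply Rmult_le_compat_l; [apply alpha_ge0|apply Pprod_mono].
Qed.

Lemma lam_ge0 m k : 0 <= lam m k.
Proof.
  apply fmul_ge0; [|apply Pm_ge0]. intros j. unfold theta.
  apply Rmult_le_pos; [apply pos_INR|apply Qm_ge0_mono].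
Qed.

Lemma lam_mono m k : lam m k <= lam (S m) k.
Proof.
  apply fmul_le; intros j; [|split; [apply Pm_ge0|apply Pm_mono]].
  unfold theta. pose proof (Qm_ge0_mono m j). pose proof (pos_INR j). split; nra.
Qed.

(* [defect M] is the error made in replacing the upper (overshooting) half of the signed sum [Dc M]
   by its mirror image [g M]. *)
Definition defect (M : nat) : fps := fun k =>
  (if (k <? M)%nat then 0 else g (- INR M) k) - g (INR M) k.

Lemma Dc_eq M : (cst (exp (INR M)) * Dc M = g (- INR M) - g (INR M) - defect M)%FS.
Proof.
  apply functional_extensionality; intros k. rewrite cst_mul_coef.
  unfold fsub, defect, Dc. destruct (Nat.ltb_spec k M).
  - unfold g, abel_term.
    replace (exp (- (INR k + - INR M))) with (exp (INR M) * exp (- INR k))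
      by (rewrite <- exp_plus; f_equal; ring).
    unfold Rminus. ring.
  - ring.
Qed.

Definition Y (M : nat) : fps := (V * p (INR M) * (cst (exp (INR M)) * Dc M))%FS.

Lemma V_p_g M : (1 <= M)%nat -> (V * p (INR M) * g (- INR M))%FS = cst 1.
Proof.
  intros HM. rewrite <- fmulA, p_mul_g, Rplus_opp_l, fmulC by lia. apply U_mul_V.
Qed.

(** The factor [V * p (INR M)] inverts [g (- INR M)], turns the mirror image [g (INR M)] into
    [p (INR (2 * M))], and equals [q (INR M)] in front of the defect. *)
Lemma Y_eq M : (1 <= M)%nat ->
  Y M = (cst 1 - p (INR (2 * M)) - q (INR M) * defect M)%FS.
Proof.
  intros HM. unfold Y. rewrite Dc_eq.
  assert (HM' : 0 < INR M) by (apply lt_0_INR; lia).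
  rewrite <- V_mul_p by auto. rewrite <- (V_p_g M) by auto.
  rewrite <- (V_mul_g (2 * M)) by lia.
  replace (INR (2 * M)) with (INR M + INR M) by (rewrite mult_INR; simpl; ring).
  rewrite <- p_mul_g by lia. ring.
Qed.

(** Below M the truncation of [Dc M] is invisible, so [Y M] looks like
    [V * p (INR M) * g (- INR M)], which is 1. *)
Lemma Y_low M k : (k < M)%nat -> Y M k = cst 1 k.
Proof.
  intros Hk. rewrite <- (V_p_g M) by lia. unfold Y.
  apply fmul_ext; intros j Hj; [reflexivity|]. rewrite cst_mul_coef.
  unfold Dc. destruct (Nat.ltb_spec j M); [|lia].
  unfold g, abel_term.
  replace (exp (- (INR j + - INR M))) with (exp (INR M) * exp (- INR j))
    by (rewrite <- exp_plus; f_equal; ring).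
  unfold Rminus. ring.
Qed.

Lemma Y_Pm m : (Y (m + 2) * Pm m = cst (exp 1) * p 1 * Y (m + 1))%FS.
Proof.
  unfold Y. rewrite <- (Pm_mul_Dc m).
  replace (INR (m + 2)) with (INR (m + 1) + 1) by (rewrite !plus_INR; simpl; ring).
  rewrite <- p1_mul_p by (apply lt_0_INR; lia).
  replace (cst (exp (INR (m + 1) + 1))) with (cst (exp (INR (m + 1))) * cst (exp 1))%FS; [ring|].
  apply functional_extensionality; intros k. rewrite cst_mul_coef, exp_plus.
  destruct k; simpl; ring.
Qed.

Definition Lam (M : nat) : fps := (theta (Y M) * finv (Y M))%FS.

Lemma theta_Y M : (1 <= M)%nat -> theta (Y M) = (Lam M * Y M)%FS.
Proof.
  intros HM. unfold Lam. transitivity (theta (Y M) * (Y M * finv (Y M)))%FS; [|ring].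
  rewrite finv_r by (rewrite Y_low by lia; simpl; lra). ring.
Qed.

(** Logarithmic derivative of [Y_Pm]; the factor [p 1] contributes [U - cst 1]. *)
Lemma lam_eq m : lam m = (U - cst 1 + Lam (m + 1) - Lam (m + 2))%FS.
Proof.
  apply (fmul_cancel (Y (m + 2) * Pm m)%FS).
  { rewrite fmul0, Y_low by lia. unfold Pm. rewrite B_0. simpl. lra. }
  pose proof (f_equal theta (Y_Pm m)) as H.
  rewrite !thetaM, theta_Pm, !theta_Y, theta_cst in H by lia.
  pose proof (theta_p 1 ltac:(lia)) as Hp. simpl INR in Hp. rewrite Hp in H.
  transitivity ((Lam (m + 2) * Y (m + 2) * Pm m + Y (m + 2) * (lam m * Pm m))
     - Lam (m + 2) * (Y (m + 2) * Pm m))%FS; [ring|].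
  rewrite H, Y_Pm. ring.
Qed.

Lemma Lam_low M k : (k < M)%nat -> Lam M k = 0.
Proof.
  intros Hk. unfold Lam. rewrite fmul_sum. apply sum_eq_R0; intros i Hi.
  unfold theta. rewrite Y_low by lia. destruct i; simpl; ring.
Qed.

Lemma lam_low m k : (k <= m)%nat -> lam m k = (U - cst 1)%FS k.
Proof.
  intros Hk. rewrite lam_eq. unfold fsub, fadd. rewrite !Lam_low by lia. ring.
Qed.

(** A closed walk of length k <= m cannot exceed m, so this is the full count: e times [p 1 k]
    equals (k+1)^(k-1) e^(-k)/k!. The number of parking functions is thus a by-product of
    [Y_low]. *)
Lemma Pm_low m k : (k <= m)%nat -> Pm m k = exp 1 * p 1 k.
Proof.
  intros Hk. rewrite <- cst_mul_coef.
  transitivity ((Y (m + 2) * Pm m)%FS k).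
  - transitivity ((cst 1 * Pm m)%FS k); [rewrite fmul1l; reflexivity|]. apply fmul_ext; intros j Hj; [rewrite Y_low by lia|]; reflexivity.
  - rewrite Y_Pm, fmulC. transitivity ((cst 1 * (cst (exp 1) * p 1))%FS k).
    + apply fmul_ext; intros j Hj; [rewrite Y_low by lia|]; reflexivity.
    + rewrite fmul1l. reflexivity.
Qed.

Lemma lam_le m k : lam m k <= (U - cst 1)%FS k.
Proof.
  rewrite <- (lam_low (m + k)) by lia.
  assert (H : forall j, lam m k <= lam (m + j) k); [|apply H].
  induction j as [|j IH].
  - rewrite Nat.add_0_r; lra.
  - rewrite Nat.add_succ_r. eapply Rle_trans; [apply IH|apply lam_mono].
Qed.

Lemma Pm_le m k : Pm m k <= exp 1 * p 1 k.
Proof.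
  rewrite <- (Pm_low (m + k)) by lia.
  assert (H : forall j, Pm m k <= Pm (m + j) k); [|apply H].
  induction j as [|j IH].
  - rewrite Nat.add_0_r; lra.
  - rewrite Nat.add_succ_r. eapply Rle_trans; [apply IH|apply Pm_mono].
Qed.

(** * Estimates on coefficients *)

Lemma nonneg_of_derive (f f' : R -> R) u :
  0 <= u -> f 0 = 0 ->
  (forall x, 0 <= x <= u -> is_derive f x (f' x)) -> (forall x, 0 <= x <= u -> 0 <= f' x) -> 0 <= f u.
Proof.
  intros Hu H0 Hd Hp.
  destruct (MVT_gen f 0 u f') as [c [Hc E]]; rewrite ?Rmin_left, ?Rmax_right in * by lra.
  - intros x Hx. apply Hd; lra.
  - intros x Hx. apply continuity_pt_filterlim. apply (ex_derive_continuous f x).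
    exists (f' x). apply Hd; lra.
  - specialize (Hp c Hc). rewrite H0 in E. nra.
Qed.

(** The trapezoidal rule for the convex function 1/(1+x). It gives the Gaussian exponent
    -b^2/(2(b+k)) uniformly in b and k. *)
Lemma ln_1p_upper u : 0 <= u -> ln (1 + u) <= (u + u / (1 + u)) / 2.
Proof.
  intros Hu.
  enough (0 <= (u + u / (1 + u)) / 2 - ln (1 + u)) by lra.
  apply (nonneg_of_derive (fun u => (u + u / (1 + u)) / 2 - ln (1 + u))
           (fun x => x ^ 2 / (2 * (1 + x) ^ 2)) u); auto.
  - rewrite Rplus_0_r, ln_1. field.
  - intros x Hx. auto_derive; [repeat split; lra|]. field; lra.
  - intros x Hx. apply Rmult_le_pos; [apply pow2_ge_0|].
    apply Rlt_le, Rinv_0_lt_compat. nra.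
Qed.

Lemma ln_1p_lower u : 0 <= u -> 2 * u / (2 + u) <= ln (1 + u).
Proof.
  intros Hu.
  enough (0 <= ln (1 + u) - 2 * u / (2 + u)) by lra.
  apply (nonneg_of_derive (fun u => ln (1 + u) - 2 * u / (2 + u))
           (fun x => x ^ 2 / ((1 + x) * (2 + x) ^ 2)) u); auto.
  - rewrite Rplus_0_r, ln_1. field.
  - intros x Hx. auto_derive; [repeat split; lra|]. field; lra.
  - intros x Hx. apply Rmult_le_pos; [apply pow2_ge_0|].
    apply Rlt_le, Rinv_0_lt_compat. apply Rmult_lt_0_compat; nra.
Qed.

Lemma ln_1p_lower2 u : 0 <= u -> u - u ^ 2 / 2 <= ln (1 + u).
Proof.
  intros Hu.
  enough (0 <= ln (1 + u) - (u - u ^ 2 / 2)) by lra.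
  apply (nonneg_of_derive (fun u => ln (1 + u) - (u - u ^ 2 / 2))
           (fun x => x ^ 2 / (1 + x)) u); auto.
  - rewrite Rplus_0_r, ln_1. field.
  - intros x Hx. auto_derive; [repeat split; lra|]. field; lra.
  - intros x Hx. apply Rmult_le_pos; [apply pow2_ge_0|].
    apply Rlt_le, Rinv_0_lt_compat. lra.
Qed.

(** The even powers of u cancel between the two logarithms. This is why a term and its mirror image
    agree to third order in M/k. *)
Lemma ln_ratio_bounds u : 0 <= u <= 1 / 2 -> 0 <= ln (1 + u) - ln (1 - u) - 2 * u <= u ^ 3.
Proof.
  intros Hu. split.
  - apply (nonneg_of_derive (fun u => ln (1 + u) - ln (1 - u) - 2 * u)
           (fun x => 2 * x ^ 2 / ((1 + x) * (1 - x))) u); [lra| | |].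
    + rewrite Rplus_0_r, Rminus_0_r, ln_1. ring.
    + intros x Hx. auto_derive; [repeat split; lra|]. field; lra.
    + intros x Hx. apply Rmult_le_pos; [nra|].
      apply Rlt_le, Rinv_0_lt_compat. nra.
  - enough (0 <= u ^ 3 - (ln (1 + u) - ln (1 - u) - 2 * u)) by lra.
    apply (nonneg_of_derive (fun u => u ^ 3 - (ln (1 + u) - ln (1 - u) - 2 * u))
           (fun x => x ^ 2 * (1 - 3 * x ^ 2) / ((1 + x) * (1 - x))) u); [lra| | |].
    + rewrite Rplus_0_r, Rminus_0_r, ln_1. ring.
    + intros x Hx. auto_derive; [repeat split; lra|]. field; lra.
    + intros x Hx. apply Rmult_le_pos; [apply Rmult_le_pos; nra|].
      apply Rlt_le, Rinv_0_lt_compat. nra.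
Qed.

Lemma le_div_r a b c : 0 < c -> a * c <= b -> a <= b / c.
Proof. intros Hc H. apply Rle_div_r; auto. Qed.

Lemma div_le_l a b c : 0 < c -> a <= b * c -> a / c <= b.
Proof. intros Hc H. apply Rle_div_l; auto. Qed.

Lemma pow_exp_ln x k : 0 < x -> x ^ k = exp (INR k * ln x).
Proof. intros Hx. rewrite <- Rpower_pow by auto. reflexivity. Qed.

Lemma exp_le x y : x <= y -> exp x <= exp y.
Proof. intros [H| ->]; [apply Rlt_le, exp_increasing, H|apply Rle_refl]. Qed.

Lemma exp_neg_le_inv y : 0 < y -> exp (- y) <= / y.
Proof.
  intros Hy. rewrite exp_Ropp. apply Rinv_le_contravar; auto.
  pose proof (exp_ineq1_le y). lra.
Qed.

(** * Size of the coefficients of 1/(1 - T) and Gaussian bounds for [g], [p] and [q] *)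

Lemma U_coef k : U k = INR k ^ k / INR (fact k) * exp (- INR k).
Proof. unfold U, g, abel_term. rewrite Rplus_0_r. reflexivity. Qed.

Lemma U_pos k : 0 < U k.
Proof.
  rewrite U_coef. apply Rmult_lt_0_compat; [|apply exp_pos].
  apply Rmult_lt_0_compat; [|apply Rinv_0_lt_compat, INR_fact_lt_0].
  destruct k as [|k]; [simpl; lra|]. apply pow_lt, lt_0_INR; lia.
Qed.

Lemma U_0 : U 0%nat = 1.
Proof. rewrite U_coef. simpl. rewrite Ropp_0, exp_0. field. Qed.

Lemma U_1 : U 1%nat = exp (-1).
Proof. rewrite U_coef. simpl. replace (- (1)) with (-1) by ring. field. Qed.

Lemma U_S k : (1 <= k)%nat -> U (S k) = U k * exp (INR k * ln (1 + / INR k) - 1).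
Proof.
  intros Hk. assert (HK : 0 < INR k) by (apply lt_0_INR; lia).
  unfold Rminus. rewrite exp_plus.
  rewrite <- pow_exp_ln by (pose proof (Rinv_0_lt_compat _ HK); lra).
  rewrite !U_coef.
  replace (1 + / INR k) with (INR (S k) * / INR k) by (rewrite S_INR; field; lra).
  rewrite Rpow_mult_distr, pow_inv.
  replace (exp (- INR (S k))) with (exp (- INR k) * exp (- (1)))
    by (rewrite <- exp_plus; f_equal; rewrite S_INR; ring).
  rewrite fact_simpl, mult_INR.
  change (INR (S k) ^ S k) with (INR (S k) * INR (S k) ^ k).
  field. repeat split; try apply INR_fact_neq_0; try apply pow_nonzero; try lra.
  apply not_0_INR; lia.
Qed.

(** With [U_sqr_lower] this replaces Stirling's formula: the ratio of consecutive values of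
    [U k ^ 2 * INR (S k)] is at most 1, that of [U k ^ 2 * INR k] at least 1. *)
Lemma U_sqr_upper k : U k ^ 2 * INR (S k) <= 1.
Proof.
  destruct k as [|k]; [rewrite U_0; simpl; lra|].
  induction k as [|k IH].
  - rewrite U_1. simpl. rewrite Rmult_1_r, <- exp_plus.
    pose proof (exp_neg_le_inv (1 + 1) ltac:(lra)) as H.
    replace (-1 + -1) with (- (1 + 1)) by ring. lra.
  - set (j := S k) in *. assert (Hj : 0 < INR j) by (apply lt_0_INR; lia).
    rewrite U_S by lia.
    assert (H1 : exp (INR j * ln (1 + / INR j) - 1) ^ 2 * (INR (S (S j)) / INR (S j)) <= 1).
    { pose proof (Rinv_0_lt_compat _ Hj).
      pose proof (ln_1p_upper (/ INR j) ltac:(lra)) as H1.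
      assert (H2 : exp (INR j * ln (1 + / INR j) - 1) <= exp (- / (2 * INR (S j)))).
      { apply exp_le.
        apply Rle_trans with (INR j * ((/ INR j + / INR j / (1 + / INR j)) / 2) - 1).
        - apply Rplus_le_compat_r, Rmult_le_compat_l; lra.
        - right. rewrite S_INR. field. lra. }
      assert (H3 : INR (S (S j)) / INR (S j) <= exp (/ INR (S j))).
      { pose proof (exp_ineq1_le (/ INR (S j))).
        replace (INR (S (S j)) / INR (S j)) with (1 + / INR (S j)); auto.
        rewrite (S_INR (S j)). field. apply not_0_INR; lia. }
      apply Rle_trans with (exp (- / (2 * INR (S j))) ^ 2 * exp (/ INR (S j))).
      - apply Rmult_le_compat; auto.
        + apply pow2_ge_0.
        + apply Rlt_le, Rdiv_lt_0_compat; apply lt_0_INR; lia.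
        + apply pow_incr. split; [apply Rlt_le, exp_pos|auto].
      - right. generalize (INR (S j)) (not_0_INR (S j) ltac:(lia)). intros w Hw.
        replace (exp (- / (2 * w)) ^ 2) with (exp (- / (2 * w)) * exp (- / (2 * w))) by ring.
        rewrite <- !exp_plus. replace (_ + _) with 0 by (field; auto). apply exp_0. }
    rewrite Rpow_mult_distr.
    set (w := exp (INR j * ln (1 + / INR j) - 1) ^ 2) in *.
    replace (U j ^ 2 * w * INR (S (S j)))
      with (U j ^ 2 * INR (S j) * (w * (INR (S (S j)) / INR (S j))))
      by (field; apply not_0_INR; lia).
    rewrite <- (Rmult_1_r 1). apply Rmult_le_compat; auto.
    + apply Rmult_le_pos; [apply pow2_ge_0|apply pos_INR].
    + apply Rmult_le_pos; [apply pow2_ge_0|].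
      apply Rlt_le, Rdiv_lt_0_compat; apply lt_0_INR; lia.
Qed.

Lemma U_upper k : U k <= / sqrt (INR (S k)).
Proof.
  pose proof (U_sqr_upper k) as H. pose proof (U_pos k).
  assert (Hs : 0 < sqrt (INR (S k))) by (apply sqrt_lt_R0, lt_0_INR; lia).
  replace (/ sqrt (INR (S k))) with (1 / sqrt (INR (S k))) by (field; lra).
  apply le_div_r; auto.
  apply Rsqr_incr_0_var; [|lra]. unfold Rsqr.
  replace (U k * sqrt (INR (S k)) * (U k * sqrt (INR (S k))))
    with (U k ^ 2 * (sqrt (INR (S k)) * sqrt (INR (S k)))) by ring.
  rewrite sqrt_sqrt by apply pos_INR. lra.
Qed.

Lemma U_sqr_lower k : (1 <= k)%nat -> exp (-2) <= U k ^ 2 * INR k.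
Proof.
  intros Hk. destruct k as [|k]; [lia|]. clear Hk.
  induction k as [|k IH].
  - rewrite U_1. simpl. rewrite !Rmult_1_r, <- exp_plus. right; f_equal; ring.
  - set (j := S k) in *. assert (Hj : 0 < INR j) by (apply lt_0_INR; lia).
    rewrite U_S by lia. eapply Rle_trans; [apply IH|].
    rewrite Rpow_mult_distr, Rmult_assoc.
    apply Rmult_le_compat_l; [apply pow2_ge_0|].
    pose proof (Rinv_0_lt_compat _ Hj) as Hi.
    replace (INR (S j)) with (INR j * exp (ln (1 + / INR j)))
      by (rewrite exp_ln, S_INR by lra; field; lra).
    rewrite <- (Rmult_1_r (INR j)) at 1.
    rewrite (Rmult_comm (_ ^ 2)), Rmult_assoc. apply Rmult_le_compat_l; [lra|].
    set (e := INR j * ln (1 + / INR j) - 1).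
    replace (exp e ^ 2) with (exp e * exp e) by ring. rewrite <- !exp_plus.
    apply Rle_trans with (exp 0); [rewrite exp_0; lra|]. apply exp_le. unfold e.
    pose proof (ln_1p_lower (/ INR j) ltac:(lra)) as H1.
    assert (H2 : (2 * INR j + 1) * (2 * / INR j / (2 + / INR j)) <= (2 * INR j + 1) * ln (1 + / INR j))
      by (apply Rmult_le_compat_l; lra).
    replace ((2 * INR j + 1) * (2 * / INR j / (2 + / INR j))) with 2 in H2 by (field; lra). lra.
Qed.

Lemma U_lower k : (1 <= k)%nat -> exp (-1) / sqrt (INR k) <= U k.
Proof.
  intros Hk. pose proof (U_sqr_lower k Hk) as H. pose proof (U_pos k).
  assert (HK : 0 < INR k) by (apply lt_0_INR; lia).
  assert (Hs : 0 < sqrt (INR k)) by (apply sqrt_lt_R0; auto).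
  apply div_le_l; auto.
  apply Rsqr_incr_0_var; [|nra]. unfold Rsqr.
  replace (U k * sqrt (INR k) * (U k * sqrt (INR k)))
    with (U k ^ 2 * (sqrt (INR k) * sqrt (INR k))) by ring.
  rewrite sqrt_sqrt, <- exp_plus by lra. replace (-1 + -1) with (-2) by ring. lra.
Qed.

Lemma g_coef b k : 0 <= b -> (1 <= k)%nat -> g b k = U k * exp (INR k * ln (1 + b / INR k) - b).
Proof.
  intros Hb Hk. assert (HK : 0 < INR k) by (apply lt_0_INR; lia).
  assert (0 <= b / INR k) by (apply Rmult_le_pos; [auto|apply Rlt_le, Rinv_0_lt_compat; auto]).
  unfold Rminus. rewrite exp_plus, <- pow_exp_ln by lra.
  rewrite U_coef. unfold g, abel_term.
  replace (1 + b / INR k) with ((INR k + b) * / INR k) by (field; lra).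
  rewrite Rpow_mult_distr, pow_inv.
  replace (exp (- (INR k + b))) with (exp (- INR k) * exp (- b)) by (rewrite <- exp_plus; f_equal; ring).
  field. repeat split; try apply INR_fact_neq_0; apply pow_nonzero; lra.
Qed.

Lemma g_exponent_upper b k : 0 <= b -> 0 < k -> k * ln (1 + b / k) - b <= - (b ^ 2 / (2 * (b + k))).
Proof.
  intros Hb Hk. assert (0 <= b / k) by (apply Rmult_le_pos; [auto|apply Rlt_le, Rinv_0_lt_compat; auto]).
  pose proof (ln_1p_upper (b / k) ltac:(lra)) as H1.
  apply Rle_trans with (k * ((b / k + b / k / (1 + b / k)) / 2) - b).
  - apply Rplus_le_compat_r, Rmult_le_compat_l; lra.
  - right. field. lra.
Qed.

Lemma g_exponent_lower b k : 0 <= b -> 0 < k -> - (b ^ 2 / (2 * k)) <= k * ln (1 + b / k) - b.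
Proof.
  intros Hb Hk. assert (0 <= b / k) by (apply Rmult_le_pos; [auto|apply Rlt_le, Rinv_0_lt_compat; auto]).
  pose proof (ln_1p_lower2 (b / k) ltac:(lra)) as H1.
  apply Rle_trans with (k * (b / k - (b / k) ^ 2 / 2) - b).
  - right. field. lra.
  - apply Rplus_le_compat_r, Rmult_le_compat_l; lra.
Qed.

Lemma g_upper b k : 0 < b -> g b k <= U k * exp (- (b ^ 2 / (2 * (b + INR k)))).
Proof.
  intros Hb. destruct k as [|k].
  - rewrite U_0. unfold g, abel_term; simpl INR; simpl fact; simpl INR. simpl pow.
    rewrite Rmult_1_l. replace (1 / 1 * exp (- (0 + b))) with (exp (- b)) by (rewrite Rplus_0_l; field).
    apply exp_le. apply Ropp_le_contravar. replace (b * (b * 1) / (2 * (b + 0))) with (b / 2) by (field; lra). lra.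
  - rewrite g_coef by (try lia; lra). apply Rmult_le_compat_l; [apply Rlt_le, U_pos|].
    apply exp_le, g_exponent_upper; [lra|apply lt_0_INR; lia].
Qed.

Lemma g_ge0 b k : 0 <= INR k + b -> 0 <= g b k.
Proof.
  intros Hb. unfold g, abel_term. apply Rmult_le_pos; [|apply Rlt_le, exp_pos].
  apply Rmult_le_pos; [|apply Rlt_le, Rinv_0_lt_compat, INR_fact_lt_0].
  apply pow_le; auto.
Qed.

Lemma p_ge0 b k : 0 < b -> 0 <= p b k.
Proof.
  intros Hb. pose proof (pos_INR k). unfold p. apply Rmult_le_pos; [|apply g_ge0; lra].
  apply Rmult_le_pos; [lra|apply Rlt_le, Rinv_0_lt_compat; lra].
Qed.

Lemma U_le1 k : U k <= 1.
Proof.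
  pose proof (U_sqr_upper k). pose proof (U_pos k). rewrite S_INR in *. pose proof (pos_INR k). nra.
Qed.

(** For k <= b the Gaussian exponent is at least b/4, and exp(-y) <= 1/y. *)
Lemma p_upper b k : 0 < b -> INR k <= b -> p b k <= 4 / b.
Proof.
  intros Hb Hk. pose proof (pos_INR k). unfold p.
  assert (H0 : 0 < b ^ 2 / (2 * (b + INR k))) by (apply Rdiv_lt_0_compat; nra).
  assert (H1 : g b k <= 4 / b).
  { eapply Rle_trans; [apply g_upper; auto|].
    pose proof (exp_neg_le_inv _ H0) as H2. pose proof (U_pos k). pose proof (U_le1 k).
    pose proof (exp_pos (- (b ^ 2 / (2 * (b + INR k))))).
    apply Rle_trans with (1 * / (b ^ 2 / (2 * (b + INR k)))).
    - apply Rmult_le_compat; lra.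
    - rewrite Rmult_1_l. unfold Rdiv at 1. rewrite Rinv_mult, Rinv_inv.
      replace (4 / b) with (/ b ^ 2 * (4 * b)) by (field; lra).
      apply Rmult_le_compat_l; [apply Rlt_le, Rinv_0_lt_compat; nra|lra]. }
  pose proof (g_ge0 b k ltac:(lra)).
  apply Rle_trans with (1 * g b k); [|lra].
  apply Rmult_le_compat_r; auto. apply div_le_l; lra.
Qed.

(** Fourth power of exp(z/8) >= 1 + z/8 >= (1+z)/8; 4096 is 8^4. *)
Lemma poly_exp_bound z : 0 <= z -> (1 + z) ^ 4 * exp (- (z / 2)) <= 4096.
Proof.
  intros Hz. rewrite exp_Ropp.
  assert (H : ((1 + z) / 8) ^ 4 <= exp (z / 2)).
  { replace (exp (z / 2)) with (exp (z / 8) ^ 4).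
    - apply pow_incr. pose proof (exp_ineq1_le (z / 8)). lra.
    - simpl pow. rewrite Rmult_1_r, <- !exp_plus. f_equal. field. }
  pose proof (exp_pos (z / 2)).
  apply div_le_l; auto.
  replace ((1 + z) ^ 4) with (4096 * ((1 + z) / 8) ^ 4) by field. lra.
Qed.

Lemma q_upper b k : 1 <= b -> Rabs (q b k) <= 100000 / b ^ 3.
Proof.
  intros Hb. rewrite q_coef by lra. pose proof (pos_INR k) as Hk.
  set (s := b + INR k). set (z := b ^ 2 / s).
  assert (Hs : b <= s) by (unfold s; lra).
  assert (Hz : 0 < z) by (apply Rdiv_lt_0_compat; nra).
  assert (Hb3 : 0 < b ^ 3) by (apply pow_lt; lra).
  set (r := / sqrt (INR (S k))).
  assert (Hsq : 0 < sqrt (INR (S k))) by (apply sqrt_lt_R0, lt_0_INR; lia).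
  assert (Hr : 0 < r) by (apply Rinv_0_lt_compat; auto).
  assert (Hr2 : r ^ 2 * (INR k + 1) = 1).
  { rewrite <- S_INR. unfold r. rewrite <- (sqrt_sqrt (INR (S k))) at 2 by apply pos_INR. field. lra. }
  set (e := exp (- (z / 2))).
  assert (He : 0 < e) by apply exp_pos.
  assert (Hg : 0 <= g b k <= r * e).
  { split; [apply g_ge0; lra|]. eapply Rle_trans; [apply g_upper; lra|].
    replace (b ^ 2 / (2 * (b + INR k))) with (z / 2) by (unfold z, s; field; lra).
    apply Rmult_le_compat_r; [lra|apply U_upper]. }
  assert (Hpoly : (1 + z) ^ 4 * e <= 4096) by (apply poly_exp_bound; lra).
  assert (Hq : Rabs ((b ^ 2 - INR k) / s ^ 2 * g b k) <= (b ^ 2 + s) / s ^ 2 * (r * e)).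
  { rewrite Rabs_mult, (Rabs_pos_eq (g b k)) by lra.
    apply Rmult_le_compat; try lra; [apply Rabs_pos|].
    unfold Rdiv. rewrite Rabs_mult, (Rabs_pos_eq (/ s ^ 2)) by (apply Rlt_le, Rinv_0_lt_compat; nra).
    apply Rmult_le_compat_r; [apply Rlt_le, Rinv_0_lt_compat; nra|].
    apply Rabs_le. unfold s. pose proof (pow2_ge_0 b). lra. }
  eapply Rle_trans; [apply Hq|]. clear Hq.
  apply le_div_r; auto.
  (* If k + 1 is at least half of s = b + k, then [U] supplies a factor of order s^(-1/2), and b r
     is controlled by z. Otherwise k is small against b, z is at least b/2, and the exponential
     beats every power of b. *)
  destruct (Rle_lt_dec (s / 2) (INR k + 1)) as [Hc|Hc].
  - assert (Hbr : b * r <= 1 + z).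
    { apply Rsqr_incr_0_var; [|lra]. unfold Rsqr.
      assert (r ^ 2 * s <= 2) by nra.
      assert (E : b ^ 2 * r ^ 2 <= 2 * z).
      { replace (b ^ 2 * r ^ 2) with (z * (r ^ 2 * s)) by (unfold z; field; lra). nra. }
      nra. }
    replace ((b ^ 2 + s) / s ^ 2 * (r * e) * b ^ 3) with ((b * r) * (z * (1 + z)) * e)
      by (unfold z; field; lra).
    assert ((b * r) * (z * (1 + z)) <= (1 + z) ^ 4).
    { apply Rle_trans with ((1 + z) * ((1 + z) * (1 + z))).
      - apply Rmult_le_compat; nra.
      - replace ((1 + z) ^ 4) with ((1 + z) * ((1 + z) * (1 + z)) * (1 + z)) by ring.
        assert (0 <= (1 + z) * ((1 + z) * (1 + z))) by nra. nra. }
    apply Rle_trans with ((1 + z) ^ 4 * e); [|lra].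
    apply Rmult_le_compat_r; lra.
  - assert (Hs2 : s < 2 * b) by (unfold s in *; lra).
    assert (Hbz : b <= 2 * z).
    { unfold z. apply Rmult_le_reg_r with s; [lra|].
      replace (2 * (b ^ 2 / s) * s) with (2 * b ^ 2) by (field; lra). nra. }
    assert (Hr1 : r <= 1) by nra.
    assert (H3 : (b ^ 2 + s) / s ^ 2 <= 3).
    { apply div_le_l; [nra|]. nra. }
    assert (Hbz3 : b ^ 3 <= 8 * (1 + z) ^ 4).
    { apply Rle_trans with ((2 * (1 + z)) ^ 3).
      - apply pow_incr; lra.
      - replace ((2 * (1 + z)) ^ 3) with (8 * (1 + z) ^ 3) by ring.
        replace ((1 + z) ^ 4) with ((1 + z) ^ 3 * (1 + z)) by ring.
        assert (0 <= (1 + z) ^ 3) by (apply pow_le; lra). nra. }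
    (* This gives 3 times 8 times 4096 = 98304, the origin of the constant 100000. *)
    apply Rle_trans with (3 * (1 * e) * (8 * (1 + z) ^ 4)); [|nra].
    assert (0 <= (b ^ 2 + s) / s ^ 2) by (apply Rlt_le, Rdiv_lt_0_compat; nra).
    apply Rmult_le_compat; try lra.
    + apply Rmult_le_pos; nra.
    + apply Rmult_le_compat; nra.
Qed.

(** * The image series *)

Lemma g_neg_bounds M k : (1 <= M <= k)%nat -> 0 <= g (- INR M) k <= U k.
Proof.
  intros [HM Hk]. assert (HK : 0 < INR k) by (apply lt_0_INR; lia).
  pose proof (le_INR _ _ Hk). split; [apply g_ge0; lra|].
  rewrite U_coef. unfold g, abel_term.
  assert (H1 : (INR k + - INR M) ^ k <= (INR k * exp (- (INR M / INR k))) ^ k).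
  { apply pow_incr. split; [lra|].
    pose proof (exp_ineq1_le (- (INR M / INR k))).
    replace (INR k + - INR M) with (INR k * (1 + - (INR M / INR k))) by (field; lra).
    apply Rmult_le_compat_l; lra. }
  rewrite Rpow_mult_distr, (pow_exp_ln (exp _)), ln_exp in H1 by apply exp_pos.
  replace (INR k * - (INR M / INR k)) with (- INR M) in H1 by (field; lra).
  replace (exp (- (INR k + - INR M))) with (exp (- INR k) * exp (INR M))
    by (rewrite <- exp_plus; f_equal; ring).
  apply Rle_trans with (INR k ^ k * exp (- INR M) / INR (fact k) * (exp (- INR k) * exp (INR M))).
  - apply Rmult_le_compat_r; [apply Rlt_le, Rmult_lt_0_compat; apply exp_pos|].
    apply Rmult_le_compat_r; [apply Rlt_le, Rinv_0_lt_compat, INR_fact_lt_0|auto].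
  - right. rewrite exp_Ropp. field. split; [apply INR_fact_neq_0|apply Rgt_not_eq, exp_pos].
Qed.

Lemma g_le_U b k : 0 < b -> g b k <= U k.
Proof.
  intros Hb. eapply Rle_trans; [apply g_upper; auto|].
  rewrite <- (Rmult_1_r (U k)) at 2. apply Rmult_le_compat_l; [apply Rlt_le, U_pos|].
  rewrite <- exp_0. apply exp_le. pose proof (pos_INR k).
  enough (0 <= b ^ 2 / (2 * (b + INR k))) by lra.
  apply Rlt_le, Rdiv_lt_0_compat; nra.
Qed.

Lemma defect_le_U M k : (1 <= M)%nat -> Rabs (defect M k) <= U k.
Proof.
  intros HM. assert (0 < INR M) by (apply lt_0_INR; lia). pose proof (pos_INR k).
  pose proof (g_le_U (INR M) k ltac:(auto)). pose proof (g_ge0 (INR M) k ltac:(lra)).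
  unfold defect. apply Rabs_le. destruct (Nat.ltb_spec k M); [lra|].
  pose proof (g_neg_bounds M k ltac:(lia)). lra.
Qed.

Lemma g_neg_coef b k : 0 <= b -> (1 <= k)%nat -> b < INR k ->
  g (- b) k = U k * exp (INR k * ln (1 - b / INR k) + b).
Proof.
  intros Hb Hk Hbk. assert (HK : 0 < INR k) by (apply lt_0_INR; lia).
  assert (0 < 1 - b / INR k).
  { replace (1 - b / INR k) with ((INR k - b) / INR k) by (field; lra). apply Rdiv_lt_0_compat; lra. }
  rewrite exp_plus, <- pow_exp_ln by lra.
  rewrite U_coef. unfold g, abel_term.
  replace (1 - b / INR k) with ((INR k + - b) * / INR k) by (field; lra).
  rewrite Rpow_mult_distr, pow_inv.
  replace (exp (- (INR k + - b))) with (exp (- INR k) * exp b) by (rewrite <- exp_plus; f_equal; ring).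
  field. repeat split; try apply INR_fact_neq_0; apply pow_nonzero; lra.
Qed.

(** Both terms are [U k] times an exponential with nonpositive exponent, so their difference is at
    most that of the exponents, an odd logarithm of order k (M/k)^3. *)
Lemma defect_far M k : (1 <= M)%nat -> (2 * M <= k)%nat ->
  Rabs (defect M k) <= U k * (INR M ^ 3 / INR k ^ 2).
Proof.
  intros HM Hk. assert (HM' : 0 < INR M) by (apply lt_0_INR; lia).
  assert (HK : 2 * INR M <= INR k) by (apply le_INR in Hk; rewrite mult_INR in Hk; simpl in Hk; lra).
  unfold defect. destruct (Nat.ltb_spec k M); [lia|].
  rewrite g_neg_coef, g_coef by (try lia; lra).
  set (u := INR M / INR k).
  assert (Hu : 0 <= u <= 1 / 2).
  { split; [apply Rlt_le, Rdiv_lt_0_compat; lra|]. apply div_le_l; lra. }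
  set (x := INR k * ln (1 - u) + INR M). set (y := INR k * ln (1 + u) - INR M).
  assert (Hxy : 0 <= y - x <= INR M ^ 3 / INR k ^ 2).
  { pose proof (ln_ratio_bounds u Hu) as [H1 H2].
    replace (y - x) with (INR k * (ln (1 + u) - ln (1 - u) - 2 * u)) by (unfold x, y, u; field; lra).
    split; [apply Rmult_le_pos; lra|].
    replace (INR M ^ 3 / INR k ^ 2) with (INR k * u ^ 3) by (unfold u; field; lra).
    apply Rmult_le_compat_l; lra. }
  assert (Hy : exp y <= 1).
  { rewrite <- exp_0. apply exp_le. unfold y, u.
    pose proof (g_exponent_upper (INR M) (INR k) ltac:(lra) ltac:(lra)).
    assert (0 <= INR M ^ 2 / (2 * (INR M + INR k))) by (apply Rlt_le, Rdiv_lt_0_compat; nra). lra. }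
  assert (Hex : exp y * (1 + (x - y)) <= exp x <= exp y).
  { split; [|apply exp_le; lra].
    replace (exp x) with (exp y * exp (x - y)) by (rewrite <- exp_plus; f_equal; ring).
    apply Rmult_le_compat_l; [apply Rlt_le, exp_pos|apply exp_ineq1_le]. }
  rewrite <- Rmult_minus_distr_l, Rabs_mult, (Rabs_pos_eq (U k)) by (apply Rlt_le, U_pos).
  apply Rmult_le_compat_l; [apply Rlt_le, U_pos|].
  pose proof (exp_pos y). apply Rabs_le. nra.
Qed.

Lemma inv_sqrt_sum n : sum_f_R0 (fun k => / sqrt (INR (S k))) n <= 2 * sqrt (INR (S n)).
Proof.
  induction n as [|n IH].
  - simpl. rewrite sqrt_1. lra.
  - rewrite tech5. set (a := INR (S n)) in *.
    assert (Ha : 0 < a) by (apply lt_0_INR; lia).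
    replace (INR (S (S n))) with (a + 1) by (unfold a; rewrite (S_INR (S n)); ring).
    pose proof (sqrt_lt_R0 (a + 1) ltac:(lra)). pose proof (sqrt_pos a).
    pose proof (sqrt_sqrt a ltac:(lra)). pose proof (sqrt_sqrt (a + 1) ltac:(lra)).
    assert (/ sqrt (a + 1) <= 2 * sqrt (a + 1) - 2 * sqrt a); [|lra].
    apply Rmult_le_reg_r with (sqrt (a + 1)); auto. rewrite Rinv_l by lra.
    pose proof (pow2_ge_0 (sqrt (a + 1) - sqrt a)). nra.
Qed.

Lemma norm1_defect_split M K n : (1 <= M)%nat -> (2 * M <= K)%nat ->
  norm1 (defect M) n <= 2 * sqrt (INR K) + INR M ^ 3 / (sqrt (INR K) * (INR K - 1)).
Proof.
  intros HM HK. destruct K as [|K]; [lia|]. rewrite (S_INR K) at 3.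
  replace (INR K + 1 - 1) with (INR K) by ring.
  assert (HK' : 0 < INR K) by (apply lt_0_INR; lia).
  assert (Hs : 0 < sqrt (INR (S K))) by (apply sqrt_lt_R0, lt_0_INR; lia).
  assert (HM' : 0 < INR M) by (apply lt_0_INR; lia).
  assert (HM3 : 0 < INR M ^ 3) by (apply pow_lt; auto).
  assert (H : forall j, norm1 (defect M) (K + j) <=
     2 * sqrt (INR (S K)) + INR M ^ 3 / sqrt (INR (S K)) * (/ INR K - / INR (K + j))).
  { induction j as [|j IH].
    - rewrite Nat.add_0_r, Rminus_diag, Rmult_0_r, Rplus_0_r.
      eapply Rle_trans; [|apply inv_sqrt_sum]. apply sum_Rle; intros k Hk.
      eapply Rle_trans; [apply defect_le_U; auto|apply U_upper].
    - rewrite Nat.add_succ_r. unfold norm1 in *. rewrite tech5.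
      set (m := (K + j)%nat) in *. assert (Hm : 0 < INR m) by (apply lt_0_INR; lia).
      enough (Rabs (defect M (S m)) <= INR M ^ 3 / sqrt (INR (S K)) * (/ INR m - / INR (S m))) by lra.
      eapply Rle_trans; [apply defect_far; lia|].
      unfold Rdiv. rewrite Rmult_assoc, (Rmult_comm (U _)), Rmult_assoc.
      apply Rmult_le_compat_l; [lra|]. rewrite Rmult_comm.
      apply Rmult_le_compat.
      + apply Rlt_le, U_pos.
      + apply Rlt_le, Rinv_0_lt_compat, pow_lt, lt_0_INR; lia.
      + eapply Rle_trans; [apply U_upper|]. apply Rinv_le_contravar; auto.
        apply sqrt_le_1_alt, le_INR; lia.
      + rewrite S_INR. apply Rle_trans with (/ (INR m * (INR m + 1))).
        * apply Rinv_le_contravar; nra.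
        * right; field; lra. }
  apply Rle_trans with (norm1 (defect M) (K + n)); [apply norm1_mono; lia|].
  eapply Rle_trans; [apply H|]. apply Rplus_le_compat_l.
  assert (0 < / INR (K + n)) by (apply Rinv_0_lt_compat, lt_0_INR; lia).
  assert (0 < INR M ^ 3 / sqrt (INR (S K))) by (apply Rdiv_lt_0_compat; auto).
  replace (INR M ^ 3 / (sqrt (INR (S K)) * INR K)) with (INR M ^ 3 / sqrt (INR (S K)) * / INR K)
    by (field; lra).
  apply Rmult_le_compat_l; lra.
Qed.

(** The head up to K costs sqrt K and the tail M^3 K^(-3/2); the cut K of order M^(3/2) balances
    them at M^(3/4). Cutting at K = 2M would leave M^(3/2), too much for the later error. In the
    proof x is M^(1/4), and 6 = 4 + 2. *)
Lemma norm1_defect M n : (4 <= M)%nat -> norm1 (defect M) n <= 6 * sqrt (sqrt (INR M)) ^ 3.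
Proof.
  intros HM. apply le_INR in HM as HM'. simpl in HM'.
  set (x := sqrt (sqrt (INR M))).
  assert (Hx2 : x ^ 2 = sqrt (INR M)) by (unfold x; rewrite pow2_sqrt; auto using sqrt_pos).
  assert (Hx4 : x ^ 4 = INR M).
  { replace (x ^ 4) with ((x ^ 2) ^ 2) by ring. rewrite Hx2, pow2_sqrt; lra. }
  assert (H2 : 2 <= x ^ 2).
  { rewrite Hx2. replace 2 with (sqrt (2 * 2)) by (rewrite sqrt_square; lra).
    apply sqrt_le_1_alt; lra. }
  assert (Hx : 0 < x).
  { assert (0 <= x) by apply sqrt_pos. destruct (Req_dec x 0) as [E|E]; [rewrite E in H2; lra|lra]. }
  assert (Hx3 : 0 < x ^ 3) by (apply pow_lt; auto).
  assert (Hx6 : 8 <= x ^ 6).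
  { replace (x ^ 6) with ((x ^ 2) * (x ^ 2) * (x ^ 2)) by ring. nra. }
  destruct (nfloor_ex (x ^ 6)) as [N [HN1 HN2]]; [lra|].
  assert (HS : INR (S N) = INR N + 1) by apply S_INR.
  assert (HKM : (2 * M <= S N)%nat).
  { apply INR_le. rewrite mult_INR, HS, <- Hx4. simpl INR.
    assert (x ^ 6 = x ^ 4 * x ^ 2) by ring. assert (0 <= x ^ 4) by (rewrite Hx4; lra). nra. }
  eapply Rle_trans; [apply (norm1_defect_split M (S N)); lia|].
  rewrite HS. replace (INR N + 1 - 1) with (INR N) by ring.
  assert (Hs1 : x ^ 3 <= sqrt (INR N + 1)).
  { rewrite <- (sqrt_square (x ^ 3)) by lra. apply sqrt_le_1_alt.
    replace (x ^ 3 * x ^ 3) with (x ^ 6) by ring. lra. }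
  assert (Hs2 : sqrt (INR N + 1) <= 2 * x ^ 3).
  { rewrite <- (sqrt_square (2 * x ^ 3)) by lra. apply sqrt_le_1_alt.
    replace (2 * x ^ 3 * (2 * x ^ 3)) with (4 * x ^ 6) by ring. lra. }
  assert (Hd : INR M ^ 3 / (sqrt (INR N + 1) * INR N) <= 2 * x ^ 3).
  { apply div_le_l; [nra|].
    rewrite <- Hx4. replace ((x ^ 4) ^ 3) with (x ^ 3 * (x ^ 3 * x ^ 6)) by ring.
    rewrite (Rmult_comm 2), Rmult_assoc. apply Rmult_le_compat_l; [lra|].
    apply Rle_trans with (sqrt (INR N + 1) * (2 * INR N)); [|lra].
    apply Rmult_le_compat; lra. }
  lra.
Qed.

(** Expanding 1/(1 - p^(2M)) geometrically produces the images: each further factor p^(2M) is one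
    more pair of reflections at the two walls. *)
Definition geo (M : nat) : fps := finv (cst 1 - p (INR (2 * M)))%FS.

Lemma p_at_0 b : 0 < b -> p b O = exp (- b).
Proof. intros Hb. unfold p, g, abel_term. simpl. rewrite Rplus_0_l. field. lra. Qed.

Lemma one_sub_p_0 M : (1 <= M)%nat -> (cst 1 - p (INR (2 * M)))%FS O <> 0.
Proof.
  intros HM. unfold fsub. rewrite p_at_0 by (apply lt_0_INR; lia). simpl cst.
  assert (exp (- INR (2 * M)) < exp 0); [|rewrite exp_0 in *; lra].
  apply exp_increasing. assert (0 < INR (2 * M)) by (apply lt_0_INR; lia). lra.
Qed.

Lemma geo_eq M : (1 <= M)%nat -> ((cst 1 - p (INR (2 * M))) * geo M)%FS = cst 1.
Proof. intros HM. apply finv_r, one_sub_p_0; auto. Qed.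

(** The case i = 0 is separate because [p 0] evaluates to the zero series, not to 1. *)
Definition geo_term (a : fps) (M n i : nat) : R :=
  match i with O => a n | S _ => (a * p (INR (2 * M * i)))%FS n end.

Lemma geo_partial a M n I : (1 <= M)%nat ->
  (a * geo M)%FS n
  = sum_f_R0 (geo_term a M n) I + (p (INR (2 * M * S I)) * (a * geo M))%FS n.
Proof.
  intros HM.
  assert (E : (a * geo M)%FS = (a + p (INR (2 * M)) * (a * geo M))%FS).
  { transitivity (a * ((cst 1 - p (INR (2 * M))) * geo M) + p (INR (2 * M)) * (a * geo M))%FS; [ring|].
    rewrite geo_eq by auto. ring. }
  induction I as [|I IH].
  - rewrite Nat.mul_1_r. exact (f_equal (fun s : fps => s n) E).
  - rewrite IH, tech5, Rplus_assoc. f_equal.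
    transitivity ((p (INR (2 * M * S I)) * (a + p (INR (2 * M)) * (a * geo M)))%FS n).
    { rewrite <- E. reflexivity. }
    replace (2 * M * S (S I))%nat with (2 * M * S I + 2 * M)%nat by lia.
    rewrite <- p_mul by lia. unfold geo_term.
    change ((p (INR (2 * M * S I)) * (a + p (INR (2 * M)) * (a * geo M)))%FS n
      = (a * p (INR (2 * M * S I)) + p (INR (2 * M * S I)) * p (INR (2 * M)) * (a * geo M))%FS n).
    apply (f_equal (fun s : fps => s n)). ring.
Qed.

(** The remainder in [geo_partial] carries the factor p^(2M(I+1)), whose coefficients up to n are
    O(1/I) by [p_upper]. *)
Lemma geo_series a M n : (1 <= M)%nat -> is_series (geo_term a M n) ((a * geo M)%FS n).
Proof.
  intros HM. set (c := norm1 (a * geo M)%FS n).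
  assert (Hc : 0 <= c) by apply norm1_ge0.
  apply is_series_Reals. intros eps Heps.
  destruct (nfloor_ex (4 * c / eps + INR n)) as [N [_ HN]].
  { apply Rplus_le_le_0_compat; [|apply pos_INR].
    apply Rmult_le_pos; [lra|apply Rlt_le, Rinv_0_lt_compat; lra]. }
  exists N. intros I HI.
  assert (Hq : 0 <= 4 * c / eps) by (apply Rmult_le_pos; [lra|apply Rlt_le, Rinv_0_lt_compat; lra]).
  set (b := INR (2 * M * S I)).
  assert (Hb : 4 * c / eps + INR n < b).
  { eapply Rlt_le_trans; [apply HN|]. rewrite <- S_INR. apply le_INR. nia. }
  pose proof (pos_INR n).
  rewrite (geo_partial a M n I HM). unfold R_dist.
  replace (_ - _) with (- (p b * (a * geo M))%FS n) by (unfold b; ring).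
  rewrite Rabs_Ropp.
  apply Rle_lt_trans with (4 / b * c).
  - apply fmul_sup_norm1. intros k Hk. apply le_INR in Hk.
    rewrite Rabs_pos_eq by (apply p_ge0; lra). apply p_upper; lra.
  - replace (4 / b * c) with (4 * c / b) by (field; lra).
    apply Rmult_lt_reg_r with b; [lra|].
    replace (4 * c / b * b) with (4 * c) by (field; lra).
    replace (4 * c) with (eps * (4 * c / eps)) by (field; lra).
    apply Rmult_lt_compat_l; lra.
Qed.

Lemma series_bound (a : nat -> R) l c :
  is_series a l -> (forall N, Rabs (sum_f_R0 a N) <= c) -> Rabs l <= c.
Proof.
  intros Ha Hc.
  assert (H1 : is_lim_seq (fun N => Rabs (sum_f_R0 a N)) (Rabs l)).
  { apply (is_lim_seq_abs _ l). apply is_lim_seq_Reals.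
    apply is_series_Reals in Ha. exact Ha. }
  apply (is_lim_seq_le _ (fun _ => c) (Rabs l) c Hc H1). apply is_lim_seq_const.
Qed.

Lemma inv_sqr_sum N : sum_f_R0 (fun i => / INR (S i) ^ 2) N <= 2 - / INR (S N).
Proof.
  induction N as [|N IH].
  - simpl. lra.
  - rewrite tech5. rewrite (S_INR (S N)). set (a := INR (S N)) in *.
    assert (Ha : 0 < a) by (apply lt_0_INR; lia).
    enough (/ (a + 1) ^ 2 <= / a - / (a + 1)) by lra.
    replace (/ a - / (a + 1)) with (/ (a * (a + 1))) by (field; lra).
    apply Rinv_le_contravar; nra.
Qed.

Lemma q_mul_p a b : (0 < a)%nat -> (0 < b)%nat -> (q (INR a) * p (INR b))%FS = q (INR (a + b)).
Proof.
  intros Ha Hb. rewrite <- !V_mul_p by (apply lt_0_INR; lia). rewrite <- p_mul by lia. ring.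
Qed.

(** Term i is [q] at (2i+1)M, of size M^(-3) (i+1)^(-3) by [q_upper]. Keeping [q] and [geo] together
    avoids any bound on [geo] alone, and the sum of inverse squares gives the factor 2. *)
Lemma q_geo_upper M n : (1 <= M)%nat -> Rabs ((q (INR M) * geo M)%FS n) <= 200000 / INR M ^ 3.
Proof.
  intros HM. assert (HM' : 1 <= INR M) by (apply (le_INR 1); lia).
  assert (HM3 : 0 < INR M ^ 3) by (apply pow_lt; lra).
  apply (series_bound (geo_term (q (INR M)) M n)); [apply geo_series; auto|].
  intros N. eapply Rle_trans; [apply Rsum_abs|].
  apply Rle_trans with (sum_f_R0 (fun i => / INR (S i) ^ 2 * (100000 / INR M ^ 3)) N).
  - apply sum_Rle; intros i Hi.
    assert (E : geo_term (q (INR M)) M n i = q (INR (M + 2 * M * i)) n).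
    { destruct i as [|i]; unfold geo_term; [do 2 f_equal; lia|]. rewrite q_mul_p by lia. reflexivity. }
    rewrite E. clear E. set (b := INR (M + 2 * M * i)).
    assert (Hs : 1 <= INR (S i)) by (apply (le_INR 1); lia).
    assert (Hb : INR M * INR (S i) <= b) by (unfold b; rewrite <- mult_INR; apply le_INR; nia).
    assert (Hb' : INR M * 1 <= INR M * INR (S i)) by (apply Rmult_le_compat_l; lra).
    eapply Rle_trans; [apply q_upper; lra|].
    unfold Rdiv. rewrite (Rmult_comm (/ _ ^ 2)), Rmult_assoc. apply Rmult_le_compat_l; [lra|].
    rewrite <- Rinv_mult. apply Rinv_le_contravar.
    + apply Rmult_lt_0_compat; [auto|apply pow_lt; lra].
    + apply Rle_trans with ((INR M * INR (S i)) ^ 3).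
      * rewrite Rpow_mult_distr. apply Rmult_le_compat_l; [lra|].
        apply Rle_pow; [lra|lia].
      * apply pow_incr. split; [apply Rmult_le_pos; lra|auto].
  - rewrite <- scal_sum. pose proof (inv_sqr_sum N).
    assert (0 < / INR (S N)) by (apply Rinv_0_lt_compat, lt_0_INR; lia).
    replace (200000 / INR M ^ 3) with (100000 / INR M ^ 3 * 2) by (field; lra).
    apply Rmult_le_compat_l; [apply Rlt_le, Rdiv_lt_0_compat; lra|lra].
Qed.

Definition eta (M : nat) : fps := (q (INR M) * geo M * defect M)%FS.

(** Writing the defect as a relative error [eta] splits the logarithmic derivative of [Y] into the
    image series and a perturbation. *)
Lemma Y_factor M : (1 <= M)%nat -> Y M = ((cst 1 - p (INR (2 * M))) * (cst 1 - eta M))%FS.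
Proof.
  intros HM. rewrite Y_eq by auto. unfold eta.
  transitivity ((cst 1 - p (INR (2 * M))) - ((cst 1 - p (INR (2 * M))) * geo M) * (q (INR M) * defect M))%FS;
    [|ring].
  rewrite geo_eq by auto. ring.
Qed.

Lemma one_sub_eta_0 M : (1 <= M)%nat -> (cst 1 - eta M)%FS O <> 0.
Proof.
  intros HM E. pose proof (Y_low M 0 ltac:(lia)) as H.
  rewrite Y_factor, fmul0, E, Rmult_0_r in H by auto. simpl in H. lra.
Qed.

Lemma Lam_eq M : (1 <= M)%nat ->
  Lam M = (fopp (theta (p (INR (2 * M))) * geo M) - theta (eta M) * finv (cst 1 - eta M))%FS.
Proof.
  intros HM. apply (fmul_cancel (Y M)); [rewrite Y_low by lia; simpl; lra|].
  rewrite fmulC, <- theta_Y by auto. rewrite Y_factor by auto.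
  rewrite thetaM, !thetaB, theta_cst.
  pose proof (geo_eq M HM) as E1. pose proof (finv_r _ (one_sub_eta_0 M HM)) as E2.
  set (a := p (INR (2 * M))) in *. set (h := eta M) in *.
  transitivity (fopp (theta a * ((cst 1 - a) * geo M) * (cst 1 - h))
     - theta h * ((cst 1 - h) * finv (cst 1 - h)) * (cst 1 - a))%FS; [|ring].
  rewrite E1, E2. ring.
Qed.

(** The product of the bounds for [q_geo_upper] and [norm1_defect]: of order M^(-9/4), hence o(1/n)
    when n is of order M^2. *)
Definition eta_bound (M : nat) : R := 1200000 * sqrt (sqrt (INR M)) ^ 3 / INR M ^ 3.

Lemma eta_upper M k : (4 <= M)%nat -> Rabs (eta M k) <= eta_bound M.
Proof.
  intros HM. assert (HM' : 1 <= INR M) by (apply (le_INR 1); lia).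
  assert (HM3 : 0 < INR M ^ 3) by (apply pow_lt; lra).
  unfold eta. eapply Rle_trans.
  - apply fmul_sup_norm1 with (c := 200000 / INR M ^ 3). intros; apply q_geo_upper; lia.
  - unfold eta_bound.
    replace (1200000 * sqrt (sqrt (INR M)) ^ 3 / INR M ^ 3)
      with (200000 / INR M ^ 3 * (6 * sqrt (sqrt (INR M)) ^ 3)) by (field; lra).
    apply Rmult_le_compat_l; [apply Rlt_le, Rdiv_lt_0_compat; lra|apply norm1_defect; auto].
Qed.

Lemma Lam_approx M n : (4 <= M)%nat -> INR (S n) * eta_bound M <= 1 / 2 ->
  Rabs (Lam M n + (theta (p (INR (2 * M))) * geo M)%FS n) <= 2 * INR n * eta_bound M.
Proof.
  intros HM Hn. rewrite Lam_eq by lia. unfold fsub at 1, fopp.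
  set (X := finv (cst 1 - eta M)%FS).
  replace (_ + _) with (- (theta (eta M) * X)%FS n) by ring. rewrite Rabs_Ropp.
  (* Neumann series: X = 1 + [eta] X, and the truncated norm of [eta] is at most 1/2. *)
  assert (HX : norm1 X n <= 2).
  { assert (E : X = (cst 1 + eta M * X)%FS).
    { transitivity ((cst 1 - eta M) * X + eta M * X)%FS; [ring|].
      unfold X. rewrite finv_r by (apply one_sub_eta_0; lia). reflexivity. }
    assert (H1 : norm1 (cst 1) n <= 1).
    { unfold norm1. destruct n as [|n]; [simpl; rewrite Rabs_R1; lra|].
      rewrite decomp_sum by lia. rewrite sum_eq_R0; [simpl; rewrite Rabs_R1; lra|].
      intros; simpl; apply Rabs_R0. }
    assert (H2 : norm1 X n <= norm1 (cst 1) n + norm1 (eta M) n * norm1 X n).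
    { rewrite E at 1. eapply Rle_trans; [apply norm1_add|]. apply Rplus_le_compat_l, norm1_mul. }
    assert (H3 : norm1 (eta M) n <= 1 / 2).
    { eapply Rle_trans; [apply norm1_sup; intros; apply eta_upper; auto|auto]. }
    pose proof (norm1_ge0 X n). nra. }
  assert (Hb : 0 <= eta_bound M) by (eapply Rle_trans; [apply Rabs_pos|apply (eta_upper M 0); auto]).
  eapply Rle_trans; [apply fmul_sup_norm1 with (c := INR n * eta_bound M)|].
  - intros k Hk. unfold theta. rewrite Rabs_mult, Rabs_pos_eq by apply pos_INR.
    apply Rmult_le_compat; auto using pos_INR, Rabs_pos, le_INR. apply eta_upper; auto.
  - pose proof (pos_INR n). assert (0 <= INR n * eta_bound M) by (apply Rmult_le_pos; auto).
    pose proof (norm1_ge0 X n). nra.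
Qed.

Definition reflection_term (M n i : nat) : R :=
  2 * INR M * (INR n / (INR (2 * M * S i) + INR n)) * g (INR (2 * M * S i)) n.

(** Each image term is [(U - cst 1) * p J] = [g J - p J], whose coefficient is n/(J+n) times that of
    [g J]. *)
Lemma reflection_series M n : (1 <= M)%nat ->
  is_series (reflection_term M n) ((theta (p (INR (2 * M))) * geo M)%FS n).
Proof.
  intros HM. eapply is_series_ext; [|apply geo_series; auto].
  intros i. rewrite theta_p by lia.
  assert (E : geo_term (cst (INR (2 * M)) * ((U - cst 1) * p (INR (2 * M))))%FS M n i
    = (cst (INR (2 * M)) * ((U - cst 1) * p (INR (2 * M * S i))))%FS n).
  { destruct i as [|i]; unfold geo_term.
    - rewrite Nat.mul_1_r. reflexivity.
    - replace (2 * M * S (S i))%nat with (2 * M + 2 * M * S i)%nat by lia.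
      rewrite <- p_mul by lia. apply (f_equal (fun s : fps => s n)). ring. }
  rewrite E, cst_mul_coef. clear E.
  set (J := (2 * M * S i)%nat). assert (HJ : (0 < J)%nat) by (unfold J; lia).
  replace ((U - cst 1) * p (INR J))%FS with (p (INR J) * g 0 - p (INR J))%FS by (unfold U; ring).
  rewrite p_mul_g, Rplus_0_l by lia. unfold fsub, p, reflection_term. fold J.
  replace (INR (2 * M)) with (2 * INR M) by (rewrite mult_INR; simpl; ring).
  pose proof (lt_0_INR _ HJ). pose proof (pos_INR n).
  match goal with |- ?x = ?y => change (@eq R x y) end. field. lra.
Qed.

(** * Limits of the image series *)

Lemma is_lim_seq_eps (u : nat -> R) (l : R) :
  (forall eps, 0 < eps -> exists N, forall n, (N <= n)%nat -> Rabs (u n - l) < eps) -> is_lim_seq u l.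
Proof. intros H. apply is_lim_seq_Reals. intros eps Heps. apply (H eps Heps). Qed.

Lemma is_lim_seq_eps_inv (u : nat -> R) (l : R) :
  is_lim_seq u l -> forall eps, 0 < eps -> exists N, forall n, (N <= n)%nat -> Rabs (u n - l) < eps.
Proof. intros H eps Heps. apply is_lim_seq_Reals in H. apply (H eps Heps). Qed.

Lemma is_lim_seq_opp_R (u : nat -> R) (l : R) : is_lim_seq u l -> is_lim_seq (fun n => - u n) (- l).
Proof. exact (proj1 (is_lim_seq_opp u l)). Qed.

Lemma is_lim_seq_inv_R (u : nat -> R) (l : R) : is_lim_seq u l -> l <> 0 -> is_lim_seq (fun n => / u n) (/ l).
Proof. intros Hu Hl. apply (is_lim_seq_inv u l Hu). intros E; apply Hl. injection E; auto. Qed.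

Lemma ex_series_dominated (a b : nat -> R) :
  (forall i, Rabs (a i) <= b i) -> ex_series b -> ex_series a.
Proof. intros H Hb. apply (ex_series_le (K := R_AbsRing) (V := R_CompleteNormedModule) a b H Hb). Qed.

Lemma tannery (a : nat -> nat -> R) (l b : nat -> R) N0 :
  (forall i, is_lim_seq (fun n => a n i) (l i)) ->
  ex_series b -> (forall n i, (N0 <= n)%nat -> Rabs (a n i) <= b i) ->
  ex_series l /\ is_lim_seq (fun n => Series (a n)) (Series l).
Proof.
  intros Hlim Hb Hdom.
  assert (Hl : forall i, Rabs (l i) <= b i).
  { intros i. assert (H1 := is_lim_seq_abs _ (l i) (Hlim i)).
    apply (is_lim_seq_le_loc (fun n => Rabs (a n i)) (fun _ => b i) (Rabs (l i)) (b i)).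
    - exists N0. intros n Hn. apply Hdom; auto.
    - exact H1.
    - apply is_lim_seq_const. }
  assert (Hexl : ex_series l) by (eapply ex_series_dominated; eauto).
  split; auto.
  apply is_lim_seq_eps; intros eps Heps.
  assert (Htail : exists K, Series (fun k => b (S K + k)%nat) < eps / 3).
  { destruct (is_lim_seq_eps_inv (sum_f_R0 b) (Series b)) with (eps := eps / 3) as [K HK]; [|lra|].
    - apply is_lim_seq_Reals. apply is_series_Reals. apply Series_correct, Hb.
    - exists K. specialize (HK K (le_n _)).
      rewrite (Series_incr_n b (S K)) in HK by (auto; lia). simpl pred in HK.
      apply Rabs_def2 in HK. lra. }
  destruct Htail as [K HK].
  assert (Hfin : exists N1, forall n, (N1 <= n)%nat -> Rabs (sum_f_R0 (a n) K - sum_f_R0 l K) < eps / 3).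
  { apply is_lim_seq_eps_inv; [|lra]. clear HK. induction K as [|K IH]; simpl; [apply Hlim|].
    apply (is_lim_seq_plus' _ _ _ _ IH (Hlim (S K))). }
  destruct Hfin as [N1 HN1].
  exists (N0 + N1)%nat. intros n Hn.
  assert (Hexb : ex_series (fun k => b (S K + k)%nat)) by (apply ex_series_incr_n; auto).
  assert (Htl : forall c : nat -> R, (forall i, Rabs (c i) <= b i) ->
     Rabs (Series (fun k => c (S K + k)%nat)) < eps / 3).
  { intros c Hc. eapply Rle_lt_trans; [|apply HK].
    eapply Rle_trans; [apply Series_Rabs|].
    - apply ex_series_dominated with (fun k => b (S K + k)%nat); auto.
      intros i. rewrite Rabs_Rabsolu. apply Hc.
    - apply Series_le; auto. intros i. split; [apply Rabs_pos|apply Hc]. }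
  assert (Hna : forall i, Rabs (a n i) <= b i) by (intros; apply Hdom; lia).
  rewrite (Series_incr_n (a n) (S K)), (Series_incr_n l (S K)); try lia; auto.
  2: { eapply ex_series_dominated; eauto. }
  simpl pred.
  pose proof (Htl _ Hna) as H1. pose proof (Htl _ Hl) as H2. specialize (HN1 n ltac:(lia)).
  apply Rabs_def2 in H1, H2, HN1. apply Rabs_def1; lra.
Qed.

Lemma ex_series_inv_sqr : ex_series (fun i => / INR (S i) ^ 2).
Proof.
  assert (H : ex_finite_lim_seq (sum_f_R0 (fun i => / INR (S i) ^ 2))).
  { apply ex_finite_lim_seq_incr with 2.
    - intros n. rewrite tech5. assert (0 < / INR (S (S n)) ^ 2); [|lra].
      apply Rinv_0_lt_compat, pow_lt, lt_0_INR; lia.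
    - intros n. pose proof (inv_sqr_sum n).
      assert (0 < / INR (S n)) by (apply Rinv_0_lt_compat, lt_0_INR; lia). lra. }
  destruct H as [l Hl]. exists l. apply is_series_Reals. apply is_lim_seq_Reals in Hl. exact Hl.
Qed.

Lemma ex_series_scal_inv_sqr c : ex_series (fun i => c * / INR (S i) ^ 2).
Proof. apply (ex_series_scal (K := R_AbsRing) (V := R_NormedModule) c). apply ex_series_inv_sqr. Qed.

Lemma sqrt_INR_lim : is_lim_seq (fun n => sqrt (INR n)) p_infty.
Proof.
  intros P [A HA].
  destruct (nfloor_ex (Rmax 0 A ^ 2)) as [N [_ HN]]; [apply pow2_ge_0|].
  exists (S N). intros n Hn. apply HA.
  apply Rle_lt_trans with (Rmax 0 A); [apply Rmax_r|].
  rewrite <- (sqrt_pow2 (Rmax 0 A)) by apply Rmax_l. apply sqrt_lt_1_alt.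
  split; [apply pow2_ge_0|]. eapply Rlt_le_trans; [apply HN|]. rewrite <- S_INR. apply le_INR; auto.
Qed.

Lemma inv_sqrt_lim : is_lim_seq (fun n => / sqrt (INR n)) 0.
Proof. apply (is_lim_seq_inv _ p_infty); [apply sqrt_INR_lim|discriminate]. Qed.

Definition Gterm (t : R) (i : nat) : R := 2 * t * exp (- (2 * INR (S i) ^ 2 * t ^ 2)).

(** The two bounds on the exponent, -J^2/(2n) and -J^2/(2(J+n)), merge because J/n tends to 0. *)
Lemma ratio_limit (J : nat -> nat) c : 0 < c ->
  is_lim_seq (fun n => INR (J n) / sqrt (INR n)) c ->
  is_lim_seq (fun n => g (INR (J n)) n / U n) (exp (- (c ^ 2 / 2))).
Proof.
  intros Hc HJ.
  apply is_lim_seq_ext_loc with (fun n => exp (INR n * ln (1 + INR (J n) / INR n) - INR (J n))).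
  { exists 1%nat. intros n Hn. rewrite g_coef by (auto using pos_INR). pose proof (U_pos n). field. lra. }
  apply (is_lim_seq_continuous exp).
  { apply derivable_continuous_pt, derivable_pt_exp. }
  set (z := fun n => INR (J n) / sqrt (INR n)) in *.
  assert (Hz2 : is_lim_seq (fun n => z n ^ 2) (c ^ 2)).
  { simpl. apply is_lim_seq_ext with (fun n => z n * z n); [intros; ring|].
    replace (c * (c * 1)) with (c * c) by ring. apply is_lim_seq_mult'; auto. }
  assert (Hw : is_lim_seq (fun n => 1 + z n * / sqrt (INR n)) 1).
  { replace (Finite 1) with (Finite (1 + c * 0)) by (f_equal; ring).
    apply is_lim_seq_plus'; [apply is_lim_seq_const|]. apply is_lim_seq_mult'; [auto|apply inv_sqrt_lim]. }
  apply is_lim_seq_le_le_loc with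
    (fun n => - (z n ^ 2 / 2)) (fun n => - (z n ^ 2 / 2 / (1 + z n * / sqrt (INR n)))).
  - exists 1%nat. intros n Hn. assert (Hn' : 0 < INR n) by (apply lt_0_INR; lia).
    pose proof (sqrt_lt_R0 _ Hn') as Hs. pose proof (pos_INR (J n)) as HJ0.
    assert (E : z n ^ 2 = INR (J n) ^ 2 / INR n).
    { unfold z, Rdiv. rewrite Rpow_mult_distr, pow_inv, pow2_sqrt by lra. reflexivity. }
    assert (E2 : z n * / sqrt (INR n) = INR (J n) / INR n).
    { unfold z. rewrite <- (sqrt_sqrt (INR n)) at 3 by lra. field. lra. }
    rewrite E2, E. split.
    + pose proof (g_exponent_lower (INR (J n)) (INR n) HJ0 Hn').
      replace (INR (J n) ^ 2 / INR n / 2) with (INR (J n) ^ 2 / (2 * INR n)) by (field; lra). lra.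
    + pose proof (g_exponent_upper (INR (J n)) (INR n) HJ0 Hn').
      replace (INR (J n) ^ 2 / INR n / 2 / (1 + INR (J n) / INR n))
        with (INR (J n) ^ 2 / (2 * (INR (J n) + INR n))) by (field; lra). lra.
  - apply (is_lim_seq_opp_R (fun n => z n ^ 2 / 2) (c ^ 2 / 2)).
    apply (is_lim_seq_scal_r _ (/ 2) (c ^ 2)); auto.
  - apply (is_lim_seq_opp_R (fun n => z n ^ 2 / 2 / (1 + z n * / sqrt (INR n))) (c ^ 2 / 2)).
    replace (c ^ 2 / 2) with (c ^ 2 / 2 / 1) by field.
    apply is_lim_seq_div'; [|exact Hw|lra].
    apply (is_lim_seq_scal_r _ (/ 2) (c ^ 2)); auto.
Qed.

Lemma eventually_ge_half (M : nat -> nat) t : 0 < t ->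
  is_lim_seq (fun n => INR (M n) / sqrt (INR n)) t ->
  exists N, forall n, (N <= n)%nat -> (1 <= n)%nat /\ t / 2 * sqrt (INR n) <= INR (M n) <= 2 * t * sqrt (INR n).
Proof.
  intros Ht HM. destruct (is_lim_seq_eps_inv _ _ HM (t / 2)) as [N HN]; [lra|].
  exists (S N). intros n Hn. split; [lia|]. specialize (HN n ltac:(lia)).
  assert (Hs : 0 < sqrt (INR n)) by (apply sqrt_lt_R0, lt_0_INR; lia).
  apply Rabs_def2 in HN.
  replace (INR (M n)) with (INR (M n) / sqrt (INR n) * sqrt (INR n)) by (field; lra).
  split; apply Rmult_le_compat_r; lra.
Qed.

Lemma sqrtU_lower n : (1 <= n)%nat -> exp (-1) <= sqrt (INR n) * U n.
Proof.
  intros Hn. pose proof (U_lower n Hn) as H.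
  assert (Hs : 0 < sqrt (INR n)) by (apply sqrt_lt_R0, lt_0_INR; lia).
  replace (exp (-1)) with (sqrt (INR n) * (exp (-1) / sqrt (INR n))) by (field; lra).
  apply Rmult_le_compat_l; lra.
Qed.

Lemma reflection_limit (M : nat -> nat) t : 0 < t ->
  is_lim_seq (fun n => INR (M n) / sqrt (INR n)) t ->
  is_lim_seq (fun n => Series (fun i => reflection_term (M n) n i / (sqrt (INR n) * U n))) (Series (Gterm t)).
Proof.
  intros Ht HM. destruct (eventually_ge_half M t Ht HM) as [N HN].
  apply (tannery _ (Gterm t) (fun i => 2 / t * / INR (S i) ^ 2) N).
  - intros i. set (k := INR (S i)). assert (Hk : 0 < k) by (apply lt_0_INR; lia).
    assert (HJ : is_lim_seq (fun n => INR (2 * M n * S i) / sqrt (INR n)) (2 * t * k)).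
    { apply is_lim_seq_ext with (fun n => INR (M n) / sqrt (INR n) * (2 * k)).
      - intros n. rewrite !mult_INR. fold k. simpl (INR 2). unfold Rdiv. ring.
      - replace (2 * t * k) with (t * (2 * k)) by ring. apply (is_lim_seq_scal_r _ (2 * k) t HM). }
    assert (Hc : 0 < 2 * t * k) by (apply Rmult_lt_0_compat; lra).
    pose proof (ratio_limit _ _ Hc HJ) as Hg.
    apply is_lim_seq_ext_loc with (fun n => 2 * (INR (M n) / sqrt (INR n))
       * / (1 + INR (2 * M n * S i) / sqrt (INR n) * / sqrt (INR n)) * (g (INR (2 * M n * S i)) n / U n)).
    + exists 1%nat. intros n Hn. assert (Hn' : 0 < INR n) by (apply lt_0_INR; lia).
      pose proof (sqrt_lt_R0 _ Hn') as Hs. pose proof (pos_INR (2 * M n * S i)) as HJ0.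
      pose proof (U_pos n). unfold reflection_term.
      set (J := INR (2 * M n * S i)) in *.
      replace (J / sqrt (INR n) * / sqrt (INR n)) with (J / INR n)
        by (rewrite <- (sqrt_sqrt (INR n)) at 1 by lra; field; lra).
      field. repeat split; try lra.
    + unfold Gterm. fold k.
      replace (2 * t * exp (- (2 * k ^ 2 * t ^ 2)))
        with (2 * t * / (1 + 2 * t * k * 0) * exp (- ((2 * t * k) ^ 2 / 2))).
      2: { rewrite Rmult_0_r, Rplus_0_r, Rinv_1, Rmult_1_r. do 2 f_equal. field. }
      apply is_lim_seq_mult'; auto. apply is_lim_seq_mult'.
      * apply (is_lim_seq_scal_l _ 2 t HM).
      * apply is_lim_seq_inv_R; [|rewrite Rmult_0_r; lra].
        apply is_lim_seq_plus'; [apply is_lim_seq_const|].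
        apply is_lim_seq_mult'; [auto|apply inv_sqrt_lim].
  - apply ex_series_scal_inv_sqr.
  - intros n i Hn. destruct (HN n Hn) as [Hn1 [HMn _]].
    assert (Hn' : 0 < INR n) by (apply lt_0_INR; lia).
    pose proof (sqrt_lt_R0 _ Hn') as Hs. pose proof (U_pos n) as HU.
    set (k := INR (S i)). assert (Hk : 0 < k) by (apply lt_0_INR; lia).
    assert (HMp : 0 < INR (M n)) by nra.
    unfold reflection_term.
    replace (INR (2 * M n * S i)) with (2 * INR (M n) * k) by (rewrite !mult_INR; reflexivity).
    set (m := INR (M n)) in *. set (J := 2 * m * k).
    assert (HJ : 0 < J) by (unfold J; apply Rmult_lt_0_compat; lra).
    (* With exp(-y) <= 1/y the factor J + n cancels, leaving n/(sqrt n M (i+1)^2), which is summable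
       in i uniformly in n. *)
    set (y := J ^ 2 / (2 * (J + INR n))).
    assert (Hy : 0 < y) by (apply Rdiv_lt_0_compat; [apply pow_lt; auto|lra]).
    assert (Hg : 0 <= g J n <= U n * / y).
    { split; [apply g_ge0; lra|]. eapply Rle_trans; [apply g_upper; auto|].
      apply Rmult_le_compat_l; [lra|]. apply exp_neg_le_inv; auto. }
    rewrite Rabs_pos_eq.
    2: { apply Rmult_le_pos; [|apply Rlt_le, Rinv_0_lt_compat; nra].
         apply Rmult_le_pos; [|lra]. apply Rmult_le_pos; [lra|].
         apply Rlt_le, Rdiv_lt_0_compat; lra. }
    apply Rle_trans with (2 * m * (INR n / (J + INR n)) * (U n * / y) / (sqrt (INR n) * U n)).
    + apply Rmult_le_compat_r; [apply Rlt_le, Rinv_0_lt_compat; nra|].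
      apply Rmult_le_compat_l; [|lra].
      apply Rmult_le_pos; [lra|]. apply Rlt_le, Rdiv_lt_0_compat; lra.
    + replace (2 * m * (INR n / (J + INR n)) * (U n * / y) / (sqrt (INR n) * U n))
        with (INR n / (sqrt (INR n) * m) * / k ^ 2) by (unfold y, J; unfold J in HJ; field; repeat split; lra).
      apply Rmult_le_compat_r; [apply Rlt_le, Rinv_0_lt_compat, pow_lt; auto|].
      apply div_le_l; [nra|].
      rewrite <- (sqrt_sqrt (INR n)) at 1 by lra.
      replace (2 / t * (sqrt (INR n) * m)) with (sqrt (INR n) * (2 / t * m)) by ring.
      apply Rmult_le_compat_l; [lra|].
      replace (sqrt (INR n)) with (2 / t * (t / 2 * sqrt (INR n))) at 1 by (field; lra).
      apply Rmult_le_compat_l; [apply Rlt_le, Rdiv_lt_0_compat; lra|auto].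
Qed.

(** Since n <= 4 M^2/t^2 eventually, n M^(-9/4) is at most a constant times M^(-1/4). *)
Lemma eta_bound_lim (M : nat -> nat) t : 0 < t ->
  is_lim_seq (fun n => INR (M n) / sqrt (INR n)) t ->
  is_lim_seq (fun n => INR n * eta_bound (M n)) 0.
Proof.
  intros Ht HM. destruct (eventually_ge_half M t Ht HM) as [N HN].
  assert (HMinf : is_lim_seq (fun n => INR (M n)) p_infty).
  { apply is_lim_seq_le_p_loc with (fun n => t / 2 * sqrt (INR n)).
    - exists N. intros n Hn. apply HN; auto.
    - replace p_infty with (Rbar_mult (t / 2) p_infty).
      + apply is_lim_seq_scal_l, sqrt_INR_lim.
      + apply is_Rbar_mult_unique. apply is_Rbar_mult_sym, is_Rbar_mult_p_infty_pos. simpl; lra. }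
  assert (Hsq : forall u : nat -> R, is_lim_seq u p_infty -> is_lim_seq (fun n => sqrt (u n)) p_infty).
  { intros u Hu P [A HA].
    destruct (Hu (fun x => Rmax 0 A ^ 2 < x)) as [K HK]; [exists (Rmax 0 A ^ 2); auto|].
    exists K. intros n Hn. apply HA. apply Rle_lt_trans with (Rmax 0 A); [apply Rmax_r|].
    rewrite <- (sqrt_pow2 (Rmax 0 A)) by apply Rmax_l. apply sqrt_lt_1_alt.
    split; [apply pow2_ge_0|apply HK; auto]. }
  apply is_lim_seq_le_le_loc with (fun _ => 0)
    (fun n => 4800000 / t ^ 2 * / sqrt (sqrt (INR (M n)))).
  - exists N. intros n Hn. destruct (HN n Hn) as [Hn1 [HMn _]].
    assert (Hn' : 0 < INR n) by (apply lt_0_INR; lia).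
    pose proof (sqrt_lt_R0 _ Hn') as Hs.
    unfold eta_bound. set (m := INR (M n)) in *.
    assert (Hm : 0 < m) by nra.
    set (x := sqrt (sqrt m)).
    assert (Hx : 0 < x) by (apply sqrt_lt_R0, sqrt_lt_R0; auto).
    assert (Hx4 : m = x ^ 4).
    { replace (x ^ 4) with ((x ^ 2) ^ 2) by ring. unfold x. rewrite !pow2_sqrt; auto using sqrt_pos; lra. }
    assert (Hmn : t ^ 2 * INR n <= 4 * m ^ 2).
    { rewrite <- (sqrt_sqrt (INR n)) by lra.
      replace (t ^ 2 * (sqrt (INR n) * sqrt (INR n))) with (4 * (t / 2 * sqrt (INR n)) ^ 2) by field.
      apply Rmult_le_compat_l; [lra|]. apply pow_incr. split; [nra|auto]. }
    assert (Ht2 : 0 < t ^ 2) by (apply pow_lt; auto).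
    assert (Hm2 : 0 < m ^ 2) by (apply pow_lt; auto).
    split.
    + apply Rmult_le_pos; [lra|]. apply Rlt_le, Rdiv_lt_0_compat; [|apply pow_lt; auto].
      apply Rmult_lt_0_compat; [lra|apply pow_lt; auto].
    + replace (INR n * (1200000 * x ^ 3 / m ^ 3)) with (t ^ 2 * INR n * (1200000 / (t ^ 2 * m ^ 2)) * / x).
      2: { rewrite Hx4. field. split; lra. }
      replace (4800000 / t ^ 2 * / x) with (4 * m ^ 2 * (1200000 / (t ^ 2 * m ^ 2)) * / x) by (field; lra).
      apply Rmult_le_compat_r; [apply Rlt_le, Rinv_0_lt_compat; auto|].
      apply Rmult_le_compat_r; [apply Rlt_le, Rdiv_lt_0_compat; nra|auto].
  - apply is_lim_seq_const.
  - replace (Finite 0) with (Rbar_mult (4800000 / t ^ 2) 0) by (simpl; f_equal; ring).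
    apply is_lim_seq_scal_l. apply (is_lim_seq_inv _ p_infty); [|discriminate].
    apply Hsq, Hsq, HMinf.
Qed.

Lemma Lam_limit (M : nat -> nat) t : 0 < t ->
  is_lim_seq (fun n => INR (M n) / sqrt (INR n)) t ->
  is_lim_seq (fun n => Lam (M n) n / (sqrt (INR n) * U n)) (- Series (Gterm t)).
Proof.
  intros Ht HM. destruct (eventually_ge_half M t Ht HM) as [N HN].
  pose proof (eta_bound_lim M t Ht HM) as Heta.
  pose proof (reflection_limit M t Ht HM) as Href.
  (* The bound 1/4 for n [eta_bound] gives 1/2 for (n+1) [eta_bound], as [Lam_approx] requires. *)
  destruct (is_lim_seq_eps_inv _ _ Heta (1 / 4) ltac:(lra)) as [N1 HN1].
  (* Beyond 64/t^2 one has sqrt n >= 8/t, hence [M n] >= (t/2)(8/t) = 4. *)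
  destruct (nfloor_ex (64 / t ^ 2)) as [N2 [_ HN2]].
  { apply Rlt_le, Rdiv_lt_0_compat; [lra|apply pow_lt; auto]. }
  set (D := fun n => Lam (M n) n / (sqrt (INR n) * U n)
    + Series (fun i => reflection_term (M n) n i / (sqrt (INR n) * U n))).
  assert (HD : is_lim_seq D 0).
  { apply is_lim_seq_abs_0.
    apply is_lim_seq_le_le_loc with (fun _ => 0) (fun n => INR n * eta_bound (M n) * (2 * exp 1)).
    - exists (N + N1 + S N2)%nat. intros n Hn. split; [apply Rabs_pos|].
      destruct (HN n ltac:(lia)) as [Hn1 [HMn _]].
      assert (Hn' : 0 < INR n) by (apply lt_0_INR; lia).
      pose proof (sqrt_lt_R0 _ Hn') as Hs. pose proof (U_pos n) as HU.
      assert (HM4 : (4 <= M n)%nat).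
      { apply INR_le. eapply Rle_trans; [|apply HMn]. simpl (INR 4).
        assert (64 / t ^ 2 <= INR n).
        { apply Rlt_le. eapply Rlt_le_trans; [apply HN2|]. rewrite <- S_INR. apply le_INR; lia. }
        assert (8 / t <= sqrt (INR n)).
        { rewrite <- (sqrt_pow2 (8 / t)) by (apply Rlt_le, Rdiv_lt_0_compat; lra).
          apply sqrt_le_1_alt. replace ((8 / t) ^ 2) with (64 / t ^ 2) by (field; lra). auto. }
        replace (1 + 1 + 1 + 1) with (t / 2 * (8 / t)) by (field; lra).
        apply Rmult_le_compat_l; lra. }
      specialize (HN1 n ltac:(lia)). rewrite Rminus_0_r in HN1.
      pose proof (Rle_abs (INR n * eta_bound (M n))) as Habs.
      assert (Heb : 0 <= eta_bound (M n)) by (eapply Rle_trans; [apply Rabs_pos|apply (eta_upper (M n) 0); auto]).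
      assert (Hn1' : 1 <= INR n) by (apply (le_INR 1); lia).
      assert (Hsmall : INR (S n) * eta_bound (M n) <= 1 / 2).
      { rewrite S_INR. nra. }
      pose proof (Lam_approx (M n) n HM4 Hsmall) as HL.
      rewrite <- (is_series_unique _ _ (reflection_series (M n) n ltac:(lia))) in HL.
      unfold D.
      replace (Lam (M n) n / (sqrt (INR n) * U n)
        + Series (fun i => reflection_term (M n) n i / (sqrt (INR n) * U n)))
        with ((Lam (M n) n + Series (reflection_term (M n) n)) / (sqrt (INR n) * U n)).
      2: { unfold Rdiv at 3. rewrite Series_scal_r. field. lra. }
      unfold Rdiv. rewrite Rabs_mult.
      pose proof (sqrtU_lower n Hn1) as HsU.
      rewrite (Rabs_pos_eq (/ _)) by (apply Rlt_le, Rinv_0_lt_compat; nra).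
      replace (INR n * eta_bound (M n) * (2 * exp 1)) with (2 * INR n * eta_bound (M n) * exp 1) by ring.
      apply Rmult_le_compat; auto using Rabs_pos.
      + apply Rlt_le, Rinv_0_lt_compat; nra.
      + replace (exp 1) with (/ exp (-1)).
        * apply Rinv_le_contravar; [apply exp_pos|auto].
        * rewrite <- exp_Ropp. f_equal. ring.
    - apply is_lim_seq_const.
    - replace (Finite 0) with (Rbar_mult 0 (2 * exp 1)) by (simpl; f_equal; ring).
      apply is_lim_seq_scal_r. exact Heta. }
  apply is_lim_seq_ext with (fun n => D n - Series (fun i => reflection_term (M n) n i / (sqrt (INR n) * U n))).
  - intros n. unfold D. ring.
  - replace (- Series (Gterm t)) with (0 - Series (Gterm t)) by ring.
    apply is_lim_seq_minus'; auto.
Qed.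

(** * Limits of the coefficient ratios *)

(** The t-derivative of [Gterm], and at the same time the sum of the two terms k = i+1 and k =
    -(i+1) of the announced distribution function. *)
Definition Gterm' (t : R) (i : nat) : R :=
  2 * (1 - 4 * INR (S i) ^ 2 * t ^ 2) * exp (- (2 * INR (S i) ^ 2 * t ^ 2)).

Lemma is_derive_Gterm i t : is_derive (fun s => Gterm s i) t (Gterm' t i).
Proof.
  unfold Gterm, Gterm'. generalize (INR (S i)) as k; intros k.
  auto_derive; [trivial|].
  replace (2 * (k * (k * 1)) * (t * (t * 1))) with (2 * k ^ 2 * t ^ 2) by ring. ring.
Qed.

Lemma Gterm'_bound s t i : 0 < t -> t / 2 <= s -> Rabs (Gterm' s i) <= 8192 / t ^ 2 * / INR (S i) ^ 2.
Proof.
  intros Ht Hs. unfold Gterm'. set (k := INR (S i)).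
  assert (Hk : 0 < k) by (apply lt_0_INR; lia).
  set (z := 4 * k ^ 2 * s ^ 2).
  assert (Hks : 0 < k ^ 2 * s ^ 2) by (apply Rmult_lt_0_compat; apply pow_lt; lra).
  assert (Hz : 0 < z) by (unfold z; lra).
  replace (2 * k ^ 2 * s ^ 2) with (z / 2) by (unfold z; field).
  pose proof (poly_exp_bound z ltac:(lra)) as H. pose proof (exp_pos (- (z / 2))) as He.
  rewrite Rabs_mult, (Rabs_pos_eq (exp _)) by lra.
  assert (H1 : Rabs (2 * (1 - z)) <= 2 * (1 + z)) by (apply Rabs_le; lra).
  assert (H2 : (1 + z) * exp (- (z / 2)) * z <= 4096).
  { eapply Rle_trans; [|apply H].
    replace ((1 + z) * exp (- (z / 2)) * z) with (((1 + z) * z) * exp (- (z / 2))) by ring.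
    apply Rmult_le_compat_r; [lra|].
    replace ((1 + z) ^ 4) with (((1 + z) * (1 + z)) * ((1 + z) * (1 + z))) by ring. nra. }
  apply Rle_trans with (2 * (1 + z) * exp (- (z / 2))); [apply Rmult_le_compat_r; lra|].
  apply Rle_trans with (8192 / z).
  - apply le_div_r; lra.
  - unfold Rdiv. rewrite Rmult_assoc. apply Rmult_le_compat_l; [lra|].
    rewrite <- Rinv_mult. apply Rinv_le_contravar.
    + apply Rmult_lt_0_compat; apply pow_lt; lra.
    + unfold z. replace (4 * k ^ 2 * s ^ 2) with ((2 * s) ^ 2 * k ^ 2) by ring.
      apply Rmult_le_compat_r; [apply pow2_ge_0|]. apply pow_incr; lra.
Qed.

Lemma ex_series_Gterm t : 0 < t -> ex_series (Gterm t).
Proof.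
  intros Ht. apply ex_series_dominated with (fun i => / t * / INR (S i) ^ 2); [|apply ex_series_scal_inv_sqr].
  intros i. unfold Gterm. set (k := INR (S i)). assert (Hk : 0 < k) by (apply lt_0_INR; lia).
  assert (Hy : 0 < 2 * k ^ 2 * t ^ 2).
  { apply Rmult_lt_0_compat; [apply Rmult_lt_0_compat; [lra|]|]; apply pow_lt; auto. }
  pose proof (exp_neg_le_inv _ Hy). pose proof (exp_pos (- (2 * k ^ 2 * t ^ 2))).
  rewrite Rabs_pos_eq by (apply Rmult_le_pos; lra).
  apply Rle_trans with (2 * t * / (2 * k ^ 2 * t ^ 2)); [apply Rmult_le_compat_l; lra|].
  right. field. lra.
Qed.

(** Termwise differentiation, phrased along a sequence of increments so that [tannery] applies; the
    mean value theorem and [Gterm'_bound] dominate the quotients. *)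
Lemma Gsum_quotient t (d : nat -> R) : 0 < t ->
  (forall n, d n <> 0) -> (forall n, Rabs (d n) <= t / 2) -> is_lim_seq d 0 ->
  ex_series (Gterm' t) /\
  is_lim_seq (fun n => (Series (Gterm (t + d n)) - Series (Gterm t)) / d n) (Series (Gterm' t)).
Proof.
  intros Ht Hd0 Hdt Hd.
  assert (Hd' : forall n, 0 < t + d n) by (intros n; specialize (Hdt n); apply Rabs_le_between in Hdt; lra).
  destruct (tannery (fun n i => (Gterm (t + d n) i - Gterm t i) / d n) (Gterm' t)
              (fun i => 8192 / t ^ 2 * / INR (S i) ^ 2) 0) as [H1 H2].
  - intros i. apply is_lim_seq_eps; intros eps Heps.
    pose proof (is_derive_Gterm i t) as Hder. apply is_derive_Reals in Hder.
    destruct (Hder eps Heps) as [del Hdel].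
    destruct (is_lim_seq_eps_inv _ _ Hd del (cond_pos del)) as [N HN].
    exists N. intros n Hn. apply Hdel; auto. specialize (HN n Hn). rewrite Rminus_0_r in HN. auto.
  - apply ex_series_scal_inv_sqr.
  - intros n i _.
    destruct (MVT_gen (fun s => Gterm s i) t (t + d n) (fun s => Gterm' s i)) as [c [Hc E]].
    + intros x _. apply is_derive_Gterm.
    + intros x _. apply continuity_pt_filterlim. apply (ex_derive_continuous (fun s => Gterm s i)).
      exists (Gterm' x i). apply is_derive_Gterm.
    + rewrite E. replace (Gterm' c i * (t + d n - t) / d n) with (Gterm' c i) by (field; auto).
      apply Gterm'_bound; auto. specialize (Hdt n). apply Rabs_le_between in Hdt.
      apply Rle_trans with (Rmin t (t + d n)); [|apply Hc]. apply Rmin_glb; lra.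
  - split; auto. eapply is_lim_seq_ext; [|exact H2].
    intros n. simpl. unfold Rdiv. rewrite Series_scal_r. f_equal.
    apply Series_minus; apply ex_series_Gterm; auto.
Qed.

(** As [up] is the floor plus one, this exceeds x strictly even at integers; subtracting 1 gives the
    floor. *)
Definition ceil (x : R) : nat := Z.to_nat (up x).

Lemma ceil_spec x : 0 <= x -> x < INR (ceil x) <= x + 1.
Proof.
  intros Hx. unfold ceil. destruct (archimed x) as [H1 H2].
  rewrite INR_IZR_INZ, Z2Nat.id; [lra|]. apply le_IZR. lra.
Qed.

Lemma ceil_limit d : 0 < d -> is_lim_seq (fun n => INR (ceil (d * sqrt (INR n))) / sqrt (INR n)) d.
Proof.
  intros Hd. apply is_lim_seq_le_le_loc with (fun _ => d) (fun n => d + / sqrt (INR n)).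
  - exists 1%nat. intros n Hn. assert (Hn' : 0 < INR n) by (apply lt_0_INR; lia).
    pose proof (sqrt_lt_R0 _ Hn') as Hs.
    destruct (ceil_spec (d * sqrt (INR n))) as [H1 H2]; [apply Rmult_le_pos; lra|].
    split; [apply le_div_r; lra|]. apply div_le_l; auto.
    rewrite Rmult_plus_distr_r, Rinv_l; lra.
  - apply is_lim_seq_const.
  - replace (Finite d) with (Finite (d + 0)) by (f_equal; ring).
    apply is_lim_seq_plus'; [apply is_lim_seq_const|apply inv_sqrt_lim].
Qed.

Lemma scaled_add (m h : nat -> nat) (s t : R) :
  is_lim_seq (fun n => INR (m n) / sqrt (INR n)) s -> is_lim_seq (fun n => INR (h n) / sqrt (INR n)) t ->
  is_lim_seq (fun n => INR (m n + h n) / sqrt (INR n)) (s + t).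
Proof.
  intros Hm Hh. apply is_lim_seq_ext with (fun n => INR (m n) / sqrt (INR n) + INR (h n) / sqrt (INR n)).
  - intros n. rewrite plus_INR. unfold Rdiv. ring.
  - apply is_lim_seq_plus'; [exact Hm|exact Hh].
Qed.

Lemma scaled_const (c : nat) : is_lim_seq (fun n => INR c / sqrt (INR n)) 0.
Proof.
  replace (Finite 0) with (Rbar_mult (INR c) 0) by (simpl; f_equal; ring).
  apply (is_lim_seq_scal_l (fun n => / sqrt (INR n))), inv_sqrt_lim.
Qed.

Lemma scaled_add_const (m : nat -> nat) c (t : R) :
  is_lim_seq (fun n => INR (m n) / sqrt (INR n)) t -> is_lim_seq (fun n => INR (m n + c) / sqrt (INR n)) t.
Proof.
  intros Hm. replace (Finite t) with (Finite (t + 0)) by (f_equal; ring).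
  apply (scaled_add m (fun _ => c)); [auto|apply scaled_const].
Qed.

Lemma lam_eq_coef m n : (1 <= n)%nat -> lam m n = U n + Lam (m + 1) n - Lam (m + 2) n.
Proof. intros Hn. rewrite lam_eq. unfold fsub, fadd. destruct n; [lia|]. simpl cst. ring. Qed.

Lemma lam_mono_le m m' k : (m <= m')%nat -> lam m k <= lam m' k.
Proof. induction 1; [lra|]. eapply Rle_trans; [eassumption|apply lam_mono]. Qed.

(** By monotonicity [lam m] is at most each of the h values [lam (m + j)], and their sum telescopes
    in [Lam]. The lower window compares with the values before [mu] instead. *)
Lemma lam_upper_window m h n : (1 <= n)%nat ->
  INR h * lam m n <= INR h * U n + (Lam (m + 1) n - Lam (m + h + 1) n).
Proof.
  intros Hn. induction h as [|h IH].
  - simpl. rewrite Nat.add_0_r. lra.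
  - rewrite S_INR. pose proof (lam_mono_le m (m + h) n ltac:(lia)) as H.
    rewrite (lam_eq_coef (m + h)) in H by auto.
    replace (m + S h + 1)%nat with (m + h + 2)%nat by lia. lra.
Qed.

Lemma lam_lower_window m mu h n : (1 <= n)%nat -> (m + h <= mu)%nat ->
  INR h * U n + (Lam (m + 1) n - Lam (m + h + 1) n) <= INR h * lam mu n.
Proof.
  intros Hn. induction h as [|h IH]; intros Hmu.
  - simpl. rewrite Nat.add_0_r. lra.
  - rewrite S_INR. pose proof (lam_mono_le (m + h) mu n ltac:(lia)) as H.
    rewrite (lam_eq_coef (m + h)) in H by auto. specialize (IH ltac:(lia)).
    replace (m + S h + 1)%nat with (m + h + 2)%nat by lia. lra.
Qed.

Lemma window_limit (a b h : nat -> nat) s t d : 0 < s -> 0 < t -> 0 < d ->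
  is_lim_seq (fun n => INR (a n) / sqrt (INR n)) s -> is_lim_seq (fun n => INR (b n) / sqrt (INR n)) t ->
  is_lim_seq (fun n => INR (h n) / sqrt (INR n)) d ->
  is_lim_seq (fun n => 1 + / (INR (h n) / sqrt (INR n)) *
     (Lam (a n) n / (sqrt (INR n) * U n) - Lam (b n) n / (sqrt (INR n) * U n)))
    (1 + / d * (- Series (Gterm s) - - Series (Gterm t))).
Proof.
  intros Hs Ht Hd Ha Hb Hh.
  apply is_lim_seq_plus'; [apply is_lim_seq_const|]. apply is_lim_seq_mult'.
  - apply is_lim_seq_inv_R; auto; lra.
  - apply is_lim_seq_minus'; apply Lam_limit; auto.
Qed.

(** A Tauberian argument: windows of width e sqrt n on either side of m squeeze [lam] between two
    difference quotients, both close to the derivative. The width e is fixed before n grows. *)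
Lemma lam_limit (m : nat -> nat) t : 0 < t ->
  is_lim_seq (fun n => INR (m n) / sqrt (INR n)) t ->
  is_lim_seq (fun n => lam (m n) n / U n) (1 + Series (Gterm' t)).
Proof.
  intros Ht Hm. apply is_lim_seq_eps; intros eps Heps.
  (* Only one member e of this sequence is kept, chosen so that the forward and the backward
     quotient are both within eps/2 of the derivative; e <= t/2 keeps the lower window positive. *)
  set (d := fun n : nat => t / 2 * / INR (S n)).
  assert (Hdpos : forall n, 0 < d n <= t / 2).
  { intros n. assert (1 <= INR (S n)) by (apply (le_INR 1); lia).
    assert (0 < / INR (S n) <= 1).
    { split; [apply Rinv_0_lt_compat; lra|]. rewrite <- Rinv_1. apply Rinv_le_contravar; lra. }
    unfold d. nra. }
  assert (Hdlim : is_lim_seq d 0).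
  { replace (Finite 0) with (Rbar_mult (t / 2) 0) by (simpl; f_equal; ring).
    apply is_lim_seq_scal_l. apply (is_lim_seq_incr_1 (fun n => / INR n)).
    apply (is_lim_seq_inv _ p_infty); [apply is_lim_seq_INR|discriminate]. }
  destruct (Gsum_quotient t d Ht) as [_ Hplus]; auto.
  { intros n. specialize (Hdpos n). lra. }
  { intros n. specialize (Hdpos n). rewrite Rabs_pos_eq; lra. }
  destruct (Gsum_quotient t (fun n => - d n) Ht) as [_ Hminus]; auto.
  { intros n. specialize (Hdpos n). lra. }
  { intros n. specialize (Hdpos n). rewrite Rabs_Ropp, Rabs_pos_eq; lra. }
  { replace 0 with (- 0) by ring. apply is_lim_seq_opp_R. auto. }
  destruct (is_lim_seq_eps_inv _ _ Hplus (eps / 2) ltac:(lra)) as [N1 HN1].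
  destruct (is_lim_seq_eps_inv _ _ Hminus (eps / 2) ltac:(lra)) as [N2 HN2].
  set (K := (N1 + N2)%nat). specialize (HN1 K ltac:(lia)). specialize (HN2 K ltac:(lia)).
  set (e := d K) in *. specialize (Hdpos K). fold e in Hdpos. clearbody e. clear d Hdlim Hplus Hminus.
  set (h := fun n => ceil (e * sqrt (INR n))).
  assert (Hh : is_lim_seq (fun n => INR (h n) / sqrt (INR n)) e) by (apply ceil_limit; lra).
  assert (Hle : exists N, forall n, (N <= n)%nat -> (h n <= m n)%nat).
  { assert (Hdiff : is_lim_seq (fun n => INR (m n) / sqrt (INR n) - INR (h n) / sqrt (INR n)) (t - e))
      by (apply is_lim_seq_minus'; auto).
    destruct (is_lim_seq_eps_inv _ _ Hdiff ((t - e)) ltac:(lra)) as [N HN].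
    exists (S N). intros n Hn. specialize (HN n ltac:(lia)). apply Rabs_def2 in HN.
    apply INR_le. apply Rlt_le.
    assert (Hs : 0 < sqrt (INR n)) by (apply sqrt_lt_R0, lt_0_INR; lia).
    apply Rmult_lt_reg_r with (/ sqrt (INR n)); [apply Rinv_0_lt_compat; auto|].
    unfold Rdiv in HN. lra. }
  destruct Hle as [N3 HN3].
  assert (Hsub : is_lim_seq (fun n => INR (m n - h n) / sqrt (INR n)) (t - e)).
  { apply is_lim_seq_ext_loc with (fun n => INR (m n) / sqrt (INR n) - INR (h n) / sqrt (INR n)).
    - exists N3. intros n Hn. rewrite minus_INR by auto. unfold Rdiv. ring.
    - apply is_lim_seq_minus'; auto. }
  pose proof (window_limit (fun n => m n + 1)%nat (fun n => m n + h n + 1)%nat h t (t + e) e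
    Ht ltac:(lra) ltac:(lra) (scaled_add_const _ 1 _ Hm)
    (scaled_add_const (fun n => m n + h n)%nat 1 _ (scaled_add _ _ _ _ Hm Hh)) Hh) as HU.
  pose proof (window_limit (fun n => m n - h n + 1)%nat (fun n => m n + 1)%nat h (t - e) t e
    ltac:(lra) Ht ltac:(lra) (scaled_add_const (fun n => m n - h n)%nat 1 _ Hsub) (scaled_add_const _ 1 _ Hm) Hh) as HL.
  destruct (is_lim_seq_eps_inv _ _ HU (eps / 2) ltac:(lra)) as [N4 HN4].
  destruct (is_lim_seq_eps_inv _ _ HL (eps / 2) ltac:(lra)) as [N5 HN5].
  exists (N3 + N4 + N5 + 1)%nat. intros n Hn.
  specialize (HN3 n ltac:(lia)). specialize (HN4 n ltac:(lia)). specialize (HN5 n ltac:(lia)).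
  assert (Hn1 : (1 <= n)%nat) by lia.
  pose proof (lam_upper_window (m n) (h n) n Hn1) as Hup.
  pose proof (lam_lower_window (m n - h n) (m n) (h n) n Hn1 ltac:(lia)) as Hlo.
  replace (m n - h n + h n)%nat with (m n) in Hlo by lia.
  assert (Hn' : 0 < INR n) by (apply lt_0_INR; lia).
  pose proof (sqrt_lt_R0 _ Hn') as Hs. pose proof (U_pos n) as HUp.
  assert (Hhp : 0 < INR (h n)).
  { destruct (ceil_spec (e * sqrt (INR n))) as [H1 _]; [apply Rmult_le_pos; lra|].
    unfold h. apply Rle_lt_trans with (e * sqrt (INR n)); auto. apply Rmult_le_pos; lra. }
  assert (Hup' : lam (m n) n / U n <= 1 + / (INR (h n) / sqrt (INR n)) *
     (Lam (m n + 1) n / (sqrt (INR n) * U n) - Lam (m n + h n + 1) n / (sqrt (INR n) * U n))).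
  { apply div_le_l; auto. apply Rmult_le_reg_l with (INR (h n)); auto.
    eapply Rle_trans; [apply Hup|]. right. field. lra. }
  assert (Hlo' : 1 + / (INR (h n) / sqrt (INR n)) *
     (Lam (m n - h n + 1) n / (sqrt (INR n) * U n) - Lam (m n + 1) n / (sqrt (INR n) * U n)) <= lam (m n) n / U n).
  { apply le_div_r; auto. apply Rmult_le_reg_l with (INR (h n)); auto.
    eapply Rle_trans; [|apply Hlo]. right. field. lra. }
  apply Rabs_def2 in HN1, HN2, HN4, HN5.
  replace ((Series (Gterm (t + e)) - Series (Gterm t)) / e)
    with (/ e * (- Series (Gterm t) - - Series (Gterm (t + e)))) in HN1 by (field; lra).
  replace (t + - e) with (t - e) in HN2 by ring.
  replace ((Series (Gterm (t - e)) - Series (Gterm t)) / - e)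
    with (/ e * (- Series (Gterm (t - e)) - - Series (Gterm t))) in HN2 by (field; lra).
  apply Rabs_def1; lra.
Qed.

(** * Regular variation of [U] and passage from [lam] to [Pm] *)

Lemma U_decr k : U (S k) <= U k.
Proof.
  destruct k as [|k].
  - rewrite U_0, U_1, <- exp_0. apply exp_le; lra.
  - rewrite U_S by lia. rewrite <- (Rmult_1_r (U (S k))) at 2.
    apply Rmult_le_compat_l; [apply Rlt_le, U_pos|].
    apply Rle_trans with (exp 0); [apply exp_le|rewrite exp_0; lra].
    assert (H : 0 < INR (S k)) by (apply lt_0_INR; lia).
    pose proof (g_exponent_upper 1 (INR (S k)) ltac:(lra) H) as H1.
    unfold Rdiv at 1 in H1. rewrite Rmult_1_l in H1.
    assert (0 <= 1 ^ 2 / (2 * (1 + INR (S k)))) by (apply Rlt_le, Rdiv_lt_0_compat; lra). lra.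
Qed.

Lemma U_decr_le j k : (j <= k)%nat -> U k <= U j.
Proof. induction 1; [lra|]. eapply Rle_trans; [apply U_decr|auto]. Qed.

Lemma U_ratio_S : is_lim_seq (fun n => U (S n) / U n) 1.
Proof.
  apply is_lim_seq_le_le_loc with (fun n => 1 - / INR n) (fun _ => 1).
  - exists 1%nat. intros n Hn. pose proof (U_pos n) as HU. assert (H : 0 < INR n) by (apply lt_0_INR; lia).
    split; [|apply div_le_l; auto; rewrite Rmult_1_l; apply U_decr].
    rewrite U_S by auto. replace (U n * _ / U n) with (exp (INR n * ln (1 + / INR n) - 1)) by (field; lra).
    pose proof (g_exponent_lower 1 (INR n) ltac:(lra) H) as H1.
    unfold Rdiv at 2 in H1. rewrite Rmult_1_l in H1.
    eapply Rle_trans; [|apply exp_ineq1_le].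
    assert (1 ^ 2 / (2 * INR n) <= / INR n); [|lra].
    replace (1 ^ 2 / (2 * INR n)) with (/ 2 * / INR n) by (field; lra).
    pose proof (Rinv_0_lt_compat _ H). lra.
  - replace (Finite 1) with (Finite (1 - 0)) by (f_equal; ring).
    apply is_lim_seq_minus'; [apply is_lim_seq_const|].
    apply (is_lim_seq_inv _ p_infty); [apply is_lim_seq_INR|discriminate].
  - apply is_lim_seq_const.
Qed.

Lemma U_ratio_shift i : is_lim_seq (fun n => U n / U (n + i)%nat) 1.
Proof.
  induction i as [|i IH].
  - apply is_lim_seq_ext with (fun _ => 1); [|apply is_lim_seq_const].
    intros n. rewrite Nat.add_0_r. pose proof (U_pos n). field. lra.
  - apply is_lim_seq_ext with (fun n => U n / U (n + i)%nat * / (U (S (n + i)) / U (n + i)%nat)).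
    + intros n. rewrite Nat.add_succ_r. pose proof (U_pos (n + i)). pose proof (U_pos (S (n + i))).
      field. lra.
    + replace (Finite 1) with (Finite (1 * / 1)) by (f_equal; field).
      apply is_lim_seq_mult'; auto. apply is_lim_seq_inv_R; [|lra].
      apply (is_lim_seq_incr_n (fun n => U (S n) / U n) i). apply U_ratio_S.
Qed.

(** From U_k^2 <= 2/n and U_n^2 >= e^(-2)/n >= 1/(9n), the ratio of squares is at most 18 <= 36. *)
Lemma U_half n k : (1 <= n)%nat -> (n <= 2 * k)%nat -> U k <= 6 * U n.
Proof.
  intros Hn Hk. pose proof (U_sqr_upper k) as H1. pose proof (U_sqr_lower n Hn) as H2.
  pose proof (U_pos k). pose proof (U_pos n).
  assert (Hn' : 1 <= INR n) by (apply (le_INR 1); auto).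
  assert (Hk' : INR n <= 2 * INR (S k)).
  { replace (2 * INR (S k)) with (INR (2 * S k)) by (rewrite mult_INR; reflexivity). apply le_INR; lia. }
  assert (H3 : / 9 <= exp (-2)).
  { replace (exp (-2)) with (/ (exp 1 * exp 1)).
    - pose proof exp_le_3. pose proof (exp_pos 1). apply Rinv_le_contravar; nra.
    - rewrite <- exp_plus, <- exp_Ropp. f_equal; ring. }
  apply Rsqr_incr_0_var; [|lra]. unfold Rsqr.
  assert (U k ^ 2 * INR n <= 2) by nra.
  apply Rmult_le_reg_r with (INR n); [lra|]. nra.
Qed.

Lemma p1_U k : p 1 k * (1 + INR k) <= U k.
Proof.
  pose proof (pos_INR k). unfold p. replace (1 / (1 + INR k) * g 1 k * (1 + INR k)) with (g 1 k) by (field; lra).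
  apply g_le_U; lra.
Qed.

(** Since [U] decreases, U_n times this sum is at most the convolution of [p 1] with [U], which is
    [g 1 n] <= U_n. *)
Lemma p1_sum n : sum_f_R0 (p 1) n <= 1.
Proof.
  pose proof (U_pos n) as HU. apply Rmult_le_reg_r with (U n); auto. rewrite Rmult_1_l.
  apply Rle_trans with (g 1 n); [|apply g_le_U; lra].
  replace (g 1 n) with ((p 1 * g 0)%FS n) by (rewrite p1_mul_g, Rplus_0_l; reflexivity).
  rewrite fmul_sum, Rmult_comm, scal_sum. apply sum_Rle; intros i Hi.
  apply Rmult_le_compat_l; [apply p_ge0; lra|]. apply U_decr_le; lia.
Qed.

Lemma ex_series_p1 : ex_series (p 1).
Proof.
  assert (H : ex_finite_lim_seq (sum_f_R0 (p 1))).
  { apply ex_finite_lim_seq_incr with 1; [|apply p1_sum].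
    intros n. rewrite tech5. pose proof (p_ge0 1 (S n)). lra. }
  destruct H as [l Hl]. exists l. apply is_series_Reals. apply is_lim_seq_Reals in Hl. exact Hl.
Qed.

Lemma series_finite (a : nat -> R) n : (forall i, (n < i)%nat -> a i = 0) -> Series a = sum_f_R0 a n.
Proof.
  intros H. apply is_series_unique, is_series_Reals. intros eps Heps. exists n. intros N HN.
  replace (sum_f_R0 a N) with (sum_f_R0 a n); [rewrite R_dist_eq; auto|].
  induction HN as [|N HN IH]; [reflexivity|]. rewrite tech5, <- IH, H by lia. ring.
Qed.

Lemma sum_rev (a : nat -> R) n : sum_f_R0 (fun i => a (n - i)%nat) n = sum_f_R0 a n.
Proof.
  induction n as [|n IH]; [reflexivity|].
  rewrite decomp_sum by lia. simpl pred. rewrite tech5, <- IH, Nat.sub_0_r, Rplus_comm. reflexivity.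
Qed.

(** For i <= n/2 the factor [l] sits at an index comparable to n, and [tannery] applies with the
    summable [p 1]. For i > n/2 one has [p 1 i] <= 12 U_n/n, while the sum of [U] up to n is at most
    6 sqrt n, so that half is O(n^(-1/2)). *)
Lemma conv_limit (l P : nat -> fps) (c : R) :
  (forall n k, 0 <= l n k <= U k) -> (forall n k, 0 <= P n k <= exp 1 * p 1 k) ->
  (forall i, is_lim_seq (fun n => P n i) (exp 1 * p 1 i)) ->
  (forall i, is_lim_seq (fun n => l n (n - i)%nat / U n) c) ->
  is_lim_seq (fun n => (l n * P n)%FS n / U n) (c * (exp 1 * Series (p 1))).
Proof.
  intros Hl HP HPlim Hllim.
  set (a := fun n i => if (2 * i <=? n)%nat then l n (n - i)%nat / U n * P n i else 0).
  assert (He : 0 < exp 1) by apply exp_pos.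
  assert (Ha : is_lim_seq (fun n => Series (a n)) (Series (fun i => c * (exp 1 * p 1 i)))).
  { apply (tannery a (fun i => c * (exp 1 * p 1 i)) (fun i => 6 * exp 1 * p 1 i) 1).
    - intros i. apply is_lim_seq_ext_loc with (fun n => l n (n - i)%nat / U n * P n i).
      + exists (2 * i)%nat. intros n Hn. unfold a. destruct (Nat.leb_spec (2 * i) n); [reflexivity|lia].
      + apply is_lim_seq_mult'; auto.
    - apply (ex_series_scal (K := R_AbsRing) (V := R_NormedModule) (6 * exp 1) (p 1)), ex_series_p1.
    - intros n i Hn. pose proof (U_pos n) as HU. pose proof (p_ge0 1 i ltac:(lra)) as Hp.
      unfold a. destruct (Nat.leb_spec (2 * i) n) as [Hi|Hi].
      + destruct (HP n i) as [HP1 HP2]. destruct (Hl n (n - i)%nat) as [Hl1 Hl2].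
        assert (Hr : 0 <= l n (n - i)%nat / U n <= 6).
        { split; [apply Rmult_le_pos; [auto|apply Rlt_le, Rinv_0_lt_compat; auto]|].
          apply div_le_l; auto. eapply Rle_trans; [apply Hl2|apply U_half; lia]. }
        rewrite Rabs_pos_eq by (apply Rmult_le_pos; lra).
        rewrite Rmult_assoc. apply Rmult_le_compat; lra.
      + rewrite Rabs_R0. apply Rmult_le_pos; lra. }
  assert (Hb : is_lim_seq (fun n => (l n * P n)%FS n / U n - Series (a n)) 0).
  { apply is_lim_seq_le_le_loc with (fun _ => 0) (fun n => exp 1 * 72 * / sqrt (INR n)).
    - exists 1%nat. intros n Hn. pose proof (U_pos n) as HU.
      assert (Hn' : 1 <= INR n) by (apply (le_INR 1); auto).
      pose proof (sqrt_lt_R0 (INR n) ltac:(lra)) as Hs.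
      assert (E : (l n * P n)%FS n / U n - Series (a n)
        = sum_f_R0 (fun i => if (2 * i <=? n)%nat then 0 else l n (n - i)%nat / U n * P n i) n).
      { rewrite (series_finite (a n) n).
        - rewrite fmulC, fmul_sum. unfold Rdiv. rewrite Rmult_comm, scal_sum, <- minus_sum.
          apply sum_eq; intros i Hi. unfold a. destruct (2 * i <=? n)%nat; unfold Rdiv; ring.
        - intros i Hi. unfold a. destruct (Nat.leb_spec (2 * i) n); [lia|reflexivity]. }
      rewrite E. split.
      + apply cond_pos_sum; intros i. destruct (2 * i <=? n)%nat; [lra|].
        destruct (HP n i). destruct (Hl n (n - i)%nat).
        apply Rmult_le_pos; [|lra]. apply Rmult_le_pos; [lra|apply Rlt_le, Rinv_0_lt_compat; auto].
      + apply Rle_trans with (sum_f_R0 (fun i => U (n - i)%nat * (exp 1 * (12 / INR n))) n).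
        * apply sum_Rle; intros i Hi. destruct (Nat.leb_spec (2 * i) n) as [Hi2|Hi2].
          -- apply Rmult_le_pos; [apply Rlt_le, U_pos|]. apply Rmult_le_pos; [lra|].
             apply Rlt_le, Rdiv_lt_0_compat; lra.
          -- destruct (HP n i) as [HP1 HP2]. destruct (Hl n (n - i)%nat) as [Hl1 Hl2].
             unfold Rdiv at 1. rewrite Rmult_assoc.
             assert (0 < / U n) by (apply Rinv_0_lt_compat; auto).
             apply Rmult_le_compat; auto; [apply Rmult_le_pos; lra|].
             apply Rle_trans with (/ U n * (exp 1 * p 1 i)); [apply Rmult_le_compat_l; lra|].
             replace (/ U n * (exp 1 * p 1 i)) with (exp 1 * (p 1 i / U n)) by (field; lra).
             apply Rmult_le_compat_l; [lra|].
             apply div_le_l; auto.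
             pose proof (p1_U i). pose proof (U_half n i Hn ltac:(lia)). pose proof (p_ge0 1 i ltac:(lra)).
             assert (INR n <= 2 * (1 + INR i)).
             { replace (2 * (1 + INR i)) with (INR (2 * i + 2)) by (rewrite plus_INR, mult_INR; simpl; ring).
               apply le_INR; lia. }
             apply Rmult_le_reg_r with (INR n); [lra|].
             replace (12 / INR n * U n * INR n) with (2 * (6 * U n)) by (field; lra).
             apply Rle_trans with (2 * (p 1 i * (1 + INR i))); [|lra].
             replace (2 * (p 1 i * (1 + INR i))) with (p 1 i * (2 * (1 + INR i))) by ring.
             apply Rmult_le_compat_l; lra.
        * rewrite <- scal_sum.
          assert (Hsum : sum_f_R0 (fun i => U (n - i)%nat) n <= 2 * sqrt (INR (S n))).
          { rewrite (sum_rev U). eapply Rle_trans; [|apply inv_sqrt_sum].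
            apply sum_Rle; intros i Hi. apply U_upper. }
          assert (Hs2 : sqrt (INR (S n)) <= 3 * sqrt (INR n)).
          { replace (3 * sqrt (INR n)) with (sqrt (9 * INR n)).
            - apply sqrt_le_1_alt. rewrite S_INR. lra.
            - rewrite sqrt_mult by lra. replace 9 with (3 * 3) by ring. rewrite sqrt_square by lra. reflexivity. }
          apply Rle_trans with (exp 1 * (12 / INR n) * (6 * sqrt (INR n))).
          -- apply Rmult_le_compat_l; [|lra]. apply Rmult_le_pos; [lra|].
             apply Rlt_le, Rdiv_lt_0_compat; lra.
          -- right. rewrite <- (sqrt_sqrt (INR n)) at 1 by lra. field. lra.
    - apply is_lim_seq_const.
    - replace (Finite 0) with (Rbar_mult (exp 1 * 72) 0) by (simpl; f_equal; ring).
      apply is_lim_seq_scal_l, inv_sqrt_lim. }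
  apply is_lim_seq_ext with (fun n => Series (a n) + ((l n * P n)%FS n / U n - Series (a n))); [intros; ring|].
  replace (c * (exp 1 * Series (p 1))) with (Series (fun i => c * (exp 1 * p 1 i)) + 0).
  - apply is_lim_seq_plus'; auto.
  - rewrite !Series_scal_l. ring.
Qed.

Lemma U_sub_cst k : 0 <= (U - cst 1)%FS k <= U k.
Proof.
  unfold fsub. destruct k as [|k].
  - rewrite U_0. simpl. lra.
  - simpl cst. pose proof (U_pos (S k)). lra.
Qed.

Lemma U_ratio_sub i : is_lim_seq (fun n => U (n - i)%nat / U n) 1.
Proof.
  apply (is_lim_seq_incr_n _ i). eapply is_lim_seq_ext; [|apply (U_ratio_shift i)].
  intros n. simpl. rewrite Nat.add_sub. reflexivity.
Qed.

(** Since y P' = [lam] P, the n-th coefficient of [Pm] is a convolution divided by n. The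
    unrestricted series e [p 1] obeys the same equation with [U - cst 1] for [lam], and the quotient
    of the two limits is the claim. *)
Lemma Pm_ratio_limit (m : nat -> nat) t : 0 < t ->
  is_lim_seq (fun n => INR (m n) / sqrt (INR n)) t ->
  is_lim_seq (fun n => Pm (m n) n / (exp 1 * p 1 n)) (1 + Series (Gterm' t)).
Proof.
  intros Ht Hm.
  assert (He : 0 < exp 1) by apply exp_pos.
  assert (Hminf : forall i, exists N, forall n, (N <= n)%nat -> (i <= m n)%nat).
  { intros i. destruct (eventually_ge_half m t Ht Hm) as [N HN].
    destruct (nfloor_ex ((2 * INR i / t) ^ 2)) as [N2 [_ HN2]]; [apply pow2_ge_0|].
    exists (N + S N2)%nat. intros n Hn. destruct (HN n ltac:(lia)) as [Hn1 [H1 _]].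
    apply INR_le. eapply Rle_trans; [|apply H1].
    replace (INR i) with (t / 2 * (2 * INR i / t)) by (field; lra).
    apply Rmult_le_compat_l; [lra|].
    assert (0 <= 2 * INR i / t).
    { apply Rmult_le_pos; [pose proof (pos_INR i); lra|apply Rlt_le, Rinv_0_lt_compat; auto]. }
    rewrite <- (sqrt_pow2 (2 * INR i / t)) by auto. apply sqrt_le_1_alt, Rlt_le.
    eapply Rlt_le_trans; [apply HN2|]. rewrite <- S_INR. apply le_INR; lia. }
  assert (H1 : is_lim_seq (fun n => (lam (m n) * Pm (m n))%FS n / U n)
     ((1 + Series (Gterm' t)) * (exp 1 * Series (p 1)))).
  { apply (conv_limit (fun n => lam (m n)) (fun n => Pm (m n))).
    - intros n k. split; [apply lam_ge0|]. eapply Rle_trans; [apply lam_le|apply U_sub_cst].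
    - intros n k. split; [apply Pm_ge0|apply Pm_le].
    - intros i. destruct (Hminf i) as [N HN].
      apply is_lim_seq_ext_loc with (fun _ => exp 1 * p 1 i); [|apply is_lim_seq_const].
      exists N. intros n Hn. rewrite Pm_low; auto.
    - intros i. apply (is_lim_seq_incr_n _ i).
      apply is_lim_seq_ext with (fun n => lam (m (n + i)%nat) n / U n * (U n / U (n + i)%nat)).
      + intros n. rewrite Nat.add_sub. pose proof (U_pos n). pose proof (U_pos (n + i)). field. lra.
      + replace (Finite (1 + Series (Gterm' t))) with (Finite ((1 + Series (Gterm' t)) * 1)) by (f_equal; ring).
        apply is_lim_seq_mult'; [|apply U_ratio_shift].
        (* After reindexing, m is evaluated at n+i but the coefficient at n; the scaling limit is
           unchanged since sqrt((n+i)/n) tends to 1. *)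
        apply (lam_limit (fun n => m (n + i)%nat) t Ht).
        assert (Hmi := proj1 (is_lim_seq_incr_n _ i _) Hm). simpl in Hmi.
        destruct (eventually_ge_half m t Ht Hm) as [N HN].
        apply is_lim_seq_ext_loc with (fun n => INR (m (n + i)%nat) / sqrt (INR (n + i)) * sqrt (1 + INR i * / INR n)).
        * exists 1%nat. intros n Hn. assert (Hn' : 0 < INR n) by (apply lt_0_INR; lia).
          pose proof (pos_INR i) as Hi.
          assert (Hni : 0 < INR (n + i)) by (rewrite plus_INR; lra).
          pose proof (sqrt_lt_R0 _ Hn') as Hs. pose proof (sqrt_lt_R0 _ Hni) as Hs2.
          replace (1 + INR i * / INR n) with (INR (n + i) / INR n) by (rewrite plus_INR; field; lra).
          rewrite sqrt_div by lra. field. lra.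
        * replace (Finite t) with (Finite (t * sqrt (1 + INR i * 0)))
            by (rewrite Rmult_0_r, Rplus_0_r, sqrt_1; f_equal; ring).
          apply is_lim_seq_mult'; auto.
          apply (is_lim_seq_continuous sqrt).
          { apply continuity_pt_sqrt. rewrite Rmult_0_r, Rplus_0_r. lra. }
          apply is_lim_seq_plus'; [apply is_lim_seq_const|].
          apply is_lim_seq_mult'; [apply is_lim_seq_const|].
          apply (is_lim_seq_inv _ p_infty); [apply is_lim_seq_INR|discriminate]. }
  (* The same limit for the unrestricted series, so that n and e [Series (p 1)] cancel and this sum
     needs no evaluation, only positivity. *)
  assert (H2 : is_lim_seq (fun n => ((U - cst 1) * (cst (exp 1) * p 1))%FS n / U n)
     (1 * (exp 1 * Series (p 1)))).
  { apply (conv_limit (fun _ => U - cst 1)%FS (fun _ => cst (exp 1) * p 1)%FS).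
    - intros _ k. apply U_sub_cst.
    - intros _ k. rewrite cst_mul_coef. split; [|lra].
      apply Rmult_le_pos; [lra|apply p_ge0; lra].
    - intros i. rewrite cst_mul_coef. apply is_lim_seq_const.
    - intros i. apply is_lim_seq_ext_loc with (fun n => U (n - i)%nat / U n); [|apply U_ratio_sub].
      exists (S i). intros n Hn. unfold fsub. destruct (n - i)%nat as [|j] eqn:E; [lia|]. simpl cst.
      rewrite Rminus_0_r. reflexivity. }
  assert (HS : 0 < Series (p 1)).
  { apply Rlt_le_trans with (p 1 O); [rewrite p_at_0 by lra; apply exp_pos|].
    rewrite Series_incr_1 by apply ex_series_p1.
    assert (0 <= Series (fun k => p 1 (S k))); [|lra].
    rewrite <- (Rmult_0_l (Series (fun k => p 1 (S k)))), <- Series_scal_l.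
    apply Series_le; [|apply (ex_series_incr_1 (p 1)), ex_series_p1].
    intros n. pose proof (p_ge0 1 (S n) ltac:(lra)). lra. }
  apply is_lim_seq_ext_loc with (fun n => (lam (m n) * Pm (m n))%FS n / U n
     / (((U - cst 1) * (cst (exp 1) * p 1))%FS n / U n)).
  - exists 1%nat. intros n Hn. rewrite <- theta_Pm.
    pose proof (theta_p 1 ltac:(lia)) as Hp. simpl INR in Hp.
    replace ((U - cst 1) * (cst (exp 1) * p 1))%FS with (cst (exp 1) * (cst 1 * ((U - cst 1) * p 1)))%FS by ring.
    rewrite <- Hp, cst_mul_coef. unfold theta.
    assert (Hn' : 0 < INR n) by (apply lt_0_INR; lia). pose proof (U_pos n).
    assert (0 < p 1 n).
    { unfold p. rewrite g_coef by (auto; lra). apply Rmult_lt_0_compat; [apply Rdiv_lt_0_compat; lra|].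
      apply Rmult_lt_0_compat; [auto|apply exp_pos]. }
    field. lra.
  - replace (1 + Series (Gterm' t)) with
      ((1 + Series (Gterm' t)) * (exp 1 * Series (p 1)) / (1 * (exp 1 * Series (p 1)))) by (field; lra).
    apply is_lim_seq_div'; auto. nra.
Qed.

(** * Distribution functions *)

Lemma fold_max_le (f : nat -> Z) z s b :
  (fold_right (fun k acc => Z.max (f k) acc) z s <= b)%Z <->
  (z <= b)%Z /\ (forall k, In k s -> (f k <= b)%Z).
Proof.
  induction s as [|k s IH]; simpl.
  - split; [intros H; split; [auto|intros _ []]|tauto].
  - rewrite Z.max_lub_iff, IH. split.
    + intros [H1 [H2 H3]]. split; auto. intros j [<-|Hj]; auto.
    + intros [H1 H2]. repeat split; auto.
Qed.

(** The seed of the fold is 0 here, because all n letters are at most n; hence it never affects a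
    bound by m >= 0. *)
Lemma maxstat_le n m l : In l (all_seqs n n) ->
  (maxstat n l <= Z.of_nat m)%Z <-> (forall k, In k (seq 1 n) -> (count_le l k <= k + m)%nat).
Proof.
  intros Hl. unfold maxstat. rewrite fold_max_le, (count_le_all _ _ _ Hl). split.
  - intros [_ H] k Hk. specialize (H k Hk). lia.
  - intros H. split; [lia|]. intros k Hk. specialize (H k Hk). lia.
Qed.

Lemma maxstat_ge0 n l : In l (all_seqs n n) -> (0 <= maxstat n l)%Z.
Proof.
  intros Hl. destruct (Z.le_gt_cases 0 (maxstat n l)) as [H|H]; auto.
  unfold maxstat in H. assert (H' : (maxstat n l <= -1)%Z) by (unfold maxstat; lia).
  unfold maxstat in H'. rewrite fold_max_le, (count_le_all _ _ _ Hl) in H'. lia.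
Qed.

Lemma strip_iff m n l :
  strip m n l = true <-> is_pf n l = true /\ (forall k, In k (seq 1 n) -> (count_le l k <= k + m)%nat).
Proof.
  unfold strip, is_pf. rewrite !forallb_forall. split.
  - intros H. split; intros k Hk; specialize (H k Hk); apply andb_prop in H as [H1 H2]; auto.
    apply Nat.leb_le; auto.
  - intros [H1 H2] k Hk. rewrite H1 by auto. simpl. apply Nat.leb_le; auto.
Qed.

Lemma PF_count n : INR (length (PF n)) = cnt (strip n n) (all_seqs n n).
Proof.
  unfold PF. change (cnt (is_pf n) (all_seqs n n) = cnt (strip n n) (all_seqs n n)).
  apply cnt_ext; intros l Hl. apply Bool.eq_iff_eq_true. rewrite strip_iff.
  split; [|tauto]. intros H; split; auto. intros k Hk.
  assert (Hc : forall q, (count_le q k <= length q)%nat).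
  { intros q. apply filter_length_le. }
  specialize (Hc l). apply all_seqs_spec in Hl as [Hl _]. lia.
Qed.

Lemma filter_filter_length {A : Type} (f h : A -> bool) l :
  length (filter f (filter h l)) = length (filter (fun x => h x && f x) l).
Proof.
  induction l as [|x l IH]; [reflexivity|]. simpl.
  destruct (h x); simpl; [destruct (f x); simpl; rewrite IH|]; auto.
Qed.

Lemma Xn_le n t l : (1 <= n)%nat -> Xn n l <= t <-> IZR (maxstat n l) <= t * sqrt (INR n).
Proof.
  intros Hn. assert (Hs : 0 < sqrt (INR n)) by (apply sqrt_lt_R0, lt_0_INR; lia).
  unfold Xn. split; intros H.
  - replace (IZR (maxstat n l)) with (IZR (maxstat n l) / sqrt (INR n) * sqrt (INR n)) by (field; lra).
    apply Rmult_le_compat_r; lra.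
  - apply div_le_l; auto.
Qed.

Lemma p1_pos n : 0 < p 1 n.
Proof.
  unfold p. pose proof (pos_INR n).
  apply Rmult_lt_0_compat; [apply Rdiv_lt_0_compat; lra|].
  unfold g, abel_term. apply Rmult_lt_0_compat; [|apply exp_pos].
  apply Rdiv_lt_0_compat; [apply pow_lt; lra|apply INR_fact_lt_0].
Qed.

(** The statistic is an integer, so the threshold may be rounded down to m. The weights e^(-n)/n!
    cancel in the quotient, and [Pm_low] evaluates the denominator. *)
Lemma cdf_eq n t m : (1 <= n)%nat -> INR m <= t * sqrt (INR n) < INR m + 1 ->
  cdf_n n t = Pm m n / (exp 1 * p 1 n).
Proof.
  intros Hn Hm. unfold cdf_n. rewrite PF_count.
  assert (E : INR (length (filter (fun l => if Rle_dec (Xn n l) t then true else false) (PF n)))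
    = cnt (strip m n) (all_seqs n n)).
  { unfold PF. rewrite filter_filter_length.
    change (cnt (fun l => is_pf n l && (if Rle_dec (Xn n l) t then true else false)) (all_seqs n n)
      = cnt (strip m n) (all_seqs n n)).
    apply cnt_ext; intros l Hl. apply Bool.eq_iff_eq_true.
    rewrite strip_iff, <- maxstat_le by auto. rewrite Bool.andb_true_iff.
    assert (H : (if Rle_dec (Xn n l) t then true else false) = true <-> Xn n l <= t)
      by (destruct (Rle_dec (Xn n l) t); split; auto; discriminate).
    rewrite H, Xn_le by auto.
    assert (H' : IZR (maxstat n l) <= t * sqrt (INR n) <-> (maxstat n l <= Z.of_nat m)%Z).
    { rewrite INR_IZR_INZ in Hm. split; intros H0.
      - apply Z.lt_succ_r. apply lt_IZR. rewrite succ_IZR. lra.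
      - apply IZR_le in H0. lra. }
    rewrite H'. tauto. }
  rewrite E. rewrite <- (Pm_low n n) by lia.
  assert (HP : Pm n n <> 0).
  { rewrite Pm_low by lia. pose proof (p1_pos n). pose proof (exp_pos 1). nra. }
  unfold Pm, B, egf in *.
  assert (Hc : cnt (strip n n) (all_seqs n n) <> 0) by (intros Hc; apply HP; rewrite Hc; unfold Rdiv; ring).
  field. repeat split; auto using INR_fact_neq_0. apply Rgt_not_eq, exp_pos.
Qed.

Lemma cdf_neg n t : (1 <= n)%nat -> t < 0 -> cdf_n n t = 0.
Proof.
  intros Hn Ht. unfold cdf_n, PF. rewrite filter_filter_length.
  rewrite (filter_ext_in _ (fun _ => false)).
  - replace (length (filter (fun _ => false) (all_seqs n n))) with O; [simpl; unfold Rdiv; ring|].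
    induction (all_seqs n n); simpl; auto.
  - intros l Hl. destruct (Rle_dec (Xn n l) t) as [H|H]; [|apply Bool.andb_false_r].
    exfalso. apply Xn_le in H; auto. pose proof (IZR_le _ _ (maxstat_ge0 n l Hl)).
    assert (Hs : 0 < sqrt (INR n)) by (apply sqrt_lt_R0, lt_0_INR; lia). nra.
Qed.

(** Maximum 0 leaves only the n! permutations. Here it follows from Q_0 = y/e. *)
Lemma Pm_0 n : Pm 0 n = exp (- INR n).
Proof.
  assert (HQ : Qm 0 = shift (cst (exp (-1)))).
  { unfold Qm. f_equal. apply functional_extensionality; intros k. unfold diag_sum.
    destruct k as [|k].
    - cbn [sum_f_R0 Nat.sub Pprod]. rewrite cst_mul_coef. unfold alpha. simpl. replace (- (1)) with (-1) by ring. field.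
    - rewrite decomp_sum by lia. rewrite sum_eq_R0.
      + cbn [Pprod]. rewrite cst_mul_coef. simpl. ring.
      + intros i Hi. cbn [Pprod Nat.leb]. rewrite cst_mul_coef.
        replace (cst 0 _) with 0; [ring|]. destruct (S k - S i)%nat; reflexivity. }
  assert (H : Pm 0 = (cst 1 + shift (cst (exp (-1)) * Pm 0))%FS).
  { rewrite <- shift_mul, <- HQ. rewrite <- (Pm_Qm 0). ring. }
  induction n as [|n IH]; rewrite H; unfold fadd; simpl shift.
  - simpl. rewrite Ropp_0, exp_0. ring.
  - rewrite cst_mul_coef, IH, <- exp_plus, S_INR. simpl cst. rewrite Rplus_0_l. f_equal. ring.
Qed.

(** At t = 0 the scaling limit does not apply, but the proportion of permutations is exponentially
    small: e^(-n) against a denominator of at least (n+1)^(-2). *)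
Lemma cdf_zero_limit : is_lim_seq (fun n => cdf_n n 0) 0.
Proof.
  apply is_lim_seq_le_le_loc with (fun _ => 0) (fun n => 4096 * / INR (S n)).
  - exists 1%nat. intros n Hn.
    rewrite (cdf_eq n 0 0) by (auto; simpl; lra). rewrite Pm_0.
    pose proof (p1_pos n) as Hp. pose proof (exp_pos 1) as He. pose proof (exp_pos (- INR n)) as Hen.
    assert (Hn' : 1 <= INR n) by (apply (le_INR 1); auto).
    assert (Hs : 0 < sqrt (INR (S n))) by (apply sqrt_lt_R0, lt_0_INR; lia).
    assert (Hs1 : sqrt (INR (S n)) <= INR (S n)).
    { rewrite <- (sqrt_square (INR (S n))) at 2 by apply pos_INR. apply sqrt_le_1_alt.
      rewrite S_INR. nra. }
    assert (H1 : / (INR (S n) ^ 2) <= exp 1 * p 1 n).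
    { unfold p. replace (g 1 n) with (U (S n)).
      2: { unfold U, g. rewrite pow_self_abel. do 2 f_equal. rewrite S_INR. ring. }
      pose proof (U_lower (S n) ltac:(lia)) as HU.
      replace (1 / (1 + INR n)) with (/ INR (S n)) by (rewrite S_INR; field; lra).
      apply Rle_trans with (exp 1 * (/ INR (S n) * (exp (-1) / sqrt (INR (S n))))).
      - replace (exp 1 * (/ INR (S n) * (exp (-1) / sqrt (INR (S n)))))
          with (exp 1 * exp (-1) * / (INR (S n) * sqrt (INR (S n)))) by (field; split; [lra|apply not_0_INR; lia]).
        rewrite <- exp_plus. replace (1 + -1) with 0 by ring. rewrite exp_0, Rmult_1_l.
        apply Rinv_le_contravar; [apply Rmult_lt_0_compat; auto; apply lt_0_INR; lia|].
        replace (INR (S n) ^ 2) with (INR (S n) * INR (S n)) by ring.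
        apply Rmult_le_compat_l; auto using pos_INR.
      - apply Rmult_le_compat_l; [lra|]. apply Rmult_le_compat_l; auto.
        apply Rlt_le, Rinv_0_lt_compat, lt_0_INR; lia. }
    split; [apply Rlt_le, Rdiv_lt_0_compat; nra|].
    assert (Hpos : 0 < INR (S n)) by (apply lt_0_INR; lia).
    apply Rle_trans with (exp (- INR n) * INR (S n) ^ 2).
    + unfold Rdiv. apply Rmult_le_compat_l; [lra|].
      rewrite <- (Rinv_inv (INR (S n) ^ 2)). apply Rinv_le_contravar; auto.
      apply Rinv_0_lt_compat, pow_lt; auto.
    + pose proof (poly_exp_bound (2 * INR n) ltac:(lra)) as Hb.
      replace (2 * INR n / 2) with (INR n) in Hb by field.
      apply (le_div_r _ _ _ Hpos). eapply Rle_trans; [|apply Hb].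
      replace (exp (- INR n) * INR (S n) ^ 2 * INR (S n)) with (INR (S n) ^ 3 * exp (- INR n)) by ring.
      apply Rmult_le_compat_r; [lra|]. rewrite S_INR.
      apply Rle_trans with ((INR n + 1) ^ 4); [apply Rle_pow; [lra|lia]|apply pow_incr; lra].
  - apply is_lim_seq_const.
  - replace (Finite 0) with (Rbar_mult 4096 0) by (simpl; f_equal; ring).
    apply is_lim_seq_scal_l. apply (is_lim_seq_incr_1 (fun n => / INR n)).
    apply (is_lim_seq_inv _ p_infty); [apply is_lim_seq_INR|discriminate].
Qed.

Lemma symmetric_sum (f : Z -> R) N :
  sum_f_R0 (fun j => f (Z.of_nat j - Z.of_nat (S N))%Z) (2 * S N) =
  f 0%Z + sum_f_R0 (fun i => f (Z.of_nat (S i)) + f (- Z.of_nat (S i))%Z) N.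
Proof.
  assert (H : forall N, sum_f_R0 (fun j => f (Z.of_nat j - Z.of_nat (S N))%Z) (2 * S N) =
    f (- Z.of_nat (S N))%Z + f (Z.of_nat (S N)) + sum_f_R0 (fun j => f (Z.of_nat j - Z.of_nat N)%Z) (2 * N)).
  { intros N0. replace (2 * S N0)%nat with (S (S (2 * N0))) by lia.
    rewrite tech5, decomp_sum by lia.
    change (pred (S (2 * N0))) with (2 * N0)%nat.
    replace (Z.of_nat 0 - Z.of_nat (S N0))%Z with (- Z.of_nat (S N0))%Z by lia.
    replace (Z.of_nat (S (S (2 * N0))) - Z.of_nat (S N0))%Z with (Z.of_nat (S N0)) by lia.
    rewrite (sum_eq _ (fun j => f (Z.of_nat j - Z.of_nat N0)%Z)); [ring|].
    intros i Hi. apply (f_equal f). lia. }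
  induction N as [|N IH]; rewrite H.
  - simpl. ring.
  - rewrite IH, tech5. ring.
Qed.

Lemma M_partial_limit t : 0 < t -> is_lim_seq (M_partial t) (1 + Series (Gterm' t)).
Proof.
  intros Ht. apply (is_lim_seq_incr_1 (M_partial t)).
  apply is_lim_seq_ext with (fun N => 1 + sum_f_R0 (Gterm' t) N).
  - intros N. unfold M_partial. rewrite symmetric_sum. f_equal.
    + unfold M_term. replace (- (2 * 0 ^ 2 * t ^ 2)) with 0 by ring. rewrite exp_0. ring.
    + apply sum_eq; intros i Hi. unfold M_term, Gterm'. rewrite opp_IZR, <- INR_IZR_INZ.
      replace ((- INR (S i)) ^ 2) with (INR (S i) ^ 2) by ring. ring.
  - apply is_lim_seq_plus'; [apply is_lim_seq_const|].
    assert (Hex : ex_series (Gterm' t)).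
    { apply ex_series_dominated with (fun i => 8192 / t ^ 2 * / INR (S i) ^ 2).
      - intros i. apply Gterm'_bound; lra.
      - apply ex_series_scal_inv_sqr. }
    apply is_lim_seq_Reals. apply is_series_Reals. apply Series_correct, Hex.
Qed.

Lemma cdf_limit t : 0 < t -> is_lim_seq (fun n => cdf_n n t) (1 + Series (Gterm' t)).
Proof.
  (* This m is the floor of t sqrt n, the rounding that [cdf_eq] expects. *)
  intros Ht. set (m := fun n : nat => (ceil (t * sqrt (INR n)) - 1)%nat).
  assert (Hm : forall n, (1 <= n)%nat -> INR (m n) <= t * sqrt (INR n) < INR (m n) + 1).
  { intros n Hn. assert (Hs : 0 < sqrt (INR n)) by (apply sqrt_lt_R0, lt_0_INR; lia).
    destruct (ceil_spec (t * sqrt (INR n))) as [H1 H2]; [apply Rmult_le_pos; lra|].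
    assert (Hc : (1 <= ceil (t * sqrt (INR n)))%nat).
    { apply INR_lt. simpl (INR 0). apply Rle_lt_trans with (t * sqrt (INR n)); auto. apply Rmult_le_pos; lra. }
    unfold m. rewrite minus_INR by auto. simpl (INR 1). lra. }
  apply is_lim_seq_ext_loc with (fun n => Pm (m n) n / (exp 1 * p 1 n)).
  - exists 1%nat. intros n Hn. rewrite (cdf_eq n t (m n)); auto.
  - apply Pm_ratio_limit; auto.
    apply is_lim_seq_le_le_loc with (fun n => t - / sqrt (INR n)) (fun _ => t).
    + exists 1%nat. intros n Hn. specialize (Hm n Hn).
      assert (Hs : 0 < sqrt (INR n)) by (apply sqrt_lt_R0, lt_0_INR; lia).
      split; [|apply div_le_l; lra].
      apply le_div_r; auto. rewrite Rmult_minus_distr_r, Rinv_l; lra.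
    + replace (Finite t) with (Finite (t - 0)) by (f_equal; ring).
      apply is_lim_seq_minus'; [apply is_lim_seq_const|apply inv_sqrt_lim].
    + apply is_lim_seq_const.
Qed.

(* Convergence in distribution, stated as pointwise convergence of the CDFs at
   every real t (the limit CDF is continuous everywhere, equal to 0 on t <= 0
   and to the doubly-infinite series for t > 0). *)
Theorem theorem12 :
  forall t : R,
    (t <= 0 -> Un_cv (fun n => cdf_n n t) 0) /\
    (0 < t -> exists L : R, Un_cv (M_partial t) L /\ Un_cv (fun n => cdf_n n t) L).
Proof.
  intros t. split.
  - intros [Ht|Ht]; apply is_lim_seq_Reals.
    + apply is_lim_seq_ext_loc with (fun _ => 0); [|apply is_lim_seq_const].
      exists 1%nat. intros n Hn. rewrite cdf_neg; auto.
    + rewrite Ht. apply cdf_zero_limit.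
  - intros Ht. exists (1 + Series (Gterm' t)). split; apply is_lim_seq_Reals.
    + apply M_partial_limit, Ht.
    + apply cdf_limit, Ht.
Qed.
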